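(* Let $(z,z')$ be admissible and $t=zz'$. Then $$\sigma^{(zz')}_1=\Gamma(t+1)\,\big(\phi_{z,-z}*\phi^{(-)}_{-z',z'}\big)\odot\phi_{1,t-2},$$ and consequently the first correlation (density) measure of the process $\mathcal P_{zz'}$ is, for $x\neq0$, $$\rho^{(zz')}_1(x)=\frac{\Gamma(t+1)}{|x|}\Big\{\big(\phi_{z,-z}*\phi^{(-)}_{-z',z'}\big)\odot\phi_{1,t-2}\Big\}(x).$$
   Context: Admissible parameters: either $z'=\bar z$, $z\notin\mathbb Z$, or $z,z'$ real in a common interval $(m,m+1)$, $m\in\mathbb Z$. $\sigma^{(zz')}_1$ is the first controlling measure of the spectral $z$-measure $P_{zz'}$ on the Thoma simplex; it is the unique measure on $[-1,1]$ with moments $\int x^l\sigma^{(zz')}_1(dx)=\sum_{p+q=l,\ p,q\ge0}\frac{(-1)^q\,t\,(z+1)_p(-z+1)_q(z'+1)_p(-z'+1)_q}{(t)_{p+q+1}(p+q+1)p!q!}$, $l\ge0$, and the density measure of the associated point process $\mathcal P_{zz'}$ on $I=[-1,1]\setminus\{0\}$ (random configuration of nonzero $\alpha_i$ and $-\beta_j$) is $\rho^{(zz')}_1=|x|^{-1}\sigma^{(zz')}_1|_I$. For $a\in\mathbb C$, $\phi_a(u)=u_+^a/\Gamma(a+1)$ (distribution on $\mathbb R$, analytically continued in $a$); $\phi_{ab}(u)=\phi_a(u)\phi_b(1-u)$; $\phi^{(-)}_{ab}(u)=\phi_{ab}(-u)$; $*$ is additive convolution; for compactly supported distributions, $\langle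 A\odot B,\psi\rangle=\langle A(y_1)\otimes B(y_2),\psi(y_1y_2)\rangle$. *)

(* Defs.v *)
From Stdlib Require Import Reals ClassicalEpsilon Factorial.
From Coquelicot Require Import Coquelicot.

Local Open Scope R_scope.
Local Open Scope C_scope.

Definition inhC : inhabited C := inhabits (RtoC 0).
Definition inhCC : inhabited (C -> C -> C) := inhabits (fun _ _ => RtoC 0).

Definition cpow (u : R) (a : C) : C :=
  if Rlt_dec 0 u then
    (exp (Re a * ln u) * cos (Im a * ln u), exp (Re a * ln u) * sin (Im a * ln u))%R
  else RtoC 0.

Fixpoint poch (a : C) (n : nat) : C :=
  match n with
  | O => RtoC 1
  | S m => poch a m * (a + RtoC (INR m))
  end.

(* Reciprocal Gamma function 1/Gamma(s), an entire function, defined by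
   Gauss's formula  1/Gamma(s) = lim_n s(s+1)...(s+n) / (n! n^s). *)
Definition rgamma (s : C) : C :=
  epsilon inhC (fun l => filterlim
    (fun n : nat => poch s (S n) / (RtoC (INR (fact n)) * cpow (INR n) s))
    eventually (locally l)).

(* Gamma(s) = 1 / (1/Gamma(s))  (used only at points which are not poles). *)
Definition cgamma (s : C) : C := / rgamma s.

(* Distributions: (complex-linear) functionals on complex test functions R -> C.
   All distributions used here have compact support, so they act on all
   smooth functions (test space C^infty(R)). *)
Definition distr := (R -> C) -> C.

Definition smooth (psi : R -> C) : Prop :=
  forall (n : nat) (x : R),
    ex_derive_n (fun u => Re (psi u)) n x /\ ex_derive_n (fun u => Im (psi u)) n x.

Definition entire2 (G : C -> C -> C) : Prop :=
  (forall a b : C, ex_derive (K := C_AbsRing) (V := C_NormedModule) (fun x => G x b) a) /\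
  (forall a b : C, ex_derive (K := C_AbsRing) (V := C_NormedModule) (fun y => G a y) b).

(* phi_{ab}(u) = phi_a(u) phi_b(1-u) = u_+^a (1-u)_+^b / (Gamma(a+1) Gamma(b+1)),
   as a distribution, analytically continued in (a,b) from the region
   Re a > -1, Re b > -1 where it is the (improper) integral
   int_0^1 u^a (1-u)^b psi(u) du / (Gamma(a+1)Gamma(b+1)).
   The value at (a,b) is the value of the (unique, by the identity theorem)
   function entire in a and in b which agrees with that integral. *)
Definition phi2_cont_prop (psi : R -> C) (G : C -> C -> C) : Prop :=
  entire2 G /\
  forall a b : C, (-1 < Re a)%R -> (-1 < Re b)%R ->
    is_RInt_gen (V := C_R_NormedModule)
      (fun u => rgamma (a + RtoC 1) * rgamma (b + RtoC 1)
                * cpow u a * cpow (1 - u) b * psi u)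
      (at_right 0) (at_left 1) (G a b).

Definition phi2 (a b : C) : distr :=
  fun psi => epsilon inhCC (phi2_cont_prop psi) a b.

Definition phi2m (a b : C) : distr := fun psi => phi2 a b (fun u => psi (- u)%R).

Definition dconv (A B : distr) : distr :=
  fun psi => A (fun y1 => B (fun y2 => psi (y1 + y2)%R)).

Definition dmconv (A B : distr) : distr :=
  fun psi => A (fun y1 => B (fun y2 => psi (y1 * y2)%R)).

Definition admissible (z z' : C) : Prop :=
  (z' = (Re z, (- Im z)%R) /\ ~ (exists m : Z, z = RtoC (IZR m)))
  \/
  (Im z = 0%R /\ Im z' = 0%R /\
   exists m : Z, (IZR m < Re z < IZR m + 1)%R /\ (IZR m < Re z' < IZR m + 1)%R).

Definition sigma1_moment (z z' : C) (l : nat) : C :=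
  let t := z * z' in
  sum_n (fun p =>
     let q := (l - p)%nat in
     RtoC ((-1) ^ q) * t * poch (z + RtoC 1) p * poch (- z + RtoC 1) q
       * poch (z' + RtoC 1) p * poch (- z' + RtoC 1) q
       / (poch t (p + q + 1) * RtoC (INR (p + q + 1)) * RtoC (INR (fact p))
          * RtoC (INR (fact q)))) l.

Definition rhs_distr (z z' : C) : distr :=
  let t := z * z' in
  dmconv (dconv (phi2 z (- z)) (phi2m (- z') z')) (phi2 (RtoC 1) (t - RtoC 2)).

Definition div_abs (psi : R -> C) : R -> C :=
  fun x => if Req_EM_T x 0 then RtoC 0 else RtoC (/ Rabs x) * psi x.

From mathcomp Require Import all_boot all_algebra all_classical all_reals.
From mathcomp Require Import all_analysis Rstruct Rstruct_topology.

Local Open Scope classical_set_scope.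
Local Open Scope ring_scope.

(* sigma is a (positive Borel) measure on R, concentrated on [-1,1],
   with the moments of sigma_1^{(zz')}; by the paper this determines
   sigma = sigma_1^{(zz')} uniquely. *)
Definition is_sigma1 (z z' : C) (sigma : {measure set (measurableTypeR R) -> \bar R}) : Prop :=
  sigma [set x : R | (x < -1)%R \/ (1 < x)%R] = 0%E /\
  forall l : nat,
    (\int[sigma]_x (pow x l)%:E = (Coquelicot.Complex.Re (sigma1_moment z z' l))%:E)%E /\
    Coquelicot.Complex.Im (sigma1_moment z z' l) = 0%R.

Definition pair_measure (sigma : {measure set (measurableTypeR R) -> \bar R}) (psi : R -> C) : C :=
  (fine (\int[sigma]_x (Coquelicot.Complex.Re (psi x))%:E)%E,
   fine (\int[sigma]_x (Coquelicot.Complex.Im (psi x))%:E)%E).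

Definition Iset : set R := [set x : R | x <> 0%R /\ (-1 <= x)%R /\ (x <= 1)%R].

(* <rho, psi> for rho = |x|^{-1} sigma restricted to I. *)
Definition pair_density (sigma : {measure set (measurableTypeR R) -> \bar R}) (psi : R -> C) : C :=
  (fine (\int[sigma]_(x in Iset) (Coquelicot.Complex.Re (psi x) / Rabs x)%:E)%E,
   fine (\int[sigma]_(x in Iset) (Coquelicot.Complex.Im (psi x) / Rabs x)%:E)%E).

(* Test functions on R \ {0}: smooth and vanishing near 0. *)
Definition vanishes_near0 (psi : R -> C) : Prop :=
  exists delta : R, (0 < delta)%R /\ forall x : R, (Rabs x < delta)%R -> psi x = RtoC 0.

(* Main.v *)
(* Idea. Both sides are linear functionals of the test function that are
   continuous for a C^K norm on a bounded interval, so, polynomials being dense,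
   it suffices to compare moments.

   The pairing of [phi_ab] with a test function is continued to all (a, b) by
   repeatedly trading one unit of both exponents for a derivative of the test
   function; the identity theorem, proved from Goursat's and Cauchy's theorems,
   makes this continuation the one selected in [phi2].  Euler's Beta integral gives
   <phi_ab, u^l> = (a+1)_l / Gamma(a+b+l+2).  The moments of an additive convolution
   expand by the binomial theorem and those of a multiplicative one are products;
   the resulting sum is matched with [sigma1_moment] by a 3F2-type transformation
   resting on Vandermonde's identity.

   For the density, [psi / |x|] is again smooth when [psi] vanishes near 0. *)
Require Import Defs.
From Stdlib Require Import Reals ZArith Lra Lia Psatz ClassicalEpsilon Factorial FunctionalExtensionality.
From Coquelicot Require Import Coquelicot.
From mathcomp Require Import ssreflect.

Local Open Scope R_scope.
Local Open Scope general_if_scope.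

(** * Complex-valued calculus *)

(** The shaping obstacle is that [phi2] is chosen by [epsilon]: its value at a test function is
    known only once an entire continuation for that very function has been exhibited and shown
    unique. In the nested convolutions the outer [phi2] is applied to functions produced by the
    inner ones. These must therefore be shown smooth in turn, and each inner pairing is realised as
    an operator on whole sequences of derivatives, bounded by finitely many of them on an explicit
    interval.

    Weights u^a (1-u)^b are integrated directly only for exponents of positive real part, where they
    are continuous on the whole line; all other exponents, including those whose improper integral
    converges, are reached by continuation.

    Admissibility enters through Re (z z') > 0, which keeps 1 / Gamma (t + 1) and the Pochhammer
    symbols (t)_n away from zero. The zeroth moment makes the measure finite. *)

Lemma im_le_Cmod (c : C) : Rabs (Im c) <= Cmod c.
Proof.
  have := Rmax_Cmod c; have := Rmax_r (Rabs (fst c)) (Rabs (snd c)).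
  rewrite /Im; lra.
Qed.

Lemma Cmod_le_ReIm (c : C) : Cmod c <= Rabs (Re c) + Rabs (Im c).
Proof.
  have -> : c = (RtoC (Re c) + Ci * RtoC (Im c))%C.
    destruct c as [x y]; apply injective_projections; simpl; ring.
  have := Cmod_triangle (RtoC (Re c)) (Ci * RtoC (Im c)).
  rewrite Cmod_mult Cmod_Ci !Cmod_R.
  rewrite /Re /Im /=; ring_simplify ((0 * fst c));
  intros H; eapply Rle_trans; [exact H|]; right; f_equal; [f_equal; ring|].
  rewrite Rmult_1_l; f_equal; ring.
Qed.

Lemma Cmod_triangle_minus (x y : C) : Cmod (x - y) <= Cmod x + Cmod y.
Proof. have := Cmod_triangle x (- y); rewrite Cmod_opp; auto. Qed.

Lemma Cmod_triangle_rev (x y : C) : Cmod x - Cmod y <= Cmod (x - y).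
Proof.
  have := Cmod_triangle (x - y) y.
  have -> : (x - y + y)%C = x by ring. lra.
Qed.

Lemma Cmod_minus_sym (x y : C) : Cmod (x - y) = Cmod (y - x).
Proof. rewrite -Cmod_opp; f_equal; ring. Qed.

(** The factor [M] lets callers keep whatever constant their estimate produces instead of rescaling
    [eps]. *)
Lemma C_eq_of_Cmod_small (x y : C) (M : R) :
  (forall eps, 0 < eps -> Cmod (x - y) <= M * eps) -> x = y.
Proof.
  intros H.
  have M0 : 0 <= M by have := H 1 Rlt_0_1; have := Cmod_ge_0 (x - y); lra.
  apply Ceq_minus, Cmod_eq_0.
  apply Rle_antisym; [|apply Cmod_ge_0].
  apply le_epsilon => e he.
  have h1 : 0 < e / (M + 1) by apply Rdiv_lt_0_compat; lra.
  have := H _ h1.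
  have : M * (e / (M + 1)) <= e.
    apply (Rmult_le_reg_r (M + 1)); [lra|].
    field_simplify; nra.
  lra.
Qed.

Lemma continuousC {U : UniformSpace} (f : U -> C) x :
  continuous (fun t => Re (f t)) x -> continuous (fun t => Im (f t)) x ->
  continuous f x.
Proof.
  intros H1 H2.
  apply (continuous_ext (fun t => (Re (f t), Im (f t)))).
    by intros y; destruct (f y).
  apply (continuous_comp_2 (fun t => Re (f t)) (fun t => Im (f t)) (fun a b => (a, b)) x H1 H2).
  eapply filterlim_ext; [|apply filterlim_id]. by intros [u v].
Qed.

Lemma continuous_Re {U : UniformSpace} (f : U -> C) x :
  continuous f x -> continuous (fun t => Re (f t)) x.
Proof. intros H; apply (continuous_comp f fst x H); apply continuous_fst. Qed.

Lemma continuous_Im {U : UniformSpace} (f : U -> C) x :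
  continuous f x -> continuous (fun t => Im (f t)) x.
Proof. intros H; apply (continuous_comp f snd x H); apply continuous_snd. Qed.

Section ContinuousC.
Context {U : UniformSpace}.
Implicit Types (f g : U -> C).

Lemma continuousC_plus f g x :
  continuous f x -> continuous g x -> continuous (fun t => f t + g t)%C x.
Proof.
  intros Hf Hg; apply continuousC; simpl;
  apply (continuous_plus (V := R_NormedModule)); auto using continuous_Re, continuous_Im.
Qed.

Lemma continuousC_opp f x : continuous f x -> continuous (fun t => - f t)%C x.
Proof.
  intros Hf; apply continuousC; simpl;
  apply (continuous_opp (V := R_NormedModule)); auto using continuous_Re, continuous_Im.
Qed.

Lemma continuousC_minus f g x :
  continuous f x -> continuous g x -> continuous (fun t => f t - g t)%C x.
Proof. by intros Hf Hg; apply continuousC_plus => //; apply continuousC_opp. Qed.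

Lemma continuousC_mult f g x :
  continuous f x -> continuous g x -> continuous (fun t => f t * g t)%C x.
Proof.
  intros Hf Hg; apply continuousC; simpl.
  - apply (continuous_minus (V := R_NormedModule));
    apply (continuous_mult (K := R_AbsRing));
    by [apply: continuous_Re | apply: continuous_Im].
  - apply (continuous_plus (V := R_NormedModule));
    apply (continuous_mult (K := R_AbsRing));
    by [apply: continuous_Re | apply: continuous_Im].
Qed.

Lemma continuousC_RtoC (f : U -> R) x :
  continuous f x -> continuous (fun t => RtoC (f t)) x.
Proof. intros Hf; apply continuousC; simpl => //; apply continuous_const. Qed.

Lemma continuousC_inv f x :
  f x <> 0%C -> continuous f x -> continuous (fun t => / f t)%C x.
Proof.
  intros H0 Hf.
  have Hr := continuous_Re f x Hf. have Hi := continuous_Im f x Hf.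
  have Hd : continuous (fun t => / (Re (f t) * Re (f t) + Im (f t) * Im (f t))) x.
    apply (continuous_comp (fun t => Re (f t) * Re (f t) + Im (f t) * Im (f t)) Rinv).
      apply (continuous_plus (V := R_NormedModule));
      by apply (continuous_mult (K := R_AbsRing)).
    apply continuous_Rinv => E; apply H0.
    apply injective_projections; rewrite /= -/(Re (f x)) -/(Im (f x)); nra.
  apply continuousC.
  - apply (continuous_ext (fun t => Re (f t) * / (Re (f t) * Re (f t) + Im (f t) * Im (f t)))).
      by intros t; rewrite /Re /Im /= !Rmult_1_r.
    by apply (continuous_mult (K := R_AbsRing)).
  - apply (continuous_ext (fun t => - Im (f t) * / (Re (f t) * Re (f t) + Im (f t) * Im (f t)))).
      by intros t; rewrite /Re /Im /= !Rmult_1_r.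
    apply (continuous_mult (K := R_AbsRing)) => //.
    by apply (continuous_opp (V := R_NormedModule)).
Qed.

Lemma continuousC_pow f n x : continuous f x -> continuous (fun t => f t ^ n)%C x.
Proof.
  intros Hf; induction n; simpl; [apply continuous_const|].
  by apply continuousC_mult.
Qed.

End ContinuousC.

Ltac contC := repeat match goal with
  | |- continuous (fun _ => ?k) _ => apply continuous_const
  | |- continuous (fun x => x) _ => apply continuous_id
  | |- continuous (fun x => Cplus _ _) _ => apply continuousC_plus
  | |- continuous (fun x => Cminus _ _) _ => apply continuousC_minus
  | |- continuous (fun x => Cmult _ _) _ => apply continuousC_mult
  | |- continuous (fun x => Copp _) _ => apply continuousC_opp
  | |- continuous (fun x => Cpow _ _) _ => apply continuousC_pow
  | |- continuous (fun x => RtoC _) _ => apply continuousC_RtoC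
  | |- continuous RtoC _ => apply (continuousC_RtoC (fun x => x))
  | |- continuous _ _ => assumption
  end.

Lemma ball_C_Cmod (x y : C) (e : R) : Cmod (y - x) < e -> ball x e y.
Proof.
  intros H; split; simpl.
  - apply Rle_lt_trans with (2 := H). apply (re_le_Cmod (y - x)).
  - apply Rle_lt_trans with (2 := H). apply (im_le_Cmod (y - x)).
Qed.

Lemma Cmod_ball_C (x y : C) (e : R) : ball x e y -> Cmod (y - x) < 2 * e.
Proof.
  intros [H1 H2]. have := Cmod_le_ReIm (y - x).
  rewrite /Re /Im /=.
  have h1 : Rabs (fst y - fst x) < e by apply H1.
  have h2 : Rabs (snd y - snd x) < e by apply H2.
  rewrite /Rminus in h1 h2; lra.
Qed.

Lemma locally_C (x : C) (P : C -> Prop) :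
  locally x P <-> exists d, 0 < d /\ forall y, Cmod (y - x) < d -> P y.
Proof.
  split.
  - intros [d Hd]; exists d; split; [apply cond_pos|]. intros y Hy; apply Hd.
    by apply ball_C_Cmod.
  - intros [d [d0 Hd]].
    have d2 : 0 < d / 2 by lra.
    exists (mkposreal _ d2) => y Hy; apply Hd. have := Cmod_ball_C _ _ _ Hy; simpl; lra.
Qed.

Lemma locally_R (x : R) (P : R -> Prop) :
  locally x P <-> exists d, 0 < d /\ forall y, Rabs (y - x) < d -> P y.
Proof.
  split.
  - intros [d Hd]; exists d; split; [apply cond_pos|]. intros y Hy; by apply Hd.
  - intros [d [d0 Hd]]. exists (mkposreal _ d0) => y Hy; by apply Hd.
Qed.

Lemma filterlim_to_C {T} (F : (T -> Prop) -> Prop) {FF : Filter F} (f : T -> C) (l : C) :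
  filterlim f F (locally l) <-> forall eps, 0 < eps -> F (fun t => Cmod (f t - l) < eps).
Proof.
  split.
  - intros H eps e0. apply (H (fun y => Cmod (y - l) < eps)). apply locally_C. by exists eps.
  - intros H P HP. apply locally_C in HP. destruct HP as [d [d0 Hd]].
    rewrite /filtermap. by apply: filter_imp (H d d0) => t Ht; apply Hd.
Qed.

Lemma continuous_RC (f : R -> C) x :
  continuous f x <-> forall eps, 0 < eps -> exists d, 0 < d /\
    forall y, Rabs (y - x) < d -> Cmod (f y - f x) < eps.
Proof.
  rewrite /continuous filterlim_to_C.
  by split => H e e0; move: (H e e0); rewrite locally_R.
Qed.

Lemma continuous_CC (f : C -> C) x :
  continuous f x <-> forall eps, 0 < eps -> exists d, 0 < d /\
    forall y, Cmod (y - x) < d -> Cmod (f y - f x) < eps.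
Proof.
  rewrite /continuous filterlim_to_C.
  by split => H e e0; move: (H e e0); rewrite locally_C.
Qed.

(** Caratheodory's form of differentiability: the difference quotient is a function [q] continuous
    at 0. Sum, product and chain rules become identities between such quotients, with no
    epsilons. *)
Definition cdiff (f : C -> C) (c l : C) :=
  exists q : C -> C, (forall h, f (c + h) = f c + h * q h)%C /\ continuous q (RtoC 0) /\ q (RtoC 0) = l.

Definition rdiff (f : R -> C) (x : R) (l : C) :=
  exists q : R -> C, (forall h, f (x + h)%R = f x + RtoC h * q h)%C /\ continuous q 0 /\ q 0 = l.

Lemma cdiff_intro (f : C -> C) (c : C) (l : C) :
  (forall eps, 0 < eps -> exists d, 0 < d /\ forall h, Cmod h < d ->
     Cmod (f (c + h)%C - f c - h * l) <= eps * Cmod h) -> cdiff f c l.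
Proof.
  intros H.
  exists (fun h => if Ceq_dec h 0 then l else ((f (c + h)%C - f c) / h)%C).
  split; [|split].
  - intros h; destruct (Ceq_dec h 0) as [->|n]; [|field; auto].
    rewrite Cplus_0_r; ring.
  - apply continuous_CC => e e0.
    have e2 : 0 < e / 2 by lra.
    destruct (H _ e2) as [d [d0 Hd]]; exists d; split => // h Hh.
    destruct (Ceq_dec 0 0); [|tauto].
    destruct (Ceq_dec h 0) as [->|n].
      have -> : (l - l)%C = 0 by ring. rewrite Cmod_0; lra.
    have Hm : 0 < Cmod h by apply Cmod_gt_0.
    have -> : ((f (c + h)%C - f c) / h - l = (f (c + h)%C - f c - h * l) / h)%C by field.
    rewrite Cmod_div //.
    have h1 : Cmod h < d by move: Hh; have -> : (h - 0 = h)%C by ring.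
    have := Hd h h1 => H2.
    apply Rle_lt_trans with (e / 2); [|lra].
    apply (Rmult_le_reg_r (Cmod h)) => //.
    rewrite /Rdiv Rmult_assoc Rinv_l; [|lra]. by rewrite Rmult_1_r.
  - destruct (Ceq_dec 0 0); tauto.
Qed.

Lemma cdiff_elim (f : C -> C) (c : C) (l : C) : cdiff f c l ->
  forall eps, 0 < eps -> exists d, 0 < d /\ forall h, Cmod h < d ->
     Cmod (f (c + h)%C - f c - h * l) <= eps * Cmod h.
Proof.
  intros [q [Hq [Cq <-]]] eps e0.
  destruct (proj1 (continuous_CC _ _) Cq eps e0) as [d [d0 Hd]].
  exists d; split => // h Hh.
  have -> : (f (c + h)%C - f c - h * q 0 = h * (q h - q 0))%C by rewrite Hq; ring.
  rewrite Cmod_mult Rmult_comm; apply Rmult_le_compat_r; [apply Cmod_ge_0|].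
  left; apply Hd. by have -> : (h - 0 = h)%C by ring.
Qed.

Lemma rdiff_intro (f : R -> C) (x : R) (l : C) :
  (forall eps, 0 < eps -> exists d, 0 < d /\ forall h, Rabs h < d ->
     Cmod (f (x + h)%R - f x - RtoC h * l) <= eps * Rabs h) -> rdiff f x l.
Proof.
  intros H.
  exists (fun h => if Req_EM_T h 0 then l else ((f (x + h)%R - f x) / RtoC h)%C).
  split; [|split].
  - intros h; destruct (Req_EM_T h 0) as [->|n].
      rewrite Rplus_0_r; ring.
    field; intros E; apply n; by apply RtoC_inj.
  - apply continuous_RC => e e0.
    have e2 : 0 < e / 2 by lra.
    destruct (H _ e2) as [d [d0 Hd]]; exists d; split => // h Hh.
    destruct (Req_EM_T 0 0); [|tauto].
    destruct (Req_EM_T h 0) as [->|n].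
      have -> : (l - l)%C = 0 by ring. rewrite Cmod_0; lra.
    have nC : RtoC h <> 0%C by intros E; apply n, RtoC_inj.
    have Hm : 0 < Rabs h by apply Rabs_pos_lt.
    have -> : ((f (x + h)%R - f x) / h - l = (f (x + h)%R - f x - h * l) / h)%C by field.
    rewrite Cmod_div // Cmod_R.
    have h1 : Rabs h < d by rewrite Rminus_0_r in Hh.
    have := Hd h h1 => H2.
    apply Rle_lt_trans with (e / 2); [|lra].
    apply (Rmult_le_reg_r (Rabs h)) => //.
    rewrite /Rdiv Rmult_assoc Rinv_l; [|lra]. by rewrite Rmult_1_r.
  - destruct (Req_EM_T 0 0); tauto.
Qed.

Lemma rdiff_elim (f : R -> C) (x : R) (l : C) : rdiff f x l ->
  forall eps, 0 < eps -> exists d, 0 < d /\ forall h, Rabs h < d ->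
     Cmod (f (x + h)%R - f x - RtoC h * l) <= eps * Rabs h.
Proof.
  intros [q [Hq [Cq <-]]] eps e0.
  destruct (proj1 (continuous_RC _ _) Cq eps e0) as [d [d0 Hd]].
  exists d; split => // h Hh.
  have -> : (f (x + h)%R - f x - RtoC h * q 0 = RtoC h * (q h - q 0))%C by rewrite Hq; ring.
  rewrite Cmod_mult Cmod_R Rmult_comm; apply Rmult_le_compat_r; [apply Rabs_pos|].
  left; apply Hd. by rewrite Rminus_0_r.
Qed.

(** A remainder of second order with an explicit constant passes through an integral over a
    parameter, the constant being merely multiplied by the length of the interval. *)
Lemma cdiff_of_quadratic (f : C -> C) (c : C) (l : C) (M : R) (d : R) : 0 < d ->
  (forall h, Cmod h < d -> Cmod (f (c + h)%C - f c - h * l) <= M * (Cmod h * Cmod h)) -> cdiff f c l.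
Proof.
  intros d0 H; apply cdiff_intro => e e0.
  have hM := Rabs_pos M.
  have h1 : 0 < e / (Rabs M + 1) by apply Rdiv_lt_0_compat; lra.
  exists (Rmin d (e / (Rabs M + 1))); split; [by apply Rmin_pos|].
  intros h Hh.
  have hm := Cmod_ge_0 h.
  have Ha := Rlt_le_trans _ _ _ Hh (Rmin_l _ _).
  have Hb := Rlt_le_trans _ _ _ Hh (Rmin_r _ _).
  have H1 : (Rabs M + 1) * Cmod h <= e.
    left; apply (Rmult_lt_reg_r (/ (Rabs M + 1))); [apply Rinv_0_lt_compat; lra|].
    replace ((Rabs M + 1) * Cmod h * / (Rabs M + 1)) with (Cmod h) by (field; lra). exact Hb.
  have := H h Ha; have := Rle_abs M. nra.
Qed.

Lemma rdiff_of_quadratic (f : R -> C) (c : R) (l : C) (M : R) (d : R) : 0 < d ->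
  (forall h, Rabs h < d -> Cmod (f (c + h)%R - f c - RtoC h * l) <= M * (Rabs h * Rabs h)) -> rdiff f c l.
Proof.
  intros d0 H; apply rdiff_intro => e e0.
  have hM := Rabs_pos M.
  have h1 : 0 < e / (Rabs M + 1) by apply Rdiv_lt_0_compat; lra.
  exists (Rmin d (e / (Rabs M + 1))); split; [by apply Rmin_pos|].
  intros h Hh.
  have hm := Rabs_pos h.
  have Ha := Rlt_le_trans _ _ _ Hh (Rmin_l _ _).
  have Hb := Rlt_le_trans _ _ _ Hh (Rmin_r _ _).
  have H1 : (Rabs M + 1) * Rabs h <= e.
    left; apply (Rmult_lt_reg_r (/ (Rabs M + 1))); [apply Rinv_0_lt_compat; lra|].
    replace ((Rabs M + 1) * Rabs h * / (Rabs M + 1)) with (Rabs h) by (field; lra). exact Hb.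
  have := H h Ha; have := Rle_abs M. nra.
Qed.

Lemma rdiff_eq (f : R -> C) (x : R) (l m : C) : rdiff f x l -> l = m -> rdiff f x m.
Proof. by intros H <-. Qed.

Lemma cdiff_ext (f : C -> C) (g : C -> C) (c : C) (l : C) : (forall z, f z = g z) -> cdiff f c l -> cdiff g c l.
Proof. intros E [q [Hq H]]; exists q; split => // h; by rewrite -!E. Qed.

Lemma cdiff_ext_loc (f : C -> C) (g : C -> C) (c : C) (l : C) :
  locally c (fun z => f z = g z) -> cdiff f c l -> cdiff g c l.
Proof.
  intros E H; apply cdiff_intro => e e0.
  destruct (proj1 (locally_C _ _) E) as [d1 [d10 Hd1]].
  destruct (cdiff_elim _ _ _ H e e0) as [d2 [d20 Hd2]].
  exists (Rmin d1 d2); split; [by apply Rmin_pos|] => h Hh.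
  have Ha := Rlt_le_trans _ _ _ Hh (Rmin_l _ _).
  have Hb := Rlt_le_trans _ _ _ Hh (Rmin_r _ _).
  rewrite -Hd1. rewrite -Hd1; [by apply Hd2|].
    have -> : (c - c)%C = 0 by ring. by rewrite Cmod_0.
  by have -> : (c + h - c)%C = h by ring.
Qed.

Lemma cdiff_const (k : C) (c : C) : cdiff (fun _ => k) c 0%C.
Proof. exists (fun _ => 0%C); split; [intros; ring|split => //; apply continuous_const]. Qed.

Lemma cdiff_id (c : C) : cdiff (fun z => z) c 1%C.
Proof. exists (fun _ => 1%C); split; [intros; ring|split => //; apply continuous_const]. Qed.

Lemma cdiff_plus (f : C -> C) (g : C -> C) (c : C) (l : C) (m : C) :
  cdiff f c l -> cdiff g c m -> cdiff (fun z => f z + g z)%C c (l + m)%C.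
Proof.
  intros [p [Hp [Cp <-]]] [q [Hq [Cq <-]]]; exists (fun h => p h + q h)%C.
  split; [intros h; rewrite Hp Hq; ring|split => //]. by apply continuousC_plus.
Qed.

Lemma cdiff_mult (f : C -> C) (g : C -> C) (c : C) (l : C) (m : C) :
  cdiff f c l -> cdiff g c m -> cdiff (fun z => f z * g z)%C c (l * g c + f c * m)%C.
Proof.
  intros [p [Hp [Cp <-]]] [q [Hq [Cq <-]]].
  exists (fun h => p h * g c + f c * q h + h * (p h * q h))%C.
  split; [intros h; rewrite Hp Hq; ring|split; [|ring]].
  contC.
Qed.

Lemma cdiff_comp (f : C -> C) (g : C -> C) (c : C) (l : C) (m : C) :
  cdiff f (g c) l -> cdiff g c m -> cdiff (fun z => f (g z)) c (m * l)%C.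
Proof.
  intros [p [Hp [Cp <-]]] [q [Hq [Cq <-]]].
  exists (fun h => q h * p (h * q h))%C.
  split; [intros h; rewrite Hq Hp; ring|split].
  - apply continuousC_mult => //.
    apply (continuous_comp (fun h => h * q h)%C p).
      apply continuousC_mult => //; apply continuous_id.
    by rewrite Cmult_0_l.
  - by rewrite Cmult_0_l.
Qed.

Lemma cdiff_continuous (f : C -> C) (c : C) (l : C) : cdiff f c l -> continuous f c.
Proof.
  intros [q [Hq [Cq _]]].
  apply (continuous_ext (fun z => f c + (z - c) * q (z - c))%C).
    intros z; rewrite -Hq; f_equal; ring.
  apply continuousC_plus; [apply continuous_const|].
  have Hm : continuous (fun z : C => (z - c)%C) c.
    apply continuousC_minus; [apply continuous_id|apply continuous_const].
  apply continuousC_mult => //.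
  apply (continuous_comp (fun z => z - c)%C q) => //.
  by have -> : (c - c)%C = 0 by ring.
Qed.

Lemma cdiff_unique (f : C -> C) (c : C) (l : C) (m : C) : cdiff f c l -> cdiff f c m -> l = m.
Proof.
  intros Hl Hm; apply (C_eq_of_Cmod_small _ _ 2) => e e0.
  destruct (cdiff_elim _ _ _ Hl e e0) as [d1 [d10 Hd1]].
  destruct (cdiff_elim _ _ _ Hm e e0) as [d2 [d20 Hd2]].
  have d0 : 0 < Rmin d1 d2 by apply Rmin_pos.
  have E : Cmod (RtoC (Rmin d1 d2 / 2)) = Rmin d1 d2 / 2 by rewrite Cmod_R Rabs_pos_eq; lra.
  have h1 := Hd1 (RtoC (Rmin d1 d2 / 2)). have h2 := Hd2 (RtoC (Rmin d1 d2 / 2)).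
  have := Rmin_l d1 d2; have := Rmin_r d1 d2 => ra rb.
  rewrite E in h1 h2.
  have k1 := h1 ltac:(lra). have k2 := h2 ltac:(lra).
  set h := RtoC (Rmin d1 d2 / 2) in k1 k2 E *.
  have : Cmod (h * (l - m)) <= 2 * e * Cmod h.
    have -> : (h * (l - m) = (f (c + h)%C - f c - h * m) - (f (c + h)%C - f c - h * l))%C by ring.
    have := Cmod_triangle_minus (f (c + h)%C - f c - h * m) (f (c + h)%C - f c - h * l). rewrite E; lra.
  rewrite Cmod_mult E => k.
  apply (Rmult_le_reg_l (Rmin d1 d2 / 2)); lra.
Qed.

(** Bridge to Coquelicot's derivative, in which [entire2] is phrased. *)
Lemma cdiff_of_derive (f : C -> C) (c : C) (l : C) :
  is_derive (K := C_AbsRing) (V := C_NormedModule) f c l -> cdiff f c l.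
Proof.
  intros [_ H]. apply cdiff_intro => e e0.
  have := H c (fun P HP => HP) (mkposreal e e0) => [[d Hd]].
  exists d; split; [apply cond_pos|] => h Hh.
  have hb : @ball (AbsRing_UniformSpace C_AbsRing) c d (c + h)%C.
    rewrite /ball /= /AbsRing_ball /=.
    have -> : @minus C_AbsRing (c + h)%C c = h by change (c + h + - c = h)%C; ring.
    exact Hh.
  have := Hd _ hb.
  have -> : @minus (AbsRing_NormedModule C_AbsRing) (c + h)%C c = h by change (c + h + - c = h)%C; ring.
  move=> k.
  change (Cmod (f (c + h) + - f c + - (h * l)) <= e * Cmod h)%C in k.
  exact k.
Qed.

Lemma cdiff_derive (f : C -> C) (c : C) (l : C) :
  cdiff f c l -> is_derive (K := C_AbsRing) (V := C_NormedModule) f c l.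
Proof.
  intros H; split; [apply is_linear_scal_l|].
  intros x Hx.
  have -> : x = c.
    symmetry. by apply (is_filter_lim_locally_unique (V := AbsRing_NormedModule C_AbsRing)).
  intros [e e0].
  destruct (cdiff_elim _ _ _ H e e0) as [d [d0 Hd]].
  exists (mkposreal d d0) => y Hy.
  have Hy' : Cmod (y - c) < d by exact Hy.
  have := Hd _ Hy'.
  have -> : (c + (y - c) = y)%C by ring.
  done.
Qed.

Lemma rdiff_ext (f : R -> C) (g : R -> C) (c : R) (l : C) : (forall z, f z = g z) -> rdiff f c l -> rdiff g c l.
Proof. intros E [q [Hq H]]; exists q; split => // h; by rewrite -!E. Qed.

Lemma rdiff_ext_loc (f : R -> C) (g : R -> C) (c : R) (l : C) :
  locally c (fun z => f z = g z) -> rdiff f c l -> rdiff g c l.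
Proof.
  intros E H; apply rdiff_intro => e e0.
  destruct (proj1 (locally_R _ _) E) as [d1 [d10 Hd1]].
  destruct (rdiff_elim _ _ _ H e e0) as [d2 [d20 Hd2]].
  exists (Rmin d1 d2); split; [by apply Rmin_pos|] => h Hh.
  have Ha := Rlt_le_trans _ _ _ Hh (Rmin_l _ _).
  have Hb := Rlt_le_trans _ _ _ Hh (Rmin_r _ _).
  rewrite -Hd1. rewrite -Hd1; [by apply Hd2|].
    by rewrite Rminus_eq_0 Rabs_R0.
  by have -> : (c + h - c) = h by ring.
Qed.

Lemma rdiff_const (k : C) (c : R) : rdiff (fun _ => k) c 0%C.
Proof. exists (fun _ => 0%C); split; [intros; ring|split => //; apply continuous_const]. Qed.

Lemma rdiff_plus (f : R -> C) (g : R -> C) (c : R) (l : C) (m : C) :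
  rdiff f c l -> rdiff g c m -> rdiff (fun z => f z + g z)%C c (l + m)%C.
Proof.
  intros [p [Hp [Cp <-]]] [q [Hq [Cq <-]]]; exists (fun h => p h + q h)%C.
  split; [intros h; rewrite Hp Hq; ring|split => //]. by apply continuousC_plus.
Qed.

Lemma rdiff_mult (f : R -> C) (g : R -> C) (c : R) (l : C) (m : C) :
  rdiff f c l -> rdiff g c m -> rdiff (fun z => f z * g z)%C c (l * g c + f c * m)%C.
Proof.
  intros [p [Hp [Cp <-]]] [q [Hq [Cq <-]]].
  exists (fun h => p h * g c + f c * q h + RtoC h * (p h * q h))%C.
  split; [intros h; rewrite Hp Hq; ring|split; [|ring]].
  contC.
Qed.

Lemma rdiff_scal (k : C) (g : R -> C) (c : R) (m : C) : rdiff g c m -> rdiff (fun z => k * g z)%C c (k * m)%C.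
Proof.
  intros [q [Hq [Cq <-]]]; exists (fun h => k * q h)%C.
  split; [intros h; rewrite Hq; ring|split => //].
  apply continuousC_mult => //; apply continuous_const.
Qed.

Lemma rdiff_comp_c (f : C -> C) (g : R -> C) (c : R) (l m : C) :
  cdiff f (g c) l -> rdiff g c m -> rdiff (fun z => f (g z)) c (m * l)%C.
Proof.
  intros [p [Hp [Cp <-]]] [q [Hq [Cq <-]]].
  exists (fun h => q h * p (RtoC h * q h))%C.
  split; [intros h; rewrite Hq Hp; ring|split].
  - apply continuousC_mult => //.
    apply (continuous_comp (fun h => RtoC h * q h)%C p).
      apply continuousC_mult => //; apply continuousC_RtoC; apply continuous_id.
    by rewrite Cmult_0_l.
  - by rewrite Cmult_0_l.
Qed.

Lemma rdiff_continuous (f : R -> C) (c : R) (l : C) : rdiff f c l -> continuous f c.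
Proof.
  intros [q [Hq [Cq _]]].
  have Hm : continuous (fun z : R => (z - c)) c.
    apply (continuous_minus (V := R_NormedModule)); [apply continuous_id|apply continuous_const].
  apply (continuous_ext (fun z => f c + RtoC (z - c)%R * q (z - c)%R)%C).
    intros z; rewrite -Hq; f_equal; ring.
  apply continuousC_plus; [apply continuous_const|].
  apply continuousC_mult; [by apply continuousC_RtoC|].
  apply (continuous_comp (fun z => z - c) q) => //.
  by rewrite Rminus_eq_0.
Qed.

Lemma is_derive_Rabs_iff (f : R -> R) x l :
  is_derive f x l <-> forall eps, 0 < eps -> exists d, 0 < d /\ forall h, Rabs h < d ->
     Rabs (f (x + h) - f x - h * l) <= eps * Rabs h.
Proof.
  split.
  - intros [_ H] e e0.
    have := H x (fun P HP => HP) (mkposreal e e0) => [[d Hd]].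
    exists d; split; [apply cond_pos|] => h Hh.
    have hb : ball x d (x + h).
      rewrite /ball /= /AbsRing_ball /abs /minus /plus /opp /=.
      by have -> : x + h + - x = h by ring.
    have := Hd _ hb. rewrite /norm /minus /plus /opp /scal /= /abs /mult /=.
    have -> : x + h + - x = h by ring. done.
  - intros H; split; [apply is_linear_scal_l|].
    intros y Hy.
    have -> : y = x.
      symmetry. by apply (is_filter_lim_locally_unique (V := R_NormedModule)).
    intros [e e0].
    destruct (H e e0) as [d [d0 Hd]].
    exists (mkposreal d d0) => t Ht.
    have Ht' : Rabs (t - x) < d by exact Ht.
    have := Hd _ Ht'. have -> : x + (t - x) = t by ring. done.
Qed.

Lemma rdiff_Re (f : R -> C) (x : R) (l : C) : rdiff f x l -> is_derive (fun t => Re (f t)) x (Re l).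
Proof.
  intros H; apply is_derive_Rabs_iff => e e0.
  destruct (rdiff_elim _ _ _ H e e0) as [d [d0 Hd]]; exists d; split => // h Hh.
  apply Rle_trans with (2 := Hd h Hh).
  eapply Rle_trans; [|apply re_le_Cmod]. right; f_equal. rewrite /Re /=; ring.
Qed.

Lemma rdiff_Im (f : R -> C) (x : R) (l : C) : rdiff f x l -> is_derive (fun t => Im (f t)) x (Im l).
Proof.
  intros H; apply is_derive_Rabs_iff => e e0.
  destruct (rdiff_elim _ _ _ H e e0) as [d [d0 Hd]]; exists d; split => // h Hh.
  apply Rle_trans with (2 := Hd h Hh).
  eapply Rle_trans; [|apply im_le_Cmod]. right; f_equal. rewrite /Im /=; ring.
Qed.

Lemma rdiff_ReIm (f : R -> C) (x : R) (l : C) :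
  is_derive (fun t => Re (f t)) x (Re l) -> is_derive (fun t => Im (f t)) x (Im l) ->
  rdiff f x l.
Proof.
  move=> /is_derive_Rabs_iff H1 /is_derive_Rabs_iff H2.
  apply rdiff_intro => e e0.
  have e2 : 0 < e / 2 by lra.
  destruct (H1 _ e2) as [d1 [d10 Hd1]]. destruct (H2 _ e2) as [d2 [d20 Hd2]].
  exists (Rmin d1 d2); split; [by apply Rmin_pos|] => h Hh.
  have Ha := Hd1 _ (Rlt_le_trans _ _ _ Hh (Rmin_l _ _)).
  have Hb := Hd2 _ (Rlt_le_trans _ _ _ Hh (Rmin_r _ _)).
  eapply Rle_trans; [apply Cmod_le_ReIm|].
  have -> : Re (f (x + h)%R - f x - h * l) = Re (f (x + h)) - Re (f x) - h * Re l.
    rewrite /Re /=; ring.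
  have -> : Im (f (x + h)%R - f x - h * l) = Im (f (x + h)) - Im (f x) - h * Im l.
    rewrite /Im /=; ring.
  lra.
Qed.

Lemma rdiff_RtoC (f : R -> R) (x l : R) : is_derive f x l -> rdiff (fun t => RtoC (f t)) x (RtoC l).
Proof. intros H; apply rdiff_ReIm => //=. apply @is_derive_const. Qed.

Lemma rdiff_unique (f : R -> C) (c : R) (l : C) (m : C) : rdiff f c l -> rdiff f c m -> l = m.
Proof.
  intros H1 H2; apply injective_projections.
  - by rewrite -[fst l](is_derive_unique _ _ _ (rdiff_Re _ _ _ H1))
       -[fst m](is_derive_unique _ _ _ (rdiff_Re _ _ _ H2)).
  - by rewrite -[snd l](is_derive_unique _ _ _ (rdiff_Im _ _ _ H1))
       -[snd m](is_derive_unique _ _ _ (rdiff_Im _ _ _ H2)).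
Qed.

Lemma rdiff_comp_r (f : R -> C) (g : R -> R) (x : R) (l : C) (m : R) :
  rdiff f (g x) l -> is_derive g x m -> rdiff (fun t => f (g t)) x (RtoC m * l)%C.
Proof.
  intros H1 H2; apply rdiff_ReIm.
  - have -> : Re (m * l) = scal m (Re l) by rewrite re_scal_l.
    apply: (is_derive_comp (fun t => Re (f t)) g); [by apply rdiff_Re|done].
  - have -> : Im (m * l) = scal m (Im l) by rewrite im_scal_l.
    apply: (is_derive_comp (fun t => Im (f t)) g); [by apply rdiff_Im|done].
Qed.

(** * Integrals of complex-valued functions of a real variable *)

Definition CInt (f : R -> C) (a b : R) : C :=
  (RInt (fun t => Re (f t)) a b, RInt (fun t => Im (f t)) a b).

(** Continuity on the whole line makes every integral exist whatever its bounds. The price is that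
    weights such as u^a (1-u)^b, extended by 0, qualify only for exponents of positive real part. *)
Definition contR (f : R -> C) := forall x, continuous f x.

Lemma contR_exRe f a b : contR f -> ex_RInt (fun t => Re (f t)) a b.
Proof. intros H; apply (ex_RInt_continuous (V := R_CompleteNormedModule)) => x _; by apply continuous_Re. Qed.

Lemma contR_exIm f a b : contR f -> ex_RInt (fun t => Im (f t)) a b.
Proof. intros H; apply (ex_RInt_continuous (V := R_CompleteNormedModule)) => x _; by apply continuous_Im. Qed.

Lemma CInt_is_RInt f a b : contR f -> is_RInt (V := C_R_NormedModule) f a b (CInt f a b).
Proof.
  intros H; apply (is_RInt_fct_extend_pair (U := R_NormedModule) (V := R_NormedModule)).
  - apply (RInt_correct (V := R_CompleteNormedModule)); by apply contR_exRe.
  - apply (RInt_correct (V := R_CompleteNormedModule)); by apply contR_exIm.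
Qed.

Lemma CInt_ext f g a b : (forall t, Rmin a b < t < Rmax a b -> f t = g t) -> CInt f a b = CInt g a b.
Proof. intros H; rewrite /CInt; f_equal; apply RInt_ext => t Ht; by rewrite H. Qed.

Lemma CInt_plus f g a b : contR f -> contR g ->
  CInt (fun t => f t + g t)%C a b = (CInt f a b + CInt g a b)%C.
Proof.
  intros Hf Hg; apply injective_projections; simpl.
  - rewrite -[LHS](RInt_ext (fun t => plus (Re (f t)) (Re (g t)))) //.
    rewrite (RInt_plus (V := R_CompleteNormedModule)) //; by apply contR_exRe.
  - rewrite -[LHS](RInt_ext (fun t => plus (Im (f t)) (Im (g t)))) //.
    rewrite (RInt_plus (V := R_CompleteNormedModule)) //; by apply contR_exIm.
Qed.

Lemma contR_const k : contR (fun _ => k).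
Proof. intros x; apply continuous_const. Qed.

Lemma contR_mult f g : contR f -> contR g -> contR (fun t => f t * g t)%C.
Proof. intros Hf Hg x; by apply continuousC_mult. Qed.

Lemma contR_plus f g : contR f -> contR g -> contR (fun t => f t + g t)%C.
Proof. intros Hf Hg x; by apply continuousC_plus. Qed.

Lemma contR_minus f g : contR f -> contR g -> contR (fun t => f t - g t)%C.
Proof. intros Hf Hg x; by apply continuousC_minus. Qed.

Lemma CInt_scal k f a b : contR f -> CInt (fun t => k * f t)%C a b = (k * CInt f a b)%C.
Proof.
  intros Hf.
  have hr := contR_exRe f a b Hf. have hi := contR_exIm f a b Hf.
  have sr : forall c, ex_RInt (fun t => scal c (Re (f t))) a b
    by move=> c; apply @ex_RInt_scal.
  have si : forall c, ex_RInt (fun t => scal c (Im (f t))) a b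
    by move=> c; apply @ex_RInt_scal.
  apply injective_projections; simpl.
  - rewrite -[LHS](RInt_ext (fun t => minus (scal (Re k) (Re (f t))) (scal (Im k) (Im (f t))))) //.
    rewrite (RInt_minus (V := R_CompleteNormedModule)) // !(RInt_scal (V := R_CompleteNormedModule)) //.
  - rewrite -[LHS](RInt_ext (fun t => plus (scal (Re k) (Im (f t))) (scal (Im k) (Re (f t))))) //.
    rewrite (RInt_plus (V := R_CompleteNormedModule)) // !(RInt_scal (V := R_CompleteNormedModule)) //.
Qed.

Lemma CInt_minus f g a b : contR f -> contR g ->
  CInt (fun t => f t - g t)%C a b = (CInt f a b - CInt g a b)%C.
Proof.
  intros Hf Hg.
  rewrite (CInt_ext _ (fun t => f t + (-(1)) * g t)%C); [|by intros; ring].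
  rewrite CInt_plus ?CInt_scal //; first by ring.
  by apply contR_mult => //; apply contR_const.
Qed.

Lemma CInt_Chasles f a b c : contR f -> (CInt f a b + CInt f b c = CInt f a c)%C.
Proof.
  intros Hf; apply injective_projections; simpl.
  - apply (RInt_Chasles (V := R_CompleteNormedModule)); by apply contR_exRe.
  - apply (RInt_Chasles (V := R_CompleteNormedModule)); by apply contR_exIm.
Qed.

Lemma CInt_point f a : CInt f a a = 0%C.
Proof. by apply injective_projections; simpl; rewrite RInt_point. Qed.

Lemma CInt_swap f a b : contR f -> CInt f a b = (- CInt f b a)%C.
Proof.
  intros Hf; have H := CInt_Chasles f a b a Hf; rewrite CInt_point in H.
  have -> : CInt f a b = (CInt f a b + CInt f b a - CInt f b a)%C by ring.
  rewrite H; ring.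
Qed.

Lemma CInt_const k a b : CInt (fun _ => k) a b = (RtoC (b - a)%R * k)%C.
Proof.
  rewrite /CInt !RInt_const; apply injective_projections; rewrite /= /scal /= /mult /Re /Im /=; ring.
Qed.

Lemma CInt_norm_le f a b M : a <= b -> contR f ->
  (forall t, a <= t <= b -> Cmod (f t) <= M) -> Cmod (CInt f a b) <= M * (b - a).
Proof.
  intros ab Hf HM.
  rewrite Cmod_norm.
  eapply Rle_trans.
  - apply (norm_RInt_le (V := C_R_NormedModule) f (fun _ => M) a b (CInt f a b) (scal (b - a) M)) => //.
    + intros t Ht; rewrite -Cmod_norm; by apply HM.
    + by apply CInt_is_RInt.
    + apply @is_RInt_const.
  - rewrite /scal /= /mult /=; lra.
Qed.

Lemma CInt_norm_le_fct f (g : R -> R) a b : a <= b -> contR f -> (forall x, continuous g x) ->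
  (forall t, a <= t <= b -> Cmod (f t) <= g t) -> Cmod (CInt f a b) <= RInt g a b.
Proof.
  intros ab Hf Hg HM. rewrite Cmod_norm.
  apply (norm_RInt_le (V := C_R_NormedModule) f g a b (CInt f a b)) => //.
  - intros t Ht; rewrite -Cmod_norm; by apply HM.
  - by apply CInt_is_RInt.
  - apply (RInt_correct (V := R_CompleteNormedModule)), (ex_RInt_continuous (V := R_CompleteNormedModule)); auto.
Qed.

Lemma CInt_norm_le_abs f a b M : contR f ->
  (forall t, Rmin a b <= t <= Rmax a b -> Cmod (f t) <= M) -> Cmod (CInt f a b) <= M * Rabs (b - a).
Proof.
  intros Hf HM; destruct (Rle_dec a b) as [h|h].
  - rewrite Rabs_pos_eq; [|lra]. apply CInt_norm_le => // t Ht; apply HM.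
    rewrite Rmin_left // Rmax_right //.
  - rewrite CInt_swap // Cmod_opp Rabs_minus_sym Rabs_pos_eq; [|lra].
    apply CInt_norm_le => //; [lra|] => t Ht; apply HM.
    rewrite Rmin_right ?Rmax_left; lra.
Qed.

Lemma CInt_FTC F f a b :
  (forall t, Rmin a b <= t <= Rmax a b -> rdiff F t (f t)) ->
  (forall t, Rmin a b <= t <= Rmax a b -> continuous f t) ->
  CInt f a b = (F b - F a)%C.
Proof.
  intros HF Hf.
  have h1 := is_RInt_derive (V := R_CompleteNormedModule) (fun t => Re (F t)) (fun t => Re (f t)) a b
    (fun t Ht => rdiff_Re _ _ _ (HF t Ht)) (fun t Ht => continuous_Re _ _ (Hf t Ht)).
  have h2 := is_RInt_derive (V := R_CompleteNormedModule) (fun t => Im (F t)) (fun t => Im (f t)) a b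
    (fun t Ht => rdiff_Im _ _ _ (HF t Ht)) (fun t Ht => continuous_Im _ _ (Hf t Ht)).
  rewrite /CInt (is_RInt_unique _ _ _ _ h1) (is_RInt_unique _ _ _ _ h2).
  by apply injective_projections.
Qed.

Lemma is_RInt_C_FTC F f a b :
  (forall t, Rmin a b <= t <= Rmax a b -> rdiff F t (f t)) ->
  (forall t, Rmin a b <= t <= Rmax a b -> continuous f t) ->
  is_RInt (V := C_R_NormedModule) f a b (F b - F a)%C.
Proof.
  intros HF Hf.
  have h1 := is_RInt_derive (V := R_CompleteNormedModule) (fun t => Re (F t)) (fun t => Re (f t)) a b
    (fun t Ht => rdiff_Re _ _ _ (HF t Ht)) (fun t Ht => continuous_Re _ _ (Hf t Ht)).
  have h2 := is_RInt_derive (V := R_CompleteNormedModule) (fun t => Im (F t)) (fun t => Im (f t)) a b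
    (fun t Ht => rdiff_Im _ _ _ (HF t Ht)) (fun t Ht => continuous_Im _ _ (Hf t Ht)).
  by apply (is_RInt_fct_extend_pair (U := R_NormedModule) (V := R_NormedModule)).
Qed.

Lemma CInt_antiderivative f a x : contR f -> rdiff (fun t => CInt f a t) x (f x).
Proof.
  intros Hf; apply rdiff_ReIm; simpl.
  - apply (is_derive_RInt (V := R_CompleteNormedModule) (fun t => Re (f t)) _ a);
      [|by apply continuous_Re].
    apply filter_forall => t; apply (RInt_correct (V := R_CompleteNormedModule)); by apply contR_exRe.
  - apply (is_derive_RInt (V := R_CompleteNormedModule) (fun t => Im (f t)) _ a);
      [|by apply continuous_Im].
    apply filter_forall => t; apply (RInt_correct (V := R_CompleteNormedModule)); by apply contR_exIm.
Qed.

(** The engine of both homotopy arguments, in [cauchy_kernel_integral] and [cauchy_formula_C1]: an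
    integral depending on s is constant, hence equal at s = 0 and s = 1. *)
Lemma rdiff_eq_of_zero_derivative (f : R -> C) (a : R) (b : R) :
  (forall t, Rmin a b <= t <= Rmax a b -> rdiff f t 0%C) -> f a = f b.
Proof.
  intros H; have := CInt_FTC f (fun _ => 0%C) a b H (fun t _ => continuous_const _ _).
  rewrite CInt_const Cmult_0_r => E.
  have -> : f b = (f b - f a + f a)%C by ring. rewrite -E; ring.
Qed.

Section DiffUnderIntegral.
Variables (a b : R) (D : R -> C).
Hypothesis ab : a <= b.
Hypothesis HD : contR D.

Lemma CInt_quadratic_estimate (F1 F0 : R -> C) k m M : contR F1 -> contR F0 ->
  (forall w, a <= w <= b -> Cmod (F1 w - F0 w - k * D w) <= M * (m * m)) ->
  Cmod (CInt F1 a b - CInt F0 a b - k * CInt D a b) <= (M * (b - a)) * (m * m).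
Proof.
  intros H1 H0 H.
  rewrite -CInt_scal // -CInt_minus // -CInt_minus.
  - eapply Rle_trans; [apply CInt_norm_le; [done| |exact H]|].
      apply contR_minus; [by apply contR_minus|]. by apply contR_mult => //; apply contR_const.
    right; ring.
  - by apply contR_minus.
  - by apply contR_mult => //; apply contR_const.
Qed.

Lemma cdiff_CInt (F : C -> R -> C) p M d : 0 < d ->
  (forall q, Cmod (q - p) < d -> contR (F q)) ->
  (forall h w, Cmod h < d -> a <= w <= b ->
     Cmod (F (p + h)%C w - F p w - h * D w) <= M * (Cmod h * Cmod h)) ->
  cdiff (fun q => CInt (F q) a b) p (CInt D a b).
Proof.
  intros d0 Hc H.
  apply (cdiff_of_quadratic _ _ _ (M * (b - a)) d) => // h Hh.
  apply CInt_quadratic_estimate.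
  - apply Hc. by have -> : (p + h - p = h)%C by ring.
  - apply Hc. have -> : (p - p = 0)%C by ring. by rewrite Cmod_0.
  - intros w Hw; by apply H.
Qed.

Lemma rdiff_CInt (F : R -> R -> C) p M d : 0 < d ->
  (forall q, Rabs (q - p) < d -> contR (F q)) ->
  (forall h w, Rabs h < d -> a <= w <= b ->
     Cmod (F (p + h) w - F p w - RtoC h * D w) <= M * (Rabs h * Rabs h)) ->
  rdiff (fun q => CInt (F q) a b) p (CInt D a b).
Proof.
  intros d0 Hc H.
  apply (rdiff_of_quadratic _ _ _ (M * (b - a)) d) => // h Hh.
  apply CInt_quadratic_estimate.
  - apply Hc. by have -> : (p + h - p = h) by ring.
  - apply Hc. by rewrite Rminus_eq_0 Rabs_R0.
  - intros w Hw; by apply H.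
Qed.
End DiffUnderIntegral.

(** * Goursat's theorem *)

Section RectangleInduction.
Variable P : R -> R -> R -> R -> Prop.
Hypothesis P_split : forall x1 x2 y1 y2, x1 <= x2 -> y1 <= y2 ->
  P x1 ((x1 + x2) / 2) y1 ((y1 + y2) / 2) -> P ((x1 + x2) / 2) x2 y1 ((y1 + y2) / 2) ->
  P x1 ((x1 + x2) / 2) ((y1 + y2) / 2) y2 -> P ((x1 + x2) / 2) x2 ((y1 + y2) / 2) y2 ->
  P x1 x2 y1 y2.
Hypothesis P_local : forall a b, exists d, 0 < d /\ forall x1 x2 y1 y2,
  x1 <= a <= x2 -> y1 <= b <= y2 -> (x2 - x1) + (y2 - y1) < d -> P x1 x2 y1 y2.

Let half (u v : R * R) : Prop :=
  v = (fst u, (fst u + snd u) / 2) \/ v = ((fst u + snd u) / 2, snd u).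

(** The hypotheses stand under the existential quantifier, so that choice yields a total step
    function which can be iterated before anything is known about the rectangles. *)
Lemma rect_step (r : (R * R) * (R * R)) : exists r' : (R * R) * (R * R),
  fst (fst r) <= snd (fst r) -> fst (snd r) <= snd (snd r) ->
  ~ P (fst (fst r)) (snd (fst r)) (fst (snd r)) (snd (snd r)) ->
  half (fst r) (fst r') /\ half (snd r) (snd r') /\
  ~ P (fst (fst r')) (snd (fst r')) (fst (snd r')) (snd (snd r')).
Proof.
  destruct r as [[x1 x2] [y1 y2]]; simpl.
  have := P_split x1 x2 y1 y2.
  set mx := (x1 + x2) / 2; set my := (y1 + y2) / 2 => H.
  destruct (excluded_middle_informative (P x1 mx y1 my)) as [h1|h1];
    [|by exists ((x1, mx), (y1, my)) => ? ? ?; split; [left|split; [left|]]].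
  destruct (excluded_middle_informative (P mx x2 y1 my)) as [h2|h2];
    [|by exists ((mx, x2), (y1, my)) => ? ? ?; split; [right|split; [left|]]].
  destruct (excluded_middle_informative (P x1 mx my y2)) as [h3|h3];
    [|by exists ((x1, mx), (my, y2)) => ? ? ?; split; [left|split; [right|]]].
  destruct (excluded_middle_informative (P mx x2 my y2)) as [h4|h4];
    [|by exists ((mx, x2), (my, y2)) => ? ? ?; split; [right|split; [right|]]].
  exists ((x1, x2), (y1, y2)) => ? ? n; exfalso; apply n; by apply H.
Qed.

Lemma nested_halves (u : nat -> R * R) : fst (u O) <= snd (u O) ->
  (forall n, half (u n) (u (S n))) ->
  (forall n, fst (u n) <= snd (u n) /\ snd (u n) - fst (u n) = (snd (u O) - fst (u O)) / 2 ^ n) /\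
  exists a, forall n, fst (u n) <= a <= snd (u n).
Proof.
  intros H0 H.
  have W : forall n, fst (u n) <= snd (u n) /\ snd (u n) - fst (u n) = (snd (u O) - fst (u O)) / 2 ^ n.
    elim => [|n [IH1 IH2]]; [split => //=; field|].
    have p2 : 2 ^ n <> 0 by apply pow_nonzero; lra.
    destruct (H n) as [E|E]; rewrite E /=; (split; [lra|]);
    replace ((snd (u O) - fst (u O)) / (2 * 2 ^ n)) with ((snd (u O) - fst (u O)) / 2 ^ n / 2) by (by field);
    rewrite -IH2; field.
  split => //.
  have M : forall n k, fst (u n) <= fst (u (n + k)%nat) /\ snd (u (n + k)%nat) <= snd (u n).
    move=> n; elim => [|k IH]; [rewrite Nat.add_0_r; lra|].
    rewrite Nat.add_succ_r. have := W (n + k)%nat.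
    destruct (H (n + k)%nat) as [E|E]; rewrite E /=; lra.
  have MM : forall n m, fst (u n) <= snd (u m).
    intros n m; destruct (Nat.le_ge_cases n m) as [h|h].
    - have := M n (m - n)%nat. have -> : (n + (m - n) = m)%nat by lia. have := W m; lra.
    - have := M m (n - m)%nat. have -> : (m + (n - m) = n)%nat by lia. have := W n; lra.
  destruct (completeness (fun x => exists n, x = fst (u n))) as [a [Ha1 Ha2]].
  - exists (snd (u O)) => x [n ->]; apply MM.
  - by exists (fst (u O)), O.
  - exists a => n; split; [apply Ha1; by exists n|].
    apply Ha2 => x [m ->]; apply MM.
Qed.

(** Bisection as an induction principle (Cousin's lemma in the plane): a rectangle violating [P] has
    a quarter violating [P], and the nested quarters shrink to a point where [P_local] is
    contradicted. *)
Lemma rectangle_induction x1 x2 y1 y2 : x1 <= x2 -> y1 <= y2 -> P x1 x2 y1 y2.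
Proof.
  intros hx hy; apply NNPP => HP.
  pose step r := proj1_sig (constructive_indefinite_description _ (rect_step r)).
  have Hstep := fun r => proj2_sig (constructive_indefinite_description _ (rect_step r)).
  pose u n := Nat.iter n step ((x1, x2), (y1, y2)).
  have I : forall n, fst (fst (u n)) <= snd (fst (u n)) /\ fst (snd (u n)) <= snd (snd (u n)) /\
    ~ P (fst (fst (u n))) (snd (fst (u n))) (fst (snd (u n))) (snd (snd (u n))) /\
    half (fst (u n)) (fst (u (S n))) /\ half (snd (u n)) (snd (u (S n))).
    elim => [|n [I1 [I2 [I3 [I4 I5]]]]].
      have := Hstep (u O) hx hy HP. by move=> [h1 [h2 h3]].
    have J := Hstep (u n) I1 I2 I3.
    have K1 : fst (fst (u (S n))) <= snd (fst (u (S n))).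
      destruct I4 as [E|E]; rewrite E /=; lra.
    have K2 : fst (snd (u (S n))) <= snd (snd (u (S n))).
      destruct I5 as [E|E]; rewrite E /=; lra.
    destruct J as [J1 [J2 J3]].
    have := Hstep (u (S n)) K1 K2 J3. by move=> [h1 [h2 h3]].
  destruct (nested_halves (fun n => fst (u n))) as [Wx [a Ha]] => //; [apply I|].
  destruct (nested_halves (fun n => snd (u n))) as [Wy [b Hb]] => //; [apply I|].
  destruct (P_local a b) as [d [d0 Hd]].
  have [N HN] : exists N, (x2 - x1 + (y2 - y1)) / 2 ^ N < d.
    have L : is_lim_seq (fun n => (x2 - x1 + (y2 - y1)) * (/ 2) ^ n) 0.
      replace (Finite 0) with (Rbar_mult (x2 - x1 + (y2 - y1)) (Finite 0)) by (simpl; f_equal; ring).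
      apply is_lim_seq_scal_l, is_lim_seq_geom. rewrite Rabs_pos_eq; lra.
    apply is_lim_seq_spec in L. destruct (L (mkposreal d d0)) as [N HN].
    exists N; have := HN N (Nat.le_refl N).
    rewrite /= Rminus_0_r pow_inv => h; have := Rle_abs ((x2 - x1 + (y2 - y1)) * / 2 ^ N).
    rewrite /Rdiv; lra.
  apply (proj1 (proj2 (proj2 (I N)))). apply Hd => //.
  rewrite (proj2 (Wx N)) (proj2 (Wy N)) /=.
  rewrite /Rdiv -Rmult_plus_distr_r. exact HN.
Qed.
End RectangleInduction.

(** * Contour integrals along segments and rectangles *)

Definition hseg (f : C -> C) (y x1 x2 : R) : C := CInt (fun s => f (s, y)) x1 x2.
Definition vseg (f : C -> C) (x y1 y2 : R) : C := (Ci * CInt (fun s => f (x, s)) y1 y2)%C.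
(** The boundary is run counterclockwise when the bounds are ordered; unordered bounds are allowed
    and contribute signs. *)
Definition rectint (f : C -> C) (x1 x2 y1 y2 : R) : C :=
  (hseg f y1 x1 x2 + vseg f x2 y1 y2 - hseg f y2 x1 x2 - vseg f x1 y1 y2)%C.

Definition contC_all (f : C -> C) := forall z : C, continuous f z.
Definition entire (f : C -> C) := forall c, exists l, cdiff f c l.

Lemma entire_continuous f : entire f -> contC_all f.
Proof. intros H c; destruct (H c) as [l Hl]; by apply (cdiff_continuous _ _ _ Hl). Qed.

Lemma contR_horiz f y : contC_all f -> contR (fun s => f (s, y)).
Proof.
  intros H s. apply (continuous_comp (fun s : R => (s, y) : C) f); [|apply H].
  apply continuousC; [apply continuous_id|apply continuous_const].
Qed.

Lemma contR_vert f x : contC_all f -> contR (fun s => f (x, s)).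
Proof.
  intros H s. apply (continuous_comp (fun s : R => (x, s) : C) f); [|apply H].
  apply continuousC; [apply continuous_const|apply continuous_id].
Qed.

Lemma rdiff_horiz y x : rdiff (fun s => (s, y) : C) x 1%C.
Proof. apply rdiff_ReIm; simpl; [apply @is_derive_id|apply @is_derive_const]. Qed.

Lemma rdiff_vert x y : rdiff (fun s => (x, s) : C) y Ci.
Proof. apply rdiff_ReIm; simpl; [apply @is_derive_const|apply @is_derive_id]. Qed.

Section Primitive_integrals.
Variables F f : C -> C.
Hypothesis HF : forall z, cdiff F z (f z).
Hypothesis Hf : contC_all f.

Lemma hseg_primitive y x1 x2 : hseg f y x1 x2 = (F (x2, y) - F (x1, y))%C.
Proof.
  rewrite /hseg (CInt_FTC (fun s => F (s, y))) //.
  - intros t _. rewrite -[f _]Cmult_1_l. apply (rdiff_comp_c F); [apply HF|apply rdiff_horiz].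
  - intros t _; by apply contR_horiz.
Qed.

Lemma vseg_primitive x y1 y2 : vseg f x y1 y2 = (F (x, y2) - F (x, y1))%C.
Proof.
  rewrite /vseg -CInt_scal; [|by apply contR_vert].
  rewrite (CInt_FTC (fun s => F (x, s))) //.
  - intros t _. apply (rdiff_comp_c F); [apply HF|apply rdiff_vert].
  - intros t _; apply continuousC_mult; [apply continuous_const|by apply contR_vert].
Qed.

Lemma rectint_primitive x1 x2 y1 y2 : rectint f x1 x2 y1 y2 = 0%C.
Proof. rewrite /rectint !hseg_primitive !vseg_primitive; ring. Qed.
End Primitive_integrals.

Lemma hseg_norm f y x1 x2 M : contC_all f ->
  (forall s, Rmin x1 x2 <= s <= Rmax x1 x2 -> Cmod (f (s, y)) <= M) ->
  Cmod (hseg f y x1 x2) <= M * Rabs (x2 - x1).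
Proof. intros Hf H; apply CInt_norm_le_abs => //; by apply contR_horiz. Qed.

Lemma vseg_norm f x y1 y2 M : contC_all f ->
  (forall s, Rmin y1 y2 <= s <= Rmax y1 y2 -> Cmod (f (x, s)) <= M) ->
  Cmod (vseg f x y1 y2) <= M * Rabs (y2 - y1).
Proof.
  intros Hf H; rewrite Cmod_mult Cmod_Ci Rmult_1_l.
  apply CInt_norm_le_abs => //; by apply contR_vert.
Qed.

Lemma hseg_minus f g y x1 x2 : contC_all f -> contC_all g ->
  hseg (fun z => f z - g z)%C y x1 x2 = (hseg f y x1 x2 - hseg g y x1 x2)%C.
Proof. intros Hf Hg; rewrite /hseg CInt_minus //; by apply contR_horiz. Qed.

Lemma vseg_minus f g y x1 x2 : contC_all f -> contC_all g ->
  vseg (fun z => f z - g z)%C y x1 x2 = (vseg f y x1 x2 - vseg g y x1 x2)%C.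
Proof. intros Hf Hg; rewrite /vseg CInt_minus; [ring|by apply contR_vert..]. Qed.

Lemma rectint_split f x1 xm x2 y1 ym y2 : contC_all f ->
  rectint f x1 x2 y1 y2 = (rectint f x1 xm y1 ym + rectint f xm x2 y1 ym +
    rectint f x1 xm ym y2 + rectint f xm x2 ym y2)%C.
Proof.
  intros Hf; rewrite /rectint.
  have eh : forall y, hseg f y x1 x2 = (hseg f y x1 xm + hseg f y xm x2)%C.
    intros y; rewrite /hseg CInt_Chasles //; by apply contR_horiz.
  have ev : forall x, vseg f x y1 y2 = (vseg f x y1 ym + vseg f x ym y2)%C.
    intros x; rewrite /vseg -Cmult_plus_distr_l CInt_Chasles //; by apply contR_vert.
  rewrite !eh !ev; ring.
Qed.

Lemma Cmod_le_abs x y : Cmod (x, y) <= Rabs x + Rabs y.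
Proof. apply (Cmod_le_ReIm (x, y)). Qed.

(** The affine part [A] of [f] at [c] has the primitive [PA] and integrates to zero. What is left
    has size at most [eps * s] on a boundary of length [2 * s], where [s] is the half-perimeter. *)
Lemma rectint_local f c l eps d : contC_all f -> 0 < eps ->
  (forall h, Cmod h < d -> Cmod (f (c + h)%C - f c - h * l) <= eps * Cmod h) ->
  forall x1 x2 y1 y2, x1 <= Re c <= x2 -> y1 <= Im c <= y2 -> (x2 - x1) + (y2 - y1) < d ->
  Cmod (rectint f x1 x2 y1 y2) <= 2 * eps * ((x2 - x1 + (y2 - y1)) * (x2 - x1 + (y2 - y1))).
Proof.
  intros Hf e0 Hl x1 x2 y1 y2 hx hy hs.
  set s := x2 - x1 + (y2 - y1) in hs *.
  pose A (z : C) := (f c + (z - c) * l)%C.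
  pose PA (z : C) := (z * (f c) + (/ 2) * ((z - c) * (z - c)) * l)%C.
  have HPA : forall z, cdiff PA z (A z).
    intros z.
    have k : cdiff (fun z => z - c)%C z (1 + 0)%C by apply cdiff_plus; [apply cdiff_id|apply cdiff_const].
    have := cdiff_plus _ _ z _ _ (cdiff_mult _ _ z _ _ (cdiff_id z) (cdiff_const (f c) z))
       (cdiff_mult _ _ z _ _ (cdiff_mult _ _ z _ _ (cdiff_const (/2)%C z) (cdiff_mult _ _ z _ _ k k)) (cdiff_const l z)).
    rewrite /PA /A. set q := (_ + _)%C. set q' := (f c + _)%C.
    have -> : q = q' by rewrite /q /q'; field; apply C1_nz || (intros E; apply RtoC_inj in E; lra).
    done.
  have cA : contC_all A by intros z; rewrite /A; contC.
  pose g (z : C) := (f z - A z)%C.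
  have cg : contC_all g by intros z; apply continuousC_minus; [apply Hf|apply cA].
  have E : rectint f x1 x2 y1 y2 = rectint g x1 x2 y1 y2.
    rewrite /g /rectint !hseg_minus // !vseg_minus //.
    have := rectint_primitive PA A HPA cA x1 x2 y1 y2. rewrite /rectint => E.
    rewrite -[LHS](Cplus_0_r) -Copp_0 -E; ring.
  have bg : forall z : C, x1 <= Re z <= x2 -> y1 <= Im z <= y2 -> Cmod (g z) <= eps * s.
    intros z h1 h2.
    have hz : Cmod (z - c) <= s.
      eapply Rle_trans; [apply Cmod_le_ReIm|].
      have -> : Re (z - c) = Re z - Re c by rewrite /Re /=; ring.
      have -> : Im (z - c) = Im z - Im c by rewrite /Im /=; ring.
      rewrite /s; split_Rabs; lra.
    have := Hl (z - c)%C (Rle_lt_trans _ _ _ hz hs).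
    have -> : (c + (z - c) = z)%C by ring.
    have -> : (f z - f c - (z - c) * l = g z)%C by rewrite /g /A; ring.
    have := Cmod_ge_0 (z - c). nra.
  have ms : 0 <= eps * s.
    have := bg c hx hy; have := Cmod_ge_0 (g c); lra.
  have H1 : forall y, y1 <= y <= y2 -> Cmod (hseg g y x1 x2) <= eps * s * (x2 - x1).
    intros y Hy; rewrite -[X in _ <= _ * X](Rabs_pos_eq (x2 - x1)); [|lra].
    apply hseg_norm => // t; rewrite Rmin_left ?Rmax_right; [|lra..]; intros; by apply bg.
  have H2 : forall x, x1 <= x <= x2 -> Cmod (vseg g x y1 y2) <= eps * s * (y2 - y1).
    intros x Hx; rewrite -[X in _ <= _ * X](Rabs_pos_eq (y2 - y1)); [|lra].
    apply vseg_norm => // t; rewrite Rmin_left ?Rmax_right; [|lra..]; intros; by apply bg.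
  rewrite E /rectint.
  have t1 := Cmod_triangle_minus (hseg g y1 x1 x2 + vseg g x2 y1 y2 - hseg g y2 x1 x2) (vseg g x1 y1 y2).
  have t2 := Cmod_triangle_minus (hseg g y1 x1 x2 + vseg g x2 y1 y2) (hseg g y2 x1 x2).
  have t3 := Cmod_triangle (hseg g y1 x1 x2) (vseg g x2 y1 y2).
  have := H1 y1 ltac:(lra); have := H1 y2 ltac:(lra); have := H2 x1 ltac:(lra); have := H2 x2 ltac:(lra).
  have -> : 2 * eps * (s * s) = 2 * (eps * s * (x2 - x1)) + 2 * (eps * s * (y2 - y1)) by rewrite /s; ring.
  lra.
Qed.

(** The bound is quadratic in the half-perimeter, which halving divides by 4: the bounds of the four
    quarters add up exactly to that of the whole, so the estimate is inductive. *)
Lemma Goursat_ordered f : entire f -> forall x1 x2 y1 y2, x1 <= x2 -> y1 <= y2 ->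
  rectint f x1 x2 y1 y2 = 0%C.
Proof.
  intros Hf x1 x2 y1 y2 hx hy.
  have Cf := entire_continuous f Hf.
  apply (C_eq_of_Cmod_small _ _ (2 * ((x2 - x1 + (y2 - y1)) * (x2 - x1 + (y2 - y1))))) => e e0.
  have -> : (rectint f x1 x2 y1 y2 - 0 = rectint f x1 x2 y1 y2)%C by ring.
  have := rectangle_induction (fun x1 x2 y1 y2 => Cmod (rectint f x1 x2 y1 y2) <=
     2 * e * ((x2 - x1 + (y2 - y1)) * (x2 - x1 + (y2 - y1)))).
  intros HI. eapply Rle_trans; [apply HI => //|right; ring].
  - clear -Cf e0; intros x1 x2 y1 y2 hx hy h1 h2 h3 h4.
    rewrite (rectint_split f x1 ((x1 + x2) / 2) x2 y1 ((y1 + y2) / 2) y2) //.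
    set r1 := rectint _ _ _ _ _ in h1 *; set r2 := rectint _ _ _ _ _ in h2 *.
    set r3 := rectint _ _ _ _ _ in h3 *; set r4 := rectint _ _ _ _ _ in h4 *.
    have := Cmod_triangle (r1 + r2 + r3) r4; have := Cmod_triangle (r1 + r2) r3.
    have := Cmod_triangle r1 r2; nra.
  - intros a b. destruct (Hf (a, b)) as [l Hl].
    destruct (cdiff_elim _ _ _ Hl e e0) as [d [d0 Hd]].
    exists d; split => // *. by apply (rectint_local f (a, b) l e d).
Qed.

(** Unordered bounds are needed because [primitive] starts at 0 and its increments may have either
    sign. *)
Lemma Goursat f : entire f -> forall x1 x2 y1 y2, rectint f x1 x2 y1 y2 = 0%C.
Proof.
  intros Hf x1 x2 y1 y2.
  have Cf := entire_continuous f Hf.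
  have sh : forall y a b, hseg f y a b = (- hseg f y b a)%C.
    intros; apply CInt_swap; by apply contR_horiz.
  have sv : forall y a b, vseg f y a b = (- vseg f y b a)%C.
    intros; rewrite /vseg CInt_swap; [ring|by apply contR_vert].
  have sx : forall x1 x2 y1 y2, rectint f x1 x2 y1 y2 = (- rectint f x2 x1 y1 y2)%C.
    intros; rewrite /rectint (sh y0 x0 x3) (sh y3 x0 x3); ring.
  have sy : forall x1 x2 y1 y2, rectint f x1 x2 y1 y2 = (- rectint f x1 x2 y2 y1)%C.
    intros; rewrite /rectint (sv x0 y0 y3) (sv x3 y0 y3); ring.
  destruct (Rle_dec x1 x2) as [h1|h1]; destruct (Rle_dec y1 y2) as [h2|h2].
  - by apply Goursat_ordered.
  - rewrite sy Goursat_ordered //; [ring|lra].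
  - rewrite sx Goursat_ordered //; [ring|lra].
  - rewrite sx sy Goursat_ordered //; [ring|lra|lra].
Qed.

Definition primitive (f : C -> C) (z : C) : C := (hseg f 0 0 (Re z) + vseg f (Re z) 0 (Im z))%C.

(** Goursat's theorem on the rectangle between heights 0 and Im z moves the horizontal leg up, so
    the increment of the primitive is the integral of [f] along the L-shaped path from z to z + h,
    where [f] is close to [f z]. *)
Lemma primitive_cdiff f : entire f -> forall z, cdiff (primitive f) z (f z).
Proof.
  intros Hf z. have Cf := entire_continuous f Hf.
  apply cdiff_intro => e e0.
  have e2 : 0 < e / 2 by lra.
  destruct (proj1 (continuous_CC _ _) (Cf z) _ e2) as [d [d0 Hd]].
  exists d; split => // h Hh.
  destruct z as [x y]; destruct h as [h k].
  have -> : (primitive f ((x, y) + (h, k)) - primitive f (x, y) =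
    hseg f y x (x + h)%R + vseg f (x + h)%R y (y + k)%R)%C.
    rewrite /primitive /=.
    have <- : (hseg f 0 0 x + hseg f 0 x (x + h)%R = hseg f 0 0 (x + h)%R)%C
      by apply CInt_Chasles, contR_horiz.
    have <- : (vseg f (x + h)%R 0 y + vseg f (x + h)%R y (y + k)%R = vseg f (x + h)%R 0 (y + k)%R)%C.
      rewrite /vseg -Cmult_plus_distr_l CInt_Chasles //; by apply contR_vert.
    have := Goursat f Hf x (x + h) 0 y; rewrite /rectint => E.
    apply Ceq_minus; rewrite -E; ring.
  have eh : hseg f y x (x + h) = (hseg (fun z => f z - f (x, y))%C y x (x + h)%R + RtoC h * f (x, y))%C.
    rewrite hseg_minus //; last by move=> ?; apply continuous_const.
    rewrite {3}/hseg CInt_const. have -> : x + h - x = h by ring. ring.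
  have ev : vseg f (x + h) y (y + k) = (vseg (fun z => f z - f (x, y))%C (x + h)%R y (y + k)%R + Ci * RtoC k * f (x, y))%C.
    rewrite vseg_minus //; last by move=> ?; apply continuous_const.
    rewrite {3}/vseg CInt_const. have -> : y + k - y = k by ring. ring.
  rewrite eh ev.
  have cg : contC_all (fun z => f z - f (x, y))%C.
    intros z; apply continuousC_minus; [apply Cf|apply continuous_const].
  set I1 := hseg _ _ _ _; set I2 := vseg _ _ _ _.
  have -> : (I1 + h * f (x, y) + (I2 + Ci * k * f (x, y)) - (h, k) * f (x, y) = I1 + I2)%C.
    have -> : (h, k) = (RtoC h + Ci * RtoC k)%C by apply injective_projections; simpl; ring.
    ring.
  have hx : Rabs h <= Cmod (h, k) by apply (re_le_Cmod (h, k)).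
  have hy : Rabs k <= Cmod (h, k) by apply (im_le_Cmod (h, k)).
  have cl : forall u v : R, Rabs u <= Rabs h -> Rabs v <= Rabs k -> Cmod (u, v) <= Cmod (h, k).
    intros u v Hu Hv; apply sqrt_le_1_alt; simpl.
    rewrite !Rmult_1_r. apply Rplus_le_compat; by apply Rsqr_le_abs_1.
  have K1 : Cmod I1 <= e / 2 * Rabs h.
    have := hseg_norm (fun z => f z - f (x, y))%C y x (x + h) (e / 2) cg.
    have -> : x + h - x = h by ring. apply. intros s Hs.
    left; apply Hd. eapply Rle_lt_trans; [|exact Hh].
    have -> : ((s, y) - (x, y) = ((s - x)%R, 0%R))%C by apply injective_projections; simpl; ring.
    apply cl; [|rewrite Rabs_R0; apply Rabs_pos].
    move: Hs; rewrite /Rmin /Rmax; destruct (Rle_dec _ _); split_Rabs; lra.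
  have K2 : Cmod I2 <= e / 2 * Rabs k.
    have := vseg_norm (fun z => f z - f (x, y))%C (x + h) y (y + k) (e / 2) cg.
    have -> : y + k - y = k by ring. apply. intros s Hs.
    left; apply Hd. eapply Rle_lt_trans; [|exact Hh].
    have -> : ((x + h, s)%R - (x, y) = (h, (s - y)%R))%C by apply injective_projections; simpl; ring.
    apply cl; [lra|].
    move: Hs; rewrite /Rmin /Rmax; destruct (Rle_dec _ _); split_Rabs; lra.
  have := Cmod_triangle I1 I2. nra.
Qed.

(** * Cauchy's formula and entire functions *)

Lemma continuous_Cmod {U : UniformSpace} (f : U -> C) x :
  continuous f x -> continuous (fun t => Cmod (f t)) x.
Proof.
  intros H; apply (continuous_comp f Cmod x H).
  intros P [e He]; apply locally_C; exists e; split; [apply cond_pos|] => y Hy.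
  apply He. rewrite /ball /= /AbsRing_ball /abs /minus /plus /opp /=.
  have := Cmod_triangle_rev y (f x); have := Cmod_triangle_rev (f x) y.
  rewrite (Cmod_minus_sym (f x) y) => h1 h2. split_Rabs; lra.
Qed.

Lemma contR_bounded f a b : contR f -> exists M, 0 <= M /\ forall t, a <= t <= b -> Cmod (f t) <= M.
Proof.
  intros Hf; destruct (Rle_dec a b) as [ab|ab].
  - destruct (continuity_ab_maj (fun t => Cmod (f t)) a b ab) as [m [Hm _]].
      intros c _; apply continuity_pt_filterlim. by apply continuous_Cmod.
    exists (Cmod (f m)); split; [apply Cmod_ge_0|done].
  - exists 0; split; [lra|]; intros t Ht; lra.
Qed.

Lemma contC_all_continuity_2d f x y : contC_all f ->
  continuity_2d_pt (fun x y => Re (f (x, y))) x y /\ continuity_2d_pt (fun x y => Im (f (x, y))) x y.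
Proof.
  intros Hf.
  have H : forall e : posreal, exists d : posreal, forall u v, Rabs (u - x) < d -> Rabs (v - y) < d ->
     Cmod (f (u, v) - f (x, y)) < e.
    intros e. destruct (proj1 (continuous_CC _ _) (Hf (x, y)) e (cond_pos e)) as [d [d0 Hd]].
    have d2 : 0 < d / 2 by lra.
    exists (mkposreal _ d2) => u v /= Hu Hv; apply Hd.
    have := Cmod_le_abs (u - x) (v - y).
    have -> : ((u, v) - (x, y) = ((u - x)%R, (v - y)%R))%C by apply injective_projections; simpl; ring.
    lra.
  split=> e; destruct (H e) as [d Hd]; exists d => u v Hu Hv;
  apply Rle_lt_trans with (2 := Hd u v Hu Hv).
  - exact (re_le_Cmod (f (u, v) - f (x, y))).
  - exact (im_le_Cmod (f (u, v) - f (x, y))).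
Qed.

(** The square has one unit to spare around the disc and [d <= 1], so only [z] is required to lie in
    the disc. *)
Lemma contC_all_uniform f r eps : contC_all f -> 0 < eps ->
  exists d, 0 < d /\ forall z z', Cmod z <= r -> Cmod (z' - z) < d -> Cmod (f z' - f z) < eps.
Proof.
  intros Hf e0. have e2 : 0 < eps / 2 by lra.
  destruct (uniform_continuity_2d (fun x y => Re (f (x, y))) (- r - 1) (r + 1) (- r - 1) (r + 1)
    (fun x y _ _ => proj1 (contC_all_continuity_2d f x y Hf)) (mkposreal _ e2)) as [d1 H1].
  destruct (uniform_continuity_2d (fun x y => Im (f (x, y))) (- r - 1) (r + 1) (- r - 1) (r + 1)
    (fun x y _ _ => proj2 (contC_all_continuity_2d f x y Hf)) (mkposreal _ e2)) as [d2 H2].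
  exists (Rmin 1 (Rmin d1 d2)); split.
    apply Rmin_pos; [lra|apply Rmin_pos; apply cond_pos].
  intros [x y] [u v] Hz Hzz.
  have k1 := Rmin_l 1 (Rmin d1 d2); have k2 := Rmin_r 1 (Rmin d1 d2).
  have k3 := Rmin_l d1 d2; have k4 := Rmin_r d1 d2.
  have ax : Rabs x <= r by apply Rle_trans with (2 := Hz); apply (re_le_Cmod (x, y)).
  have ay : Rabs y <= r by apply Rle_trans with (2 := Hz); apply (im_le_Cmod (x, y)).
  have au : Rabs (u - x) < Rmin 1 (Rmin d1 d2).
    apply Rle_lt_trans with (2 := Hzz); apply (re_le_Cmod ((u, v) - (x, y))).
  have av : Rabs (v - y) < Rmin 1 (Rmin d1 d2).
    apply Rle_lt_trans with (2 := Hzz); apply (im_le_Cmod ((u, v) - (x, y))).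
  have E1 := H1 x y u v ltac:(split_Rabs; lra) ltac:(split_Rabs; lra) ltac:(split_Rabs; lra)
    ltac:(split_Rabs; lra) ltac:(lra) ltac:(lra).
  have E2 := H2 x y u v ltac:(split_Rabs; lra) ltac:(split_Rabs; lra) ltac:(split_Rabs; lra)
    ltac:(split_Rabs; lra) ltac:(lra) ltac:(lra).
  have := Cmod_le_ReIm (f (u, v) - f (x, y)). simpl in E1, E2.
  have -> : Re (f (u, v) - f (x, y)) = Re (f (u, v)) - Re (f (x, y)) by rewrite /Re /=; ring.
  have -> : Im (f (u, v) - f (x, y)) = Im (f (u, v)) - Im (f (x, y)) by rewrite /Im /=; ring.
  lra.
Qed.

Lemma rdiff_line (z h : C) t : rdiff (fun t => z + RtoC t * h)%C t h.
Proof.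
  have := rdiff_plus _ _ t _ _ (rdiff_const z t) (rdiff_mult _ _ t _ _ (rdiff_RtoC _ _ _ (is_derive_id t)) (rdiff_const h t)).
  have -> : (0 + (RtoC one * h + RtoC t * 0) = h)%C by rewrite /one /=; ring.
  done.
Qed.

Lemma uniform_cdiff F f r eps : (forall z, cdiff F z (f z)) -> contC_all f -> 0 < eps ->
  exists d, 0 < d /\ forall z h, Cmod z <= r -> Cmod h < d ->
    Cmod (F (z + h)%C - F z - h * f z) <= eps * Cmod h.
Proof.
  intros HF Hf e0.
  destruct (contC_all_uniform f r eps Hf e0) as [d [d0 Hd]].
  exists d; split => // z h Hz Hh.
  have cl : contR (fun t => f (z + RtoC t * h)%C).
    intros t; apply (continuous_comp (fun t : R => z + RtoC t * h)%C f); [contC|apply Hf].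
  have -> : (F (z + h) - F z - h * f z = CInt (fun t => h * (f (z + RtoC t * h) - f z)) 0 1)%C.
    rewrite CInt_scal; [|by apply contR_minus => //; apply contR_const].
    rewrite CInt_minus //; [|by apply contR_const].
    rewrite CInt_const -[CInt (fun t => f _) 0 1]Cmult_1_l.
    have E : (h * CInt (fun t => f (z + RtoC t * h)) 0 1 = F (z + h) - F z)%C.
      rewrite -CInt_scal // (CInt_FTC (fun t => F (z + RtoC t * h)%C)).
      - by rewrite Cmult_1_l Cmult_0_l Cplus_0_r.
      - intros t _; apply (rdiff_comp_c F); [apply HF|apply rdiff_line].
      - intros t _; apply contR_mult => //; apply contR_const.
    rewrite -E Rminus_0_r; ring.
  eapply Rle_trans; [apply (CInt_norm_le _ 0 1 (eps * Cmod h))|lra]; [lra| |].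
  - apply contR_mult; [apply contR_const|]. apply contR_minus => //; apply contR_const.
  - intros t Ht; rewrite Cmod_mult Rmult_comm; apply Rmult_le_compat_r; [apply Cmod_ge_0|].
    left; apply Hd => //.
    have -> : (z + t * h - z = t * h)%C by ring.
    rewrite Cmod_mult Cmod_R Rabs_pos_eq; [|lra]. have := Cmod_ge_0 h; nra.
Qed.

Lemma rdiff_CInt_uniform (F : R -> R -> C) D p a b : a <= b -> contR D ->
  (forall q, contR (F q)) ->
  (forall eps, 0 < eps -> exists d, 0 < d /\ forall h w, Rabs h < d -> a <= w <= b ->
     Cmod (F (p + h) w - F p w - RtoC h * D w) <= eps * Rabs h) ->
  rdiff (fun q => CInt (F q) a b) p (CInt D a b).
Proof.
  intros ab HD HF H; apply rdiff_intro => e e0.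
  have k : 0 < e / (b - a + 1) by apply Rdiv_lt_0_compat; lra.
  destruct (H _ k) as [d [d0 Hd]]; exists d; split => // h Hh.
  have Hm := Rabs_pos h.
  rewrite -CInt_scal // -CInt_minus // -CInt_minus.
  - eapply Rle_trans; [apply (CInt_norm_le _ a b (e / (b - a + 1) * Rabs h)) => //|].
    + apply contR_minus; [by apply contR_minus|]. by apply contR_mult => //; apply contR_const.
    + intros w Hw; by apply Hd.
    + replace (e / (b - a + 1) * Rabs h * (b - a)) with (e * Rabs h * ((b - a) / (b - a + 1))) by (field; lra).
      have : (b - a) / (b - a + 1) <= 1.
        apply (Rmult_le_reg_r (b - a + 1)); [lra|]. field_simplify; lra.
      have : 0 <= e * Rabs h by nra. nra.
  - by apply contR_minus.
  - by apply contR_mult => //; apply contR_const.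
Qed.

Lemma cdiff_inv (z : C) : z <> 0%C -> cdiff (fun z => / z)%C z (- / (z * z))%C.
Proof.
  intros z0. have m0 : 0 < Cmod z by apply Cmod_gt_0.
  have d0 : 0 < Cmod z / 2 by lra.
  apply (cdiff_of_quadratic _ _ _ (2 / (Cmod z * Cmod z * Cmod z)) (Cmod z / 2) d0) => h Hh.
  have zh : Cmod z / 2 <= Cmod (z + h).
    have := Cmod_triangle_rev z (- h). rewrite Cmod_opp.
    have -> : (z - - h = z + h)%C by ring. lra.
  have zh0 : (z + h <> 0)%C by apply Cmod_gt_0; lra.
  have -> : (/ (z + h) - / z - h * - / (z * z) = (h * h) / ((z * z) * (z + h)))%C by field.
  rewrite Cmod_div; [|by repeat apply Cmult_neq_0]. rewrite !Cmod_mult.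
  rewrite /Rdiv Rmult_comm. apply Rmult_le_compat_r; [have := Cmod_ge_0 h; nra|].
  have -> : 2 * / (Cmod z * Cmod z * Cmod z) = / (Cmod z * Cmod z * (Cmod z / 2)) by field; lra.
  apply Rinv_le_contravar; [apply Rmult_lt_0_compat; nra|].
  apply Rmult_le_compat_l; nra.
Qed.

(** * Integrals over circles *)

Definition circ (r t : R) : C := (r * cos t, r * sin t).

Lemma Cmod_circ r t : 0 <= r -> Cmod (circ r t) = r.
Proof.
  intros r0; rewrite /Cmod /circ /=.
  have -> : r * cos t * (r * cos t * 1) + r * sin t * (r * sin t * 1) = r ^ 2.
    have := sin2_cos2 t; rewrite /Rsqr => E.
    have -> : r ^ 2 = r ^ 2 * (sin t * sin t + cos t * cos t) by rewrite E; ring. ring.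
  by apply sqrt_pow2.
Qed.

Lemma rdiff_circ r t : rdiff (circ r) t (Ci * circ r t)%C.
Proof. apply rdiff_ReIm; simpl; auto_derive => //; rewrite /Re /Im /=; ring. Qed.

Lemma contR_circ r : contR (circ r).
Proof. intros t; by apply (rdiff_continuous _ _ _ (rdiff_circ r t)). Qed.

Lemma circ_2PI r : circ r (2 * PI) = circ r 0.
Proof. by rewrite /circ cos_2PI sin_2PI cos_0 sin_0. Qed.

Lemma circ_minus_ge r w t : 0 <= r -> r - Cmod w <= Cmod (circ r t - w).
Proof. intros r0; have := Cmod_triangle_rev (circ r t) w; rewrite Cmod_circ; lra. Qed.

Lemma circ_minus_neq r w t : Cmod w < r -> (circ r t - w <> 0)%C.
Proof.
  intros H; have hw := Cmod_ge_0 w; apply Cmod_gt_0.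
  have := circ_minus_ge r w t; lra.
Qed.

Lemma contR_inv (f : R -> C) : (forall t, f t <> 0%C) -> contR f -> contR (fun t => / f t)%C.
Proof. intros H0 H t; by apply continuousC_inv. Qed.

Lemma contR_circ_minus r w : contR (fun t => circ r t - w)%C.
Proof. apply contR_minus; [apply contR_circ|apply contR_const]. Qed.

(** The integration variable is the angle. Since d zeta = i zeta dt, Cauchy's kernel d zeta / (2 pi
    i (zeta - w)) becomes zeta dt / (2 pi (zeta - w)); the density [phi] therefore has to carry a
    factor zeta. *)
Definition cauchy_transform (r : R) (phi : R -> C) (w : C) : C :=
  CInt (fun t => phi t / (circ r t - w))%C 0 (2 * PI).

Definition cauchy_transform' (r : R) (phi : R -> C) (w : C) : C :=
  CInt (fun t => phi t / ((circ r t - w) * (circ r t - w)))%C 0 (2 * PI).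

Lemma contR_cauchy r phi w : contR phi -> Cmod w < r ->
  contR (fun t => phi t / (circ r t - w))%C.
Proof.
  intros Hp Hw; apply contR_mult => //; apply contR_inv; [|apply contR_circ_minus].
  intros t; by apply circ_minus_neq.
Qed.

Lemma contR_cauchy' r phi w : contR phi -> Cmod w < r ->
  contR (fun t => phi t / ((circ r t - w) * (circ r t - w)))%C.
Proof.
  intros Hp Hw; apply contR_mult => //; apply contR_inv.
  - intros t; by apply Cmult_neq_0; apply circ_minus_neq.
  - apply contR_mult; apply contR_circ_minus.
Qed.

Lemma PI2_pos : 0 <= 2 * PI.
Proof. have := PI_RGT_0; lra. Qed.

(** Valid for every continuous density, so any continuous function satisfying Cauchy's formula is
    differentiable; [entire_uniform_limit] rests on this. *)
Lemma cauchy_transform_cdiff r phi w : contR phi -> Cmod w < r ->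
  cdiff (cauchy_transform r phi) w (cauchy_transform' r phi w).
Proof.
  intros Hp Hw.
  have w0 := Cmod_ge_0 w.
  destruct (contR_bounded phi 0 (2 * PI) Hp) as [M [M0 HM]].
  set rho := r - Cmod w. have rho0 : 0 < rho by rewrite /rho; lra.
  have d0 : 0 < rho / 2 by lra.
  apply (cdiff_CInt 0 (2 * PI) _ PI2_pos (contR_cauchy' r phi w Hp Hw)
    (fun w t => phi t / (circ r t - w))%C w (M * (2 / (rho * rho * rho))) (rho / 2) d0).
  - intros q Hq; apply contR_cauchy => //.
    have := Cmod_triangle (q - w) w. have -> : (q - w + w = q)%C by ring. rewrite /rho in Hq; lra.
  - intros h t Hh Ht.
    set u := (circ r t - w)%C.
    have hu : rho <= Cmod u by apply circ_minus_ge; lra.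
    have u0 : u <> 0%C by apply Cmod_gt_0; lra.
    have huh : rho / 2 <= Cmod (u - h) by have := Cmod_triangle_rev u h; lra.
    have uh0 : (u - h <> 0)%C by apply Cmod_gt_0; lra.
    have -> : (circ r t - (w + h) = u - h)%C by rewrite /u; ring.
    have -> : (phi t / (u - h) - phi t / u - h * (phi t / (u * u)) =
      phi t * ((h * h) * / (u * u * (u - h))))%C by field.
    rewrite !Cmod_mult Cmod_inv; [|by repeat apply Cmult_neq_0]. rewrite !Cmod_mult.
    rewrite (Rmult_assoc M); apply Rmult_le_compat; [apply Cmod_ge_0| |by apply HM|].
      apply Rmult_le_pos; [have := Cmod_ge_0 h; nra|]. left; apply Rinv_0_lt_compat.
      apply Rmult_lt_0_compat; nra.
    rewrite (Rmult_comm (2 / _)). apply Rmult_le_compat_l; [have := Cmod_ge_0 h; nra|].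
    have -> : 2 / (rho * rho * rho) = / (rho * rho * (rho / 2)) by field; lra.
    apply Rinv_le_contravar; [apply Rmult_lt_0_compat; nra|].
    apply Rmult_le_compat; nra.
Qed.

Lemma cauchy_kernel_rdiff r w t : Cmod w < r ->
  rdiff (fun t => / (circ r t - w))%C t (- (Ci * circ r t / ((circ r t - w) * (circ r t - w))))%C.
Proof.
  intros Hw; have n := circ_minus_neq r w t Hw.
  have := rdiff_comp_c _ (fun t => circ r t - w)%C t _ _ (cdiff_inv _ n)
    (rdiff_plus _ _ t _ _ (rdiff_circ r t) (rdiff_const (- w)%C t)).
  have -> : ((Ci * circ r t + 0) * - / ((circ r t - w) * (circ r t - w)) =
    - (Ci * circ r t / ((circ r t - w) * (circ r t - w))))%C by field.
  done.
Qed.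

(** Derivatives along a circle carry a factor i, which this removes. *)
Lemma C_eq_of_Ci_mult (x : C) : (Ci * x = 0)%C -> x = 0%C.
Proof.
  intros E. have -> : (x = - (Ci * (Ci * x)))%C.
    have : (Ci * Ci = -1)%C by apply injective_projections; simpl; ring.
    intros K. rewrite Cmult_assoc K; ring.
  rewrite E; ring.
Qed.

(** Move w to 0 along s w. The s-derivative is w times the integral of zeta / (zeta - s w)^2, which
    up to the factor i is the t-derivative of a function taking equal values at 0 and 2 pi. At s = 0
    the integrand is 1. *)
Lemma cauchy_kernel_integral r w : Cmod w < r -> cauchy_transform r (circ r) w = RtoC (2 * PI).
Proof.
  intros Hw. have w0 := Cmod_ge_0 w. have r0 : 0 < r by lra.
  have Hs : forall s, 0 <= s <= 1 -> Cmod (RtoC s * w) < r.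
    intros s Hs; rewrite Cmod_mult Cmod_R Rabs_pos_eq; [nra|lra].
  have E := rdiff_eq_of_zero_derivative (fun s => cauchy_transform r (circ r) (RtoC s * w)%C) 0 1.
  rewrite Rmin_left ?Rmax_right in E; [|lra..].
  rewrite Cmult_1_l Cmult_0_l in E. rewrite -E.
  - rewrite /cauchy_transform (CInt_ext _ (fun _ => 1%C)).
      rewrite CInt_const Rminus_0_r; ring.
    intros t _. have := circ_minus_neq r 0%C t. rewrite Cmod_0 => /(_ r0) n.
    have -> : (circ r t - 0 = circ r t)%C by ring.
    field. intros K; apply n; rewrite K; ring.
  - intros s Hs'.
    have := rdiff_comp_c _ (fun s => RtoC s * w)%C s _ _
      (cauchy_transform_cdiff r (circ r) _ (contR_circ r) (Hs s Hs'))
      (rdiff_mult _ _ s _ _ (rdiff_RtoC _ _ _ (is_derive_id s)) (rdiff_const w s)).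
    have -> : cauchy_transform' r (circ r) (s * w)%C = 0%C; [|by rewrite Cmult_0_r].
    apply C_eq_of_Ci_mult. rewrite /cauchy_transform' -CInt_scal; [|by apply contR_cauchy' => //; [apply contR_circ|apply Hs]].
    rewrite (CInt_FTC (fun t => - / (circ r t - s * w))%C).
    + rewrite circ_2PI; ring.
    + intros t _. have := rdiff_scal (-(1))%C _ t _ (cauchy_kernel_rdiff r _ t (Hs s Hs')).
      have n := circ_minus_neq r (s * w)%C t (Hs s Hs').
      set d1 := (- (1) * _)%C. set d2 := (Ci * _)%C.
      have -> : d1 = d2 by rewrite /d1 /d2; field.
      apply rdiff_ext => z'; ring.
    + intros t _. apply contR_mult; [apply contR_const|]. by apply contR_cauchy'; [apply contR_circ|apply Hs].
Qed.

Section CauchyFormulaC1.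
Variables F f : C -> C.
Hypothesis HF : forall z, cdiff F z (f z).
Hypothesis Hf : contC_all f.
Variables (r : R) (w : C).
Hypothesis Hw : Cmod w < r.

Let zeta t := circ r t.

Let HFc : contC_all F.
Proof. intros z; by apply (cdiff_continuous _ _ _ (HF z)). Qed.

Let c_path (G : C -> C) s : contC_all G -> contR (fun t => G (w + RtoC s * (zeta t - w))%C).
Proof.
  intros HG t; apply (continuous_comp (fun t : R => w + RtoC s * (zeta t - w))%C G); [|apply HG].
  have := contR_circ r t => k. rewrite /zeta; contC.
Qed.

Let c_ker : contR (fun t => zeta t / (zeta t - w))%C.
Proof. apply contR_cauchy => //; apply contR_circ. Qed.

(* Cauchy's formula by homotopy: this vanishing integral is the s-derivative of
   int F (w + s (zeta - w)) zeta / (zeta - w), which goes from 2 pi F w at s = 0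
   to the Cauchy integral at s = 1. *)
Lemma homotopy_derivative_zero s :
  CInt (fun t => f (w + RtoC s * (zeta t - w)) * zeta t)%C 0 (2 * PI) = 0%C.
Proof.
  have cD : contR (fun t => f (w + RtoC s * (zeta t - w)) * zeta t)%C.
    apply contR_mult; [by apply c_path|apply contR_circ].
  destruct (Req_dec s 0) as [->|s0].
  - rewrite (CInt_ext _ (fun t => f w * zeta t)%C); [|intros; congr (f _ * _)%C; ring].
    rewrite CInt_scal; [|apply contR_circ].
    have -> : CInt zeta 0 (2 * PI) = 0%C; [|ring].
    apply C_eq_of_Ci_mult. rewrite -CInt_scal; [|apply contR_circ].
    rewrite (CInt_FTC zeta); [rewrite /zeta circ_2PI; ring|intros; apply rdiff_circ|].
    intros t _; apply contR_mult; [apply contR_const|apply contR_circ].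
  - have sC : RtoC s <> 0%C by intros K; apply s0, RtoC_inj.
    have E : (RtoC s * (Ci * CInt (fun t => f (w + RtoC s * (zeta t - w)) * zeta t) 0 (2 * PI)) = 0)%C.
      rewrite Cmult_assoc -CInt_scal //.
      rewrite (CInt_FTC (fun t => F (w + RtoC s * (zeta t - w)))%C).
      + rewrite /zeta circ_2PI; ring.
      + intros t _.
        apply (rdiff_eq _ _ _ _ (rdiff_comp_c F _ t _ _ (HF _) (rdiff_plus _ _ t _ _ (rdiff_const w t)
          (rdiff_scal (RtoC s) _ t _ (rdiff_plus _ _ t _ _ (rdiff_circ r t) (rdiff_const (- w)%C t)))))).
        rewrite /zeta /Cminus; ring.
      + intros t _; apply contR_mult => //; apply contR_const.
    apply C_eq_of_Ci_mult. set x := (Ci * _)%C in E *.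
    have -> : (x = / s * (s * x))%C by field. rewrite E; ring.
Qed.

Lemma cauchy_formula_C1 :
  (RtoC (2 * PI) * F w = CInt (fun t => F (zeta t) * (zeta t / (zeta t - w))) 0 (2 * PI))%C.
Proof.
  have w0 := Cmod_ge_0 w. have r0 : 0 < r by lra.
  pose G s t := (F (w + RtoC s * (zeta t - w)) * (zeta t / (zeta t - w)))%C.
  have cG : forall s, contR (G s) by intros s; apply contR_mult => //; by apply c_path.
  have E := rdiff_eq_of_zero_derivative (fun s => CInt (G s) 0 (2 * PI)) 0 1.
  have E' : CInt (G 0) 0 (2 * PI) = CInt (G 1) 0 (2 * PI).
    apply E => s Hs. rewrite Rmin_left ?Rmax_right in Hs; [|lra..].
    rewrite -(homotopy_derivative_zero s).
    apply rdiff_CInt_uniform => //; [apply PI2_pos| |].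
      apply contR_mult; [by apply c_path|apply contR_circ].
    intros e e0.
    have k : 0 < r + Cmod w by lra.
    have e1 : 0 < e / (r + Cmod w) * ((r - Cmod w) / r).
      (* The tolerance compensates two losses: |zeta - w| <= r + |w| in the increment, and |zeta /
         (zeta - w)| <= r / (r - |w|) in the kernel. *)
      apply Rmult_lt_0_compat; apply Rdiv_lt_0_compat; lra.
    destruct (uniform_cdiff F f (r + 2 * Cmod w) _ HF Hf e1) as [d [d0 Hd]].
    exists (d / (r + Cmod w)); split; [by apply Rdiv_lt_0_compat|] => h t Hh _.
    have n := circ_minus_neq r w t Hw.
    have hz : Cmod (zeta t - w) <= r + Cmod w.
      have := Cmod_triangle_minus (zeta t) w. rewrite /zeta Cmod_circ; lra.
    have hz2 : r - Cmod w <= Cmod (zeta t - w) by apply circ_minus_ge; lra.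
    have ha := Rabs_pos h.
    have H1 : Cmod (w + s * (zeta t - w)) <= r + 2 * Cmod w.
      have := Cmod_triangle w (s * (zeta t - w)). rewrite Cmod_mult Cmod_R Rabs_pos_eq; nra.
    have H2 : Cmod (h * (zeta t - w)) < d.
      rewrite Cmod_mult Cmod_R.
      apply Rle_lt_trans with (Rabs h * (r + Cmod w)); [by apply Rmult_le_compat_l|].
      apply (Rmult_lt_reg_r (/ (r + Cmod w))); [by apply Rinv_0_lt_compat|].
      replace (Rabs h * (r + Cmod w) * / (r + Cmod w)) with (Rabs h) by (field; lra). exact Hh.
    have H := Hd _ _ H1 H2. rewrite /G.
    have -> : (w + (s + h)%R * (zeta t - w) = w + s * (zeta t - w) + h * (zeta t - w))%C.
      rewrite RtoC_plus; ring.
    set z := (w + s * (zeta t - w))%C in H *. set dz := (h * (zeta t - w))%C in H *.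
    have -> : (F (z + dz) * (zeta t / (zeta t - w)) - F z * (zeta t / (zeta t - w)) - h * (f z * zeta t) =
      (F (z + dz) - F z - dz * f z) * (zeta t / (zeta t - w)))%C by rewrite /dz; field.
    rewrite Cmod_mult Cmod_div // Cmod_circ; [|lra].
    rewrite /dz Cmod_mult Cmod_R in H.
    have hq : r / Cmod (zeta t - w) <= r / (r - Cmod w).
      apply Rmult_le_compat_l; [lra|]. apply Rinv_le_contravar; lra.
    have hq0 : 0 <= r / Cmod (zeta t - w) by apply Rle_div_r; lra.
    apply Rle_trans with ((e / (r + Cmod w) * ((r - Cmod w) / r)) * (Rabs h * (r + Cmod w)) * (r / (r - Cmod w))).
    - apply Rmult_le_compat => //; [apply Cmod_ge_0|].
      apply Rle_trans with (1 := H). apply Rmult_le_compat_l; [lra|]. by apply Rmult_le_compat_l.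
    - right; field; lra.
  move: E'; rewrite /G.
  rewrite (CInt_ext _ (fun t => F w * (zeta t / (zeta t - w)))%C); last first.
    intros t _; congr (F _ * _)%C; ring.
  rewrite CInt_scal //. have := cauchy_kernel_integral r w Hw; rewrite /cauchy_transform -/zeta => -> E'.
  rewrite Cmult_comm E'. apply CInt_ext => t _; congr (F _ * _)%C; ring.
Qed.
End CauchyFormulaC1.

(** The derivative of [f] is not known to be continuous, so the formula for continuously
    differentiable functions is applied to the primitive [F]. Differentiating it in w squares the
    kernel, and integration by parts in t restores the kernel and turns [F] into [f]. *)
Lemma cauchy_formula f r w : entire f -> Cmod w < r ->
  (RtoC (2 * PI) * f w = cauchy_transform r (fun t => f (circ r t) * circ r t) w)%C.
Proof.
  intros Hf Hw.
  have HF := primitive_cdiff f Hf. set F := primitive f in HF.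
  have Cf := entire_continuous f Hf.
  have CF : contC_all F by intros z; apply (cdiff_continuous _ _ _ (HF z)).
  have cc : forall G, contC_all G -> contR (fun t => G (circ r t) * circ r t)%C.
    intros G HG; apply contR_mult; [|apply contR_circ].
    intros t; apply (continuous_comp (circ r) G); [apply contR_circ|apply HG].
  have E1 : (RtoC (2 * PI) * f w = cauchy_transform' r (fun t => F (circ r t) * circ r t) w)%C.
    apply (cdiff_unique (cauchy_transform r (fun t => F (circ r t) * circ r t)%C) w); last first.
      apply cauchy_transform_cdiff => //; by apply cc.
    have := cdiff_mult _ _ w _ _ (cdiff_const (RtoC (2 * PI)) w) (HF w).
    rewrite Cmult_0_l Cplus_0_l. apply cdiff_ext_loc.
    apply locally_C; exists (r - Cmod w); split; [lra|] => y Hy.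
    rewrite (cauchy_formula_C1 F f HF Cf r y).
      apply CInt_ext => t _; rewrite /Cdiv; ring.
    have := Cmod_triangle (y - w) w. have -> : (y - w + w = y)%C by ring. lra.
  rewrite E1. apply Ceq_minus.
  have c1 := contR_cauchy' r _ w (cc F CF) Hw. have c2 := contR_cauchy r _ w (cc f Cf) Hw.
  rewrite /cauchy_transform /cauchy_transform' -CInt_minus //.
  apply C_eq_of_Ci_mult; rewrite -CInt_scal; [|by apply contR_minus].
  rewrite (CInt_FTC (fun t => - (F (circ r t) * / (circ r t - w)))%C).
  - rewrite circ_2PI; ring.
  - intros t _.
    have := rdiff_scal (-(1))%C _ t _ (rdiff_mult _ _ t _ _
      (rdiff_comp_c F _ t _ _ (HF _) (rdiff_circ r t)) (cauchy_kernel_rdiff r w t Hw)).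
    have n := circ_minus_neq r w t Hw.
    set d1 := (- (1) * _)%C. set d2 := (Ci * _)%C.
    have -> : d1 = d2 by rewrite /d1 /d2; field.
    apply rdiff_ext => t'; ring.
  - intros t _; apply contR_mult; [apply contR_const|by apply contR_minus].
Qed.

Lemma cauchy_bound f r w M : entire f -> Cmod w < r ->
  (forall z, Cmod z = r -> Cmod (f z) <= M) -> Cmod (f w) <= M * (r / (r - Cmod w)).
Proof.
  intros Hf Hw HM. have w0 := Cmod_ge_0 w. have r0 : 0 < r by lra.
  have P0 := PI_RGT_0.
  have E := cauchy_formula f r w Hf Hw.
  apply (Rmult_le_reg_l (2 * PI)); [lra|].
  have -> : 2 * PI * Cmod (f w) = Cmod (RtoC (2 * PI) * f w).
    rewrite Cmod_mult Cmod_R Rabs_pos_eq; lra.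
  rewrite E.
  eapply Rle_trans; [apply (CInt_norm_le _ _ _ (M * (r / (r - Cmod w)))); [lra| |]|right; ring].
  - apply contR_cauchy => //. apply contR_mult; [|apply contR_circ].
    intros t; apply (continuous_comp (circ r) f); [apply contR_circ|by apply entire_continuous].
  - intros t _. rewrite Cmod_div; [|by apply circ_minus_neq].
    rewrite Cmod_mult Cmod_circ; [|lra].
    have hz2 : r - Cmod w <= Cmod (circ r t - w) by apply circ_minus_ge; lra.
    have h := HM (circ r t) (Cmod_circ r t ltac:(lra)).
    have hf := Cmod_ge_0 (f (circ r t)).
    rewrite /Rdiv Rmult_assoc. apply Rmult_le_compat => //.
      apply Rmult_le_pos; [lra|]. left; apply Rinv_0_lt_compat; lra.
    apply Rmult_le_compat_l; [lra|]. apply Rinv_le_contravar; lra.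
Qed.

Lemma entire_div_id f : entire f -> (forall z, Cmod z < 1 -> f z = 0%C) ->
  entire (fun z => f z / z)%C.
Proof.
  intros Hf H0 c. destruct (Rlt_dec (Cmod c) 1) as [h|h].
  - exists 0%C. apply (cdiff_ext_loc (fun _ => 0%C)); [|apply cdiff_const].
    apply locally_C; exists (1 - Cmod c); split; [lra|] => y Hy.
    rewrite H0; [by rewrite /Cdiv Cmult_0_l|].
    have := Cmod_triangle (y - c) c. have -> : (y - c + c = y)%C by ring. lra.
  - destruct (Hf c) as [l Hl]. eexists. apply cdiff_mult; [exact Hl|].
    apply cdiff_inv. apply Cmod_gt_0; lra.
Qed.

(* Dividing by [z^k] keeps [f] entire because [f] vanishes near [0]; Cauchy's
   estimate on the circle [|z| = 2|w|] then gives [|f w| = O(2^-k)]. *)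
Lemma entire_vanishing f : entire f -> (forall z, Cmod z < 1 -> f z = 0%C) -> forall w, f w = 0%C.
Proof.
  intros Hf H0 w.
  destruct (Rlt_dec (Cmod w) 1) as [h|h]; [by apply H0|].
  have w0 : w <> 0%C by apply Cmod_gt_0; lra.
  have G : forall k, entire (fun z => f z / z ^ k)%C /\ (forall z, Cmod z < 1 -> (f z / z ^ k)%C = 0%C).
    elim => [|k [IH1 IH2]].
    - split; [|intros z Hz; rewrite H0 // /Cdiv; ring].
      intros c; destruct (Hf c) as [l Hl]; exists l. apply cdiff_ext with (2 := Hl).
      intros z; rewrite /=; field; apply C1_nz.
    - split; [|intros z Hz; rewrite H0 // /Cdiv; ring].
      have := entire_div_id _ IH1 IH2. intros J c; destruct (J c) as [l Hl]; exists l.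
      apply cdiff_ext with (2 := Hl) => z. rewrite /=.
      destruct (Ceq_dec z 0) as [->|n].
        rewrite (H0 0%C); [rewrite /Cdiv; ring|rewrite Cmod_0; lra].
      field; split => //; by apply Cpow_nz.
  set r := 2 * Cmod w. have hr : Cmod w < r by rewrite /r; lra.
  destruct (contR_bounded (fun t => f (circ r t)) 0 (2 * PI)) as [M [M0 HM]].
    intros t; apply (continuous_comp (circ r) f); [apply contR_circ|by apply entire_continuous].
  have [M' HM'] : exists M', forall z, Cmod z <= r -> Cmod (f z) <= M'.
    destruct (contC_all_uniform f r 1 (entire_continuous f Hf) Rlt_0_1) as [d [d0 Hd]].
    (* [f] varies by at most 1 on each of the [N] steps, shorter than [d], leading from 0 to [z]. *)
    destruct (INR_unbounded (r / d)) as [N HN'].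
    have N0 : 0 < INR N by apply Rle_lt_trans with (2 := HN'); apply Rle_div_r; lra.
    exists (INR N) => z Hz.
    have step : forall k, (k <= N)%nat -> Cmod (f (RtoC (INR k / INR N) * z)%C) <= INR k.
      elim => [_|k IH Hk].
        rewrite /= /Rdiv Rmult_0_l Cmult_0_l (H0 0%C); rewrite Cmod_0; lra.
      have := IH ltac:(lia) => IH'.
      have kN : INR k <= INR N by apply le_INR; lia.
      have fr : 0 <= INR k / INR N <= 1.
        split; [apply Rle_div_r; have := pos_INR k; lra|]. apply Rle_div_l; lra.
      have := Hd (RtoC (INR k / INR N) * z)%C (RtoC (INR (S k) / INR N) * z)%C.
      have -> : (RtoC (INR (S k) / INR N) * z - RtoC (INR k / INR N) * z = RtoC (/ INR N) * z)%C.
        rewrite S_INR. have -> : (INR k + 1) / INR N = INR k / INR N + / INR N by field; lra.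
        rewrite RtoC_plus; ring.
      rewrite !Cmod_mult !Cmod_R (Rabs_pos_eq (INR k / INR N)) ?(Rabs_pos_eq (/ INR N)); [|left; by apply Rinv_0_lt_compat|lra].
      have z0 := Cmod_ge_0 z. move=> K.
      have K' := K ltac:(nra). have q : / INR N * Cmod z < d.
        apply (Rmult_lt_reg_l (INR N)) => //. rewrite -Rmult_assoc Rinv_r; [|lra].
        apply Rlt_div_l in HN' => //. lra.
      have := Cmod_triangle_rev (f (RtoC (INR (S k) / INR N) * z)%C) (f (RtoC (INR k / INR N) * z)%C).
      have := K' q. rewrite S_INR; lra.
    have := step N (Nat.le_refl N). have -> : INR N / INR N = 1 by field; lra.
    by rewrite Cmult_1_l.
  have est : forall k, Cmod (f w) <= 2 * M' * (/ 2) ^ k.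
    intros k. destruct (G k) as [Gk _].
    have rk : 0 < r ^ k by apply pow_lt; lra.
    have := cauchy_bound _ r w (M' / r ^ k) Gk hr.
    have -> : r / (r - Cmod w) = 2 by rewrite /r; field; lra.
    rewrite Cmod_div; [|by apply Cpow_nz]. rewrite Cmod_pow => K.
    have wk : 0 < Cmod w ^ k by apply pow_lt; lra.
    have := K _ => {K} K.
    have K2 : Cmod (f w) / Cmod w ^ k <= M' / r ^ k * 2.
      apply K => z Hz. have z0 : z <> 0%C by apply Cmod_gt_0; lra.
      rewrite Cmod_div; [|by apply Cpow_nz]. rewrite Cmod_pow Hz.
      apply Rmult_le_compat_r; [left; by apply Rinv_0_lt_compat|]. apply HM'; lra.
    apply (Rmult_le_reg_r (/ Cmod w ^ k)); [by apply Rinv_0_lt_compat|].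
    apply Rle_trans with (1 := K2). right. rewrite /r Rpow_mult_distr pow_inv. field.
    by repeat split; apply pow_nonzero; lra.
  have L : is_lim_seq (fun k => 2 * M' * (/ 2) ^ k) 0.
    replace (Finite 0) with (Rbar_mult (2 * M') (Finite 0)) by (simpl; f_equal; ring).
    apply is_lim_seq_scal_l, is_lim_seq_geom. rewrite Rabs_pos_eq; lra.
  have := is_lim_seq_le _ _ _ _ est (is_lim_seq_const (Cmod (f w))) L => /= K.
  apply Cmod_eq_0. have := Cmod_ge_0 (f w); lra.
Qed.

(** Weierstrass's theorem: Cauchy's formula on a circle survives the uniform limit, and a Cauchy
    transform of a continuous density is differentiable. Continuity of the limit is obtained
    beforehand to make its density admissible. *)
Lemma entire_uniform_limit (P : nat -> C -> C) (p : C -> C) :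
  (forall n, entire (P n)) ->
  (forall r eps, 0 < eps -> exists N, forall n, (N <= n)%nat -> forall z, Cmod z <= r ->
     Cmod (P n z - p z) <= eps) -> entire p.
Proof.
  intros HP Hl.
  have Cp : contC_all p.
    intros z; apply continuous_CC => e e0.
    have e4 : 0 < e / 4 by lra.
    destruct (Hl (Cmod z + 1) _ e4) as [N HN].
    destruct (proj1 (continuous_CC _ _) (entire_continuous _ (HP N) z) _ e4) as [d [d0 Hd]].
    exists (Rmin 1 d); split; [apply Rmin_pos; lra|] => y Hy.
    have k1 := Rmin_l 1 d; have k2 := Rmin_r 1 d.
    have hy : Cmod y <= Cmod z + 1.
      have := Cmod_triangle (y - z) z. have -> : (y - z + z = y)%C by ring. lra.
    have h1 := HN N (Nat.le_refl N) y hy. have h2 := HN N (Nat.le_refl N) z ltac:(lra).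
    have h3 := Hd y ltac:(lra).
    have -> : (p y - p z = (P N y - P N z) - (P N y - p y) + (P N z - p z))%C by ring.
    have := Cmod_triangle ((P N y - P N z) - (P N y - p y)) (P N z - p z).
    have := Cmod_triangle_minus (P N y - P N z) (P N y - p y). lra.
  intros c. set r := Cmod c + 1. have c0 := Cmod_ge_0 c.
  have cc : forall G, contC_all G -> contR (fun t => G (circ r t) * circ r t)%C.
    intros G HG; apply contR_mult; [|apply contR_circ].
    intros t; apply (continuous_comp (circ r) G); [apply contR_circ|apply HG].
  have P0 := PI_RGT_0.
  have E : forall w, Cmod w < r -> (RtoC (2 * PI) * p w = cauchy_transform r (fun t => p (circ r t) * circ r t) w)%C.
    intros w Hw. have w0 := Cmod_ge_0 w.
    apply (C_eq_of_Cmod_small _ _ (2 * PI + r * / (r - Cmod w) * (2 * PI))) => e e0.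
    destruct (Hl r e e0) as [N HN].
    have EN := cauchy_formula (P N) r w (HP N) Hw.
    have cN := entire_continuous _ (HP N).
    set T := cauchy_transform r (fun t => p (circ r t) * circ r t)%C w.
    have -> : (RtoC (2 * PI) * p w - T =
      (cauchy_transform r (fun t => P N (circ r t) * circ r t) w - T) - RtoC (2 * PI) * (P N w - p w))%C.
      rewrite -EN; ring.
    eapply Rle_trans; [apply Cmod_triangle_minus|].
    rewrite Cmod_mult Cmod_R Rabs_pos_eq; [|lra].
    have h1 := HN N (Nat.le_refl N) w ltac:(lra).
    have h2 : Cmod (cauchy_transform r (fun t => P N (circ r t) * circ r t)%C w - T) <= (e * r * / (r - Cmod w)) * (2 * PI - 0).
      rewrite /T /cauchy_transform -CInt_minus; [|by apply contR_cauchy => //; apply cc..].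
      apply CInt_norm_le; [lra|by apply contR_minus; apply contR_cauchy => //; apply cc|].
      intros t _. have n := circ_minus_neq r w t Hw.
      have -> : (P N (circ r t) * circ r t / (circ r t - w) - p (circ r t) * circ r t / (circ r t - w) =
        (P N (circ r t) - p (circ r t)) * circ r t * / (circ r t - w))%C by field.
      have hc : Cmod (circ r t) = r by apply Cmod_circ; lra.
      rewrite !Cmod_mult Cmod_inv // hc.
      have hz2 : r - Cmod w <= Cmod (circ r t - w) by apply circ_minus_ge; lra.
      apply Rmult_le_compat.
      - apply Rmult_le_pos; [apply Cmod_ge_0|lra].
      - left; apply Rinv_0_lt_compat; lra.
      - apply Rmult_le_compat_r; [lra|]. apply HN => //. by right.
      - apply Rinv_le_contravar; lra.
    nra.
  have PC : RtoC (2 * PI) <> 0%C by intros K; apply RtoC_inj in K; lra.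
  eexists. apply (cdiff_ext_loc (fun w => / RtoC (2 * PI) * cauchy_transform r (fun t => p (circ r t) * circ r t)%C w)%C).
  - apply locally_C; exists 1; split; [lra|] => y Hy. rewrite -E; [by field|].
    have := Cmod_triangle (y - c) c. have -> : (y - c + c = y)%C by ring. rewrite /r; lra.
  - apply cdiff_mult; [apply cdiff_const|]. apply cauchy_transform_cdiff; [by apply cc|rewrite /r; lra].
Qed.

(** * The reciprocal Gamma function *)

Definition cexp (s : C) : C := (exp (Re s) * cos (Im s), exp (Re s) * sin (Im s)).

Lemma cexp_plus a b : cexp (a + b) = (cexp a * cexp b)%C.
Proof.
  rewrite /cexp; have -> : Re (a + b) = Re a + Re b by []. have -> : Im (a + b) = Im a + Im b by [].
  rewrite exp_plus cos_plus sin_plus; apply injective_projections; simpl; ring.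
Qed.

Lemma cexp_0 : cexp 0 = 1%C.
Proof. by rewrite /cexp /= exp_0 cos_0 sin_0 !Rmult_1_l. Qed.

Lemma Cmod_cexp s : Cmod (cexp s) = exp (Re s).
Proof. apply Cmod_circ; left; apply exp_pos. Qed.

Lemma cexp_neq0 s : cexp s <> 0%C.
Proof. apply Cmod_gt_0; rewrite Cmod_cexp; apply exp_pos. Qed.

Lemma cexp_opp s : cexp (- s) = (/ cexp s)%C.
Proof.
  have H : (cexp (- s) * cexp s = 1)%C.
    rewrite -cexp_plus -cexp_0; f_equal; ring.
  have n := cexp_neq0 s. have -> : cexp (- s) = (cexp (- s) * cexp s * / cexp s)%C by field.
  rewrite H; ring.
Qed.

Lemma rdiff_cexp_line h t : rdiff (fun t => cexp (RtoC t * h)) t (h * cexp (RtoC t * h))%C.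
Proof.
  have E : forall t, cexp (RtoC t * h) = (exp (t * fst h) * cos (t * snd h), exp (t * fst h) * sin (t * snd h)).
    by intros u; rewrite /cexp re_scal_l im_scal_l.
  apply (rdiff_ext (fun t => (exp (t * fst h) * cos (t * snd h), exp (t * fst h) * sin (t * snd h)))) => //.
  rewrite E; apply rdiff_ReIm; rewrite /Re /Im /=; auto_derive => //; ring.
Qed.

Lemma exp_le x y : x <= y -> exp x <= exp y.
Proof. intros [H| ->]; [left; by apply exp_increasing|by right]. Qed.

Lemma exp_Re_le s t : 0 <= t <= 1 -> exp (Re (RtoC t * s)) <= exp (Cmod s).
Proof.
  intros Ht; apply exp_le. rewrite re_scal_l.
  have := re_le_Cmod s; have := Rle_abs (Re s); have := Cmod_ge_0 s. nra.
Qed.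

Lemma contR_cexp_line h : contR (fun t => cexp (RtoC t * h)).
Proof. intros t; apply (rdiff_continuous _ _ _ (rdiff_cexp_line h t)). Qed.

Lemma cexp_estimate1 h : Cmod (cexp h - 1) <= Cmod h * exp (Cmod h).
Proof.
  have -> : (cexp h - 1 = CInt (fun t => h * cexp (RtoC t * h)) 0 1)%C.
    rewrite (CInt_FTC (fun t => cexp (RtoC t * h))).
    - by rewrite Cmult_0_l Cmult_1_l cexp_0.
    - intros; apply rdiff_cexp_line.
    - intros t _; apply contR_mult; [apply contR_const|apply contR_cexp_line].
  eapply Rle_trans; [apply (CInt_norm_le _ 0 1 (Cmod h * exp (Cmod h)))|lra]; [lra| |].
  - apply contR_mult; [apply contR_const|apply contR_cexp_line].
  - intros t Ht; rewrite Cmod_mult Cmod_cexp. apply Rmult_le_compat_l; [apply Cmod_ge_0|].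
    by apply exp_Re_le.
Qed.

Lemma cexp_estimate2 h : Cmod (cexp h - 1 - h) <= Cmod h * Cmod h * exp (Cmod h).
Proof.
  have -> : (cexp h - 1 - h = CInt (fun t => h * (cexp (RtoC t * h) - 1)) 0 1)%C.
    rewrite CInt_scal ?CInt_minus ?CInt_const; [|apply contR_cexp_line|apply contR_const|].
    - have -> : (cexp h - 1 = h * CInt (fun t => cexp (RtoC t * h)) 0 1)%C.
        rewrite -CInt_scal; [|apply contR_cexp_line].
        rewrite (CInt_FTC (fun t => cexp (RtoC t * h))).
        + by rewrite Cmult_0_l Cmult_1_l cexp_0.
        + intros; apply rdiff_cexp_line.
        + intros t _; apply contR_mult; [apply contR_const|apply contR_cexp_line].
      rewrite Rminus_0_r; ring.
    - apply contR_minus; [apply contR_cexp_line|apply contR_const].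
  have h0 := Cmod_ge_0 h.
  eapply Rle_trans; [apply (CInt_norm_le _ 0 1 (Cmod h * Cmod h * exp (Cmod h)))|lra]; [lra| |].
  - apply contR_mult; [apply contR_const|]. apply contR_minus; [apply contR_cexp_line|apply contR_const].
  - intros t Ht; rewrite Cmod_mult Rmult_assoc. apply Rmult_le_compat_l => //.
    eapply Rle_trans; [apply cexp_estimate1|].
    have E : Cmod (t * h) <= Cmod h by rewrite Cmod_mult Cmod_R Rabs_pos_eq; [nra|lra].
    apply Rmult_le_compat => //; [apply Cmod_ge_0|left; apply exp_pos|by apply exp_le].
Qed.

Lemma cdiff_cexp z : cdiff cexp z (cexp z).
Proof.
  apply (cdiff_of_quadratic _ _ _ (Cmod (cexp z) * exp 1) 1 Rlt_0_1) => h Hh.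
  rewrite cexp_plus.
  have -> : (cexp z * cexp h - cexp z - h * cexp z = cexp z * (cexp h - 1 - h))%C by ring.
  rewrite Cmod_mult Rmult_assoc; apply Rmult_le_compat_l; [apply Cmod_ge_0|].
  eapply Rle_trans; [apply cexp_estimate2|]. rewrite Rmult_comm.
  apply Rmult_le_compat_r; [have := Cmod_ge_0 h; nra|]. apply exp_le; lra.
Qed.

Lemma cpow_cexp u a : 0 < u -> cpow u a = cexp (a * RtoC (ln u)).
Proof.
  intros u0; rewrite /cpow; destruct (Rlt_dec 0 u); [|tauto].
  rewrite /cexp.
  have -> : Re (a * ln u) = Re a * ln u by rewrite re_scal_r.
  have -> : Im (a * ln u) = Im a * ln u by rewrite im_scal_r.
  done.
Qed.

Lemma cpow_nonpos u a : u <= 0 -> cpow u a = 0%C.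
Proof. intros H; rewrite /cpow; destruct (Rlt_dec 0 u) => //; lra. Qed.

Lemma cpow_plus u a b : cpow u (a + b) = (cpow u a * cpow u b)%C.
Proof.
  destruct (Rlt_dec 0 u) as [h|h].
  - rewrite !cpow_cexp // -cexp_plus; f_equal; ring.
  - rewrite !cpow_nonpos; try lra; ring.
Qed.

Lemma cpow_1 u : 0 < u -> cpow u 1 = RtoC u.
Proof.
  intros h; rewrite cpow_cexp // Cmult_1_l /cexp /= cos_0 sin_0 exp_ln //.
  by rewrite Rmult_1_r Rmult_0_r.
Qed.

Lemma cpow_plus1 u a : cpow u (a + 1) = (RtoC u * cpow u a)%C.
Proof.
  destruct (Rlt_dec 0 u) as [h|h].
  - rewrite cpow_plus cpow_1 //; ring.
  - rewrite !cpow_nonpos; try lra; ring.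
Qed.

Lemma cpow_neq0 u a : 0 < u -> cpow u a <> 0%C.
Proof. intros h; rewrite cpow_cexp //; apply cexp_neq0. Qed.

Lemma Cmod_cpow u a : 0 < u -> Cmod (cpow u a) = exp (Re a * ln u).
Proof. intros h; by rewrite cpow_cexp // Cmod_cexp re_scal_r. Qed.

Lemma cpow_base1 a : cpow 1 a = 1%C.
Proof. by rewrite cpow_cexp ?ln_1 ?Cmult_0_r ?cexp_0 //; lra. Qed.

Lemma rdiff_cpow u a : 0 < u -> rdiff (fun u => cpow u a) u (a * cpow u (a - 1))%C.
Proof.
  intros h.
  apply (rdiff_ext_loc (fun u => cexp (RtoC (ln u) * a)%C)).
    apply locally_R; exists u; split => // y Hy. rewrite cpow_cexp; [f_equal; ring|].
    split_Rabs; lra.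
  have D : rdiff (fun u => RtoC (ln u) * a)%C u (RtoC (/ u) * a + RtoC (ln u) * 0)%C.
    apply (rdiff_mult (fun u => RtoC (ln u))); [|apply rdiff_const]. apply (rdiff_RtoC ln). by apply is_derive_Reals, derivable_pt_lim_ln.
  apply (rdiff_eq _ _ _ _ (rdiff_comp_c cexp (fun u => RtoC (ln u) * a)%C _ _ _ (cdiff_cexp _) D)).
  have E : cpow u a = (RtoC u * cpow u (a - 1))%C.
    rewrite -cpow_plus1; f_equal; ring.
  have <- : cpow u a = cexp (ln u * a) by rewrite cpow_cexp // Cmult_comm.
  have uC : RtoC u <> 0%C by move=> /RtoC_inj; lra.
  rewrite E RtoC_inv; [|lra]. by field.
Qed.

Lemma contR_cpow a : 0 < Re a -> contR (fun u => cpow u a).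
Proof.
  intros a0 u.
  destruct (Rtotal_order 0 u) as [h|[h|h]].
  - apply (rdiff_continuous _ _ _ (rdiff_cpow u a h)).
  - subst u. apply continuous_RC => e e0.
    exists (exp (ln e / Re a)); split; [apply exp_pos|] => y Hy.
    rewrite (cpow_nonpos 0) ?Rle_refl //.
    have -> : (cpow y a - 0 = cpow y a)%C by ring.
    destruct (Rlt_dec 0 y) as [y0|y0]; [|rewrite cpow_nonpos ?Cmod_0; lra].
    rewrite Cmod_cpow //.
    rewrite Rminus_0_r Rabs_pos_eq in Hy; [|lra].
    have L : ln y < ln e / Re a by rewrite -(ln_exp (ln e / Re a)); by apply ln_increasing.
    rewrite -[X in _ < X](exp_ln e) //. apply exp_increasing.
    apply Rlt_div_r in L => //; lra.
    by right.
  - apply (continuous_ext_loc (U := C_UniformSpace) _ (fun _ => RtoC 0)); [|apply continuous_const].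
    apply locally_R; exists (- u); split; [lra|] => y Hy.
    rewrite cpow_nonpos //. split_Rabs; lra.
Qed.

(** * Gauss's products and their limit *)

Definition gauss (n : nat) (s : C) : C :=
  (poch s (S n) / (RtoC (INR (fact n)) * cpow (INR n) s))%C.

Lemma RtoC_neq0 (x : R) : x <> 0 -> RtoC x <> 0%C.
Proof. intros H K; by apply H, RtoC_inj. Qed.

Lemma INR_C_neq0 n : (0 < n)%nat -> RtoC (INR n) <> 0%C.
Proof. intros H; apply RtoC_neq0, not_0_INR; lia. Qed.

Lemma fact_C_neq0 n : RtoC (INR (fact n)) <> 0%C.
Proof. apply INR_C_neq0; have := fact_neq_0 n; lia. Qed.

(** The quotient of consecutive Gauss products, (1 + s/(n+1)) (n/(n+1))^s. It is 1 + O(1/n^2),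
    whence convergence. *)
Definition gauss_ratio (n : nat) (s : C) : C :=
  ((1 + s * RtoC (/ INR (S n))) * cexp (- s * RtoC (ln (INR (S n)) - ln (INR n))%R))%C.

Lemma gauss_S n s : (0 < n)%nat -> gauss (S n) s = (gauss n s * gauss_ratio n s)%C.
Proof.
  intros n0.
  have p0 : 0 < INR n by apply lt_0_INR.
  have p1 : 0 < INR (S n) by apply lt_0_INR; lia.
  have E : cexp (- s * RtoC (ln (INR (S n)) - ln (INR n))%R) = (cpow (INR n) s / cpow (INR (S n)) s)%C.
    rewrite !cpow_cexp // /Cdiv -cexp_opp -cexp_plus RtoC_minus; f_equal; ring.
  rewrite /gauss /gauss_ratio E.
  have -> : fact (S n) = (S n * fact n)%nat by [].
  rewrite mult_INR RtoC_mult RtoC_inv; [|lra].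
  rewrite -[poch s (S (S n))]/(poch s (S n) * (s + RtoC (INR (S n))))%C.
  field; repeat split; try apply fact_C_neq0; try (apply INR_C_neq0; lia); by apply cpow_neq0.
Qed.

Lemma gauss_1 s : gauss 1 s = (s * (s + 1))%C.
Proof. rewrite /gauss /= cpow_base1 Cplus_0_r; field; apply C1_nz. Qed.

Lemma ln_ratio_bounds n : (0 < n)%nat ->
  / INR (S n) <= ln (INR (S n)) - ln (INR n) <= / INR n.
Proof.
  intros n0.
  have p0 : 0 < INR n by apply lt_0_INR.
  have p1 : 0 < INR (S n) by apply lt_0_INR; lia.
  have E := S_INR n.
  rewrite -ln_div //. split.
  - have q : 0 < 1 + - / INR (S n).
      have : / INR (S n) < 1; [|lra]. rewrite -Rinv_1. apply Rinv_lt_contravar; lra.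
    have := ln_le _ _ q (exp_ineq1_le (- / INR (S n))). rewrite ln_exp.
    have -> : 1 + - / INR (S n) = / (INR (S n) / INR n) by rewrite E; field; lra.
    rewrite ln_Rinv; [lra|by apply Rdiv_lt_0_compat].
  - rewrite -(ln_exp (/ INR n)).
    have -> : INR (S n) / INR n = 1 + / INR n by rewrite E; field; lra.
    apply ln_le; [|apply exp_ineq1_le]. have := Rinv_0_lt_compat _ p0; lra.
Qed.

(** Bounding 1/n^2 by a telescoping difference avoids series: errors accumulated from n to n + m sum
    to a multiple of 1/n - 1/(n+m). *)
Lemma inv_sq_telescope n : (0 < n)%nat -> / INR n * / INR n <= 2 * (/ INR n - / INR (S n)).
Proof.
  intros n0. have p0 : 1 <= INR n by apply (le_INR 1).
  rewrite S_INR.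
  have -> : 2 * (/ INR n - / (INR n + 1)) = (2 * INR n / (INR n + 1)) * (/ INR n * / INR n) by field; lra.
  have h : 0 < / INR n by apply Rinv_0_lt_compat; lra.
  have : 1 <= 2 * INR n / (INR n + 1) by apply Rle_div_r; lra.
  nra.
Qed.

(** The first order terms nearly cancel: 1/(n+1) and ln ((n+1)/n) both lie between 1/(n+1) and 1/n,
    so they differ by at most 1/n^2. *)
Lemma gauss_ratio_estimate M : 0 <= M -> exists K, 0 <= K /\ forall s n, Cmod s <= M -> (0 < n)%nat ->
  Cmod (gauss_ratio n s - 1) <= K * (/ INR n - / INR (S n)).
Proof.
  intros M0. have eM := exp_pos M.
  (* One summand for each term of the expansion below: s (k - lam), s^2 k lam, and the remainder of
     the exponential times 1 + s k. The final factor 2 is that of [inv_sq_telescope]. *)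
  pose K := M + M * M + (1 + M) * (M * M * exp M).
  have K0 : 0 <= K.
    rewrite /K. have : 0 <= M * M * exp M by apply Rmult_le_pos; nra. nra.
  exists (2 * K); split; [lra|] => s n Hs n0.
  have p0 : 1 <= INR n by apply (le_INR 1).
  have [l1 l2] := ln_ratio_bounds n n0.
  have tl := inv_sq_telescope n n0.
  set lam := ln (INR (S n)) - ln (INR n) in l1 l2 *.
  rewrite /gauss_ratio -/lam.
  set k := / INR (S n) in l1 tl *.
  set i := / INR n in l2 tl *.
  have k0 : 0 < k by apply Rinv_0_lt_compat; apply lt_0_INR; lia.
  have i1 : i <= 1 by rewrite /i -Rinv_1; apply Rinv_le_contravar; lra.
  have ik : i - k <= i * i.
    have -> : i - k = i * k by rewrite /i /k S_INR; field; lra.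
    apply Rmult_le_compat_l; lra.
  set E := (cexp (- s * lam) - 1 - (- s * lam))%C.
  have s0 := Cmod_ge_0 s.
  have HE : Cmod E <= M * M * exp M * (i * i).
    apply Rle_trans with (1 := cexp_estimate2 _).
    rewrite Cmod_mult Cmod_opp Cmod_R Rabs_pos_eq; [|lra].
    have sl : Cmod s * lam <= M * i by apply Rmult_le_compat; lra.
    have sl0 : 0 <= Cmod s * lam by apply Rmult_le_pos; lra.
    have ee : exp (Cmod s * lam) <= exp M by apply exp_le; nra.
    have -> : M * M * exp M * (i * i) = (M * i) * (M * i) * exp M by ring.
    apply Rmult_le_compat; [nra|left; apply exp_pos| |done].
    apply Rmult_le_compat; lra.
  have -> : ((1 + s * k) * cexp (- s * lam) - 1 =
     s * RtoC (k - lam)%R - s * s * RtoC (k * lam)%R + (1 + s * k) * E)%C.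
    rewrite /E RtoC_minus RtoC_mult; ring.
  have t1 := Cmod_triangle (s * RtoC (k - lam)%R - s * s * RtoC (k * lam)%R) ((1 + s * k) * E).
  have t2 := Cmod_triangle_minus (s * RtoC (k - lam)%R) (s * s * RtoC (k * lam)%R).
  rewrite !Cmod_mult !Cmod_R in t1 t2.
  have a1 : Cmod s * Rabs (k - lam) <= M * (i * i).
    apply Rmult_le_compat => //; [apply Rabs_pos|]. split_Rabs; lra.
  have a2 : Cmod s * Cmod s * Rabs (k * lam) <= M * M * (i * i).
    rewrite Rabs_pos_eq; [|nra]. apply Rmult_le_compat; [nra|nra| |]; apply Rmult_le_compat; lra.
  have a3 : Cmod (1 + s * k) * Cmod E <= (1 + M) * (M * M * exp M * (i * i)).
    apply Rmult_le_compat => //; [apply Cmod_ge_0..|].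
    have := Cmod_triangle 1 (s * k). rewrite Cmod_mult Cmod_1 Cmod_R Rabs_pos_eq; [nra|lra].
  apply Rle_trans with (K * (i * i)).
  - rewrite /K; lra.
  - rewrite (Rmult_comm 2) Rmult_assoc; apply Rmult_le_compat_l; lra.
Qed.

(** Each ratio is at most exp (K (1/n - 1/(n+1))), so the exponents telescope, starting from
    [gauss 1 s], which is s (s + 1). *)
Lemma gauss_bounded M : 0 <= M -> exists B, 0 <= B /\ forall s n, Cmod s <= M -> (0 < n)%nat -> Cmod (gauss n s) <= B.
Proof.
  intros M0. destruct (gauss_ratio_estimate M M0) as [K [K0 HK]].
  exists (M * (M + 1) * exp K); split.
    have := exp_pos K; intros; apply Rmult_le_pos; nra.
  intros s n Hs n0.
  have H : forall n, Cmod (gauss (S n) s) <= M * (M + 1) * exp (K * (1 - / INR (S n))).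
    clear n n0; elim => [|n IH].
    - rewrite gauss_1 Cmod_mult /= Rinv_1 Rminus_eq_0 Rmult_0_r exp_0 Rmult_1_r.
      have := Cmod_triangle s 1. rewrite Cmod_1 => h. apply Rmult_le_compat; (apply Cmod_ge_0 || lra).
    - rewrite gauss_S; [|lia]. rewrite Cmod_mult.
      have h := HK s (S n) Hs ltac:(lia).
      have h2 : Cmod (gauss_ratio (S n) s) <= exp (K * (/ INR (S n) - / INR (S (S n)))).
        apply Rle_trans with (2 := exp_ineq1_le _).
        have := Cmod_triangle (gauss_ratio (S n) s - 1) 1. rewrite Cmod_1.
        have -> : (gauss_ratio (S n) s - 1 + 1 = gauss_ratio (S n) s)%C by ring. lra.
      apply Rle_trans with (M * (M + 1) * exp (K * (1 - / INR (S n))) * exp (K * (/ INR (S n) - / INR (S (S n))))).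
        apply Rmult_le_compat => //; apply Cmod_ge_0.
      right; rewrite Rmult_assoc -exp_plus; f_equal; f_equal; ring.
  destruct n as [|n]; [lia|]. apply Rle_trans with (1 := H n).
  apply Rmult_le_compat_l; [nra|]. apply exp_le.
  have : 0 < / INR (S n) by apply Rinv_0_lt_compat, lt_0_INR; lia. nra.
Qed.

Lemma gauss_cauchy M : 0 <= M -> exists K, 0 <= K /\ forall s n m, Cmod s <= M -> (0 < n)%nat ->
  Cmod (gauss (n + m) s - gauss n s) <= K * (/ INR n - / INR (n + m)).
Proof.
  intros M0. destruct (gauss_ratio_estimate M M0) as [K [K0 HK]].
  destruct (gauss_bounded M M0) as [B [B0 HB]].
  exists (B * K); split; [nra|] => s n m Hs n0.
  elim: m => [|m IH].
  - rewrite Nat.add_0_r. have -> : (gauss n s - gauss n s = 0)%C by ring. rewrite Cmod_0; lra.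
  - rewrite Nat.add_succ_r gauss_S; [|lia].
    have -> : (gauss (n + m) s * gauss_ratio (n + m) s - gauss n s =
      gauss (n + m) s * (gauss_ratio (n + m) s - 1) + (gauss (n + m) s - gauss n s))%C by ring.
    apply Rle_trans with (1 := Cmod_triangle _ _).
    rewrite Cmod_mult.
    have h1 := HK s (n + m)%nat Hs ltac:(lia). have h2 := HB s (n + m)%nat Hs ltac:(lia).
    have : Cmod (gauss (n + m) s) * Cmod (gauss_ratio (n + m) s - 1) <= B * (K * (/ INR (n + m) - / INR (S (n + m)))).
      apply Rmult_le_compat => //; apply Cmod_ge_0.
    lra.
Qed.

Definition Clim (u : nat -> C) (l : C) := filterlim u eventually (locally l).

Lemma Clim_unique u l m : Clim u l -> Clim u m -> l = m.
Proof. apply (filterlim_locally_unique (V := C_R_NormedModule)). Qed.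

Lemma Clim_eps u l : Clim u l <-> forall eps, 0 < eps -> exists N, forall n, (N <= n)%nat -> Cmod (u n - l) < eps.
Proof. apply (filterlim_to_C eventually). Qed.

Lemma Clim_cauchy (u : nat -> C) : (forall eps, 0 < eps -> exists N, forall n m, (N <= n)%nat -> (N <= m)%nat -> Cmod (u n - u m) < eps) ->
  exists l, Clim u l.
Proof.
  intros H.
  have [lr Hr] : { l | Un_cv (fun n => Re (u n)) l }.
    apply Rcomplete.R_complete => e e0; destruct (H e e0) as [N HN]; exists N => n m Hn Hm.
    apply Rle_lt_trans with (2 := HN n m Hn Hm). apply (re_le_Cmod (u n - u m)).
  have [li Hi] : { l | Un_cv (fun n => Im (u n)) l }.
    apply Rcomplete.R_complete => e e0; destruct (H e e0) as [N HN]; exists N => n m Hn Hm.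
    apply Rle_lt_trans with (2 := HN n m Hn Hm). apply (im_le_Cmod (u n - u m)).
  exists (lr, li); apply Clim_eps => e e0.
  have e2 : e / 2 > 0 by lra.
  destruct (Hr _ e2) as [N1 H1]; destruct (Hi _ e2) as [N2 H2].
  exists (N1 + N2)%nat => n Hn.
  apply Rle_lt_trans with (1 := Cmod_le_ReIm _).
  have h1 := H1 n ltac:(lia); have h2 := H2 n ltac:(lia).
  rewrite /Rdist /Rminus in h1 h2. rewrite /Re /Im /= in h1 h2 *. lra.
Qed.

Lemma inv_INR_lim eps : 0 < eps -> exists N, (0 < N)%nat /\ forall n, (N <= n)%nat -> / INR n < eps.
Proof.
  intros e0; destruct (INR_unbounded (/ eps)) as [N HN].
  have p := Rinv_0_lt_compat _ e0.
  exists N; split; [apply INR_lt; simpl; lra|] => n Hn.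
  rewrite -(Rinv_inv eps). apply Rinv_lt_contravar.
    apply Rmult_lt_0_compat => //. apply lt_0_INR. apply Nat.lt_le_trans with N => //. apply INR_lt; simpl; lra.
  apply Rlt_le_trans with (1 := HN). by apply le_INR.
Qed.

Lemma Clim_rate u l K : (forall n, (0 < n)%nat -> Cmod (u n - l) <= K * / INR n) -> Clim u l.
Proof.
  intros H; apply Clim_eps => e e0.
  have K1 : 0 < Rabs K + 1 by have := Rabs_pos K; lra.
  destruct (inv_INR_lim (e / (Rabs K + 1))) as [N [N0 HN]]; [by apply Rdiv_lt_0_compat|].
  exists N => n Hn. have := HN n Hn. have := H n ltac:(lia).
  have i0 : 0 < / INR n by apply Rinv_0_lt_compat, lt_0_INR; lia.
  move=> h1 /(Rlt_div_r _ _ _ K1) h2. have := Rle_abs K. nra.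
Qed.

Lemma rgamma_lim s : Clim (fun n => gauss n s) (rgamma s).
Proof.
  apply (epsilon_spec inhC (fun l => Clim (fun n => gauss n s) l)).
  destruct (gauss_cauchy (Cmod s) (Cmod_ge_0 s)) as [K [K0 HK]].
  apply Clim_cauchy => e e0.
  destruct (inv_INR_lim (e / (K + 1))) as [N [N0 HN]]; [apply Rdiv_lt_0_compat; lra|].
  have H : forall n m, (N <= n)%nat -> Cmod (gauss (n + m) s - gauss n s) < e.
    intros n m Hn. apply Rle_lt_trans with (1 := HK s n m (Rle_refl _) ltac:(lia)).
    have h := HN n Hn. apply Rlt_div_r in h; [|lra].
    have i0 : 0 < / INR n by apply Rinv_0_lt_compat, lt_0_INR; lia.
    have i1 : 0 < / INR (n + m) by apply Rinv_0_lt_compat, lt_0_INR; lia.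
    nra.
  exists N => n m Hn Hm. destruct (Nat.le_ge_cases n m) as [h|h].
  - rewrite Cmod_minus_sym. have := H n (m - n)%nat Hn. by have -> : (n + (m - n) = m)%nat by lia.
  - have := H m (n - m)%nat Hm. by have -> : (m + (n - m) = n)%nat by lia.
Qed.

Lemma Clim_Cmod_le u l x B : Clim u l -> (exists N, forall n, (N <= n)%nat -> Cmod (u n - x) <= B) -> Cmod (l - x) <= B.
Proof.
  intros Hu [N HN]; apply le_epsilon => e e0.
  destruct (proj1 (Clim_eps _ _) Hu e e0) as [N' HN'].
  have h1 := HN' (N + N')%nat ltac:(lia). have h2 := HN (N + N')%nat ltac:(lia).
  have := Cmod_triangle_minus (u (N + N')%nat - x) (u (N + N')%nat - l).
  have -> : (u (N + N')%nat - x - (u (N + N')%nat - l) = l - x)%C by ring. lra.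
Qed.

Lemma gauss_rate M : 0 <= M -> exists K, 0 <= K /\ forall s n, Cmod s <= M -> (0 < n)%nat ->
  Cmod (gauss n s - rgamma s) <= K * / INR n.
Proof.
  intros M0; destruct (gauss_cauchy M M0) as [K [K0 HK]]; exists K; split => // s n Hs n0.
  rewrite Cmod_minus_sym. apply (Clim_Cmod_le _ _ _ _ (rgamma_lim s)).
  exists n => m Hm. have := HK s n (m - n)%nat Hs n0. have -> : (n + (m - n) = m)%nat by lia.
  have i1 : 0 < / INR m by apply Rinv_0_lt_compat, lt_0_INR; lia. nra.
Qed.

Lemma entire_poch n : entire (fun s => poch s n).
Proof.
  elim: n => [|n IH] c /=; [eexists; apply cdiff_const|].
  destruct (IH c) as [l Hl]; eexists. apply cdiff_mult; [exact Hl|].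
  apply cdiff_plus; [apply cdiff_id|apply cdiff_const].
Qed.

Lemma entire_gauss n : entire (gauss (S n)).
Proof.
  intros c. destruct (entire_poch (S (S n)) c) as [l Hl].
  have p1 : 0 < INR (S n) by apply lt_0_INR; lia.
  eexists. apply (cdiff_ext (fun s => poch s (S (S n)) * (/ RtoC (INR (fact (S n))) * cexp (s * RtoC (- ln (INR (S n)))%R)))%C).
    intros s. rewrite /gauss cpow_cexp //.
    have -> : (s * RtoC (- ln (INR (S n)))%R = - (s * ln (INR (S n))))%C by rewrite RtoC_opp; ring.
    rewrite cexp_opp. field; split; [apply cexp_neq0|apply fact_C_neq0].
  apply cdiff_mult; [exact Hl|]. apply cdiff_mult; [apply cdiff_const|].
  apply (cdiff_comp cexp); [apply cdiff_cexp|]. apply cdiff_mult; [apply cdiff_id|apply cdiff_const].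
Qed.

Lemma entire_rgamma : entire rgamma.
Proof.
  (* The sequence starts at index 1 because [gauss 0] divides by [cpow 0 s], which is 0. *)
  apply (entire_uniform_limit (fun n => gauss (S n))); [apply entire_gauss|].
  intros r e e0.
  destruct (Rle_dec 0 r) as [r0|r0]; last first.
    exists O => n _ z Hz; have := Cmod_ge_0 z; lra.
  destruct (gauss_rate r r0) as [K [K0 HK]].
  destruct (inv_INR_lim (e / (K + 1))) as [N [N0 HN]]; [apply Rdiv_lt_0_compat; lra|].
  exists N => n Hn z Hz. apply Rle_trans with (1 := HK z (S n) Hz ltac:(lia)).
  have h := HN (S n) ltac:(lia). apply Rlt_div_r in h; [|lra].
  have i0 : 0 < / INR (S n) by apply Rinv_0_lt_compat, lt_0_INR; lia. nra.
Qed.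

Lemma poch_shift s n : poch s (S n) = (s * poch (s + 1) n)%C.
Proof.
  elim: n => [|n IH]; [simpl; rewrite Cplus_0_r; ring|].
  rewrite -[LHS]/(poch s (S n) * (s + RtoC (INR (S n))))%C IH S_INR RtoC_plus /=; ring.
Qed.

Lemma gauss_shift n s : (0 < n)%nat ->
  (s * gauss n (s + 1) = gauss n s * (1 + (s + 1) * RtoC (/ INR n)))%C.
Proof.
  intros n0; have p0 : 0 < INR n by apply lt_0_INR.
  rewrite /gauss cpow_plus1.
  have -> : (s * (poch (s + 1) (S n) / (RtoC (INR (fact n)) * (INR n * cpow (INR n) s))) =
    (s * poch (s + 1) (S n)) / (RtoC (INR (fact n)) * (INR n * cpow (INR n) s)))%C by rewrite /Cdiv; ring.
  rewrite -poch_shift -[poch s (S (S n))]/(poch s (S n) * (s + RtoC (INR (S n))))%C.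
  rewrite RtoC_inv ?S_INR ?RtoC_plus; [|lra].
  field; repeat split; try apply fact_C_neq0; try (by apply INR_C_neq0); by apply cpow_neq0.
Qed.

(** The limit of [gauss_shift], whose correction factor 1 + (s+1)/n tends to 1. *)
Lemma rgamma_shift s : rgamma s = (s * rgamma (s + 1))%C.
Proof.
  destruct (gauss_rate (Cmod s + 1)) as [K [K0 HK]]; [have := Cmod_ge_0 s; lra|].
  destruct (gauss_bounded (Cmod s + 1)) as [B [B0 HB]]; [have := Cmod_ge_0 s; lra|].
  have s0 := Cmod_ge_0 s.
  have s1 : Cmod (s + 1) <= Cmod s + 1 by have := Cmod_triangle s 1; rewrite Cmod_1.
  apply (C_eq_of_Cmod_small _ _ (K + Cmod s * K + B * (Cmod s + 1))) => e e0.
  destruct (inv_INR_lim e e0) as [N [N0 HN]]. have hi := HN N (Nat.le_refl N).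
  have i0 : 0 < / INR N by apply Rinv_0_lt_compat, lt_0_INR; lia.
  have h1 := HK s N ltac:(lra) N0. have h2 := HK (s + 1)%C N s1 N0. have h3 := HB s N ltac:(lra) N0.
  have -> : (rgamma s - s * rgamma (s + 1) = s * (gauss N (s + 1) - rgamma (s + 1)) - (gauss N s - rgamma s)
     - gauss N s * ((s + 1) * RtoC (/ INR N)))%C.
    have := gauss_shift N s N0 => E.
    have -> : (s * (gauss N (s + 1) - rgamma (s + 1)) = s * gauss N (s + 1) - s * rgamma (s + 1))%C by ring.
    rewrite E; ring.
  have t1 := Cmod_triangle_minus (s * (gauss N (s + 1) - rgamma (s + 1)) - (gauss N s - rgamma s)) (gauss N s * ((s + 1) * RtoC (/ INR N))).
  have t2 := Cmod_triangle_minus (s * (gauss N (s + 1) - rgamma (s + 1))) (gauss N s - rgamma s).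
  rewrite (Cmod_mult (gauss N s)) (Cmod_mult (s + 1)) Cmod_R (Rabs_pos_eq (/ INR N)) in t1; [|lra].
  rewrite (Cmod_mult s) in t2.
  have k1 : Cmod s * Cmod (gauss N (s + 1) - rgamma (s + 1)) <= Cmod s * (K * / INR N) by apply Rmult_le_compat_l.
  have k2 : Cmod (gauss N s) * (Cmod (s + 1) * / INR N) <= B * ((Cmod s + 1) * / INR N).
    apply Rmult_le_compat => //; [apply Cmod_ge_0| |apply Rmult_le_compat_r; lra].
    apply Rmult_le_pos; [apply Cmod_ge_0|lra].
  have : (K + Cmod s * K + B * (Cmod s + 1)) * / INR N <= (K + Cmod s * K + B * (Cmod s + 1)) * e.
    apply Rmult_le_compat_l; [|lra]. nra.
  lra.
Qed.

Lemma rgamma_poch s n : rgamma s = (poch s n * rgamma (s + RtoC (INR n)))%C.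
Proof.
  elim: n => [|n IH]; [rewrite /= Cplus_0_r; ring|].
  rewrite IH rgamma_shift S_INR RtoC_plus /=.
  have -> : (s + INR n + 1 = s + (INR n + 1))%C by ring. ring.
Qed.

Lemma poch_1 n : poch 1 n = RtoC (INR (fact n)).
Proof.
  elim: n => [//|n IH]. rewrite /= IH plus_INR mult_INR RtoC_plus RtoC_mult; ring.
Qed.

Lemma rgamma_1 : rgamma 1 = 1%C.
Proof.
  apply (Clim_unique (fun n => gauss n 1)); [apply rgamma_lim|].
  apply (Clim_rate _ _ 1) => n n0.
  have p0 : 0 < INR n by apply lt_0_INR.
  rewrite /gauss cpow_1 // poch_1.
  have -> : fact (S n) = (S n * fact n)%nat by [].
  rewrite mult_INR RtoC_mult S_INR RtoC_plus.
  have -> : ((INR n + 1) * INR (fact n) / (INR (fact n) * INR n) - 1 = / INR n)%C.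
    field; split; [by apply INR_C_neq0|apply fact_C_neq0].
  rewrite -RtoC_inv; [|lra]. rewrite Cmod_R Rabs_pos_eq; [lra|]. left; by apply Rinv_0_lt_compat.
Qed.

Lemma rgamma_nat n : rgamma (RtoC (INR (S n))) = (/ RtoC (INR (fact n)))%C.
Proof.
  have := rgamma_poch 1 n. rewrite rgamma_1 poch_1.
  have -> : (1 + INR n = RtoC (INR (S n)))%C by rewrite S_INR RtoC_plus; ring.
  intros E. have f0 := fact_C_neq0 n.
  have -> : rgamma (RtoC (INR (S n))) = (/ INR (fact n) * (INR (fact n) * rgamma (RtoC (INR (S n)))))%C by field.
  rewrite -E; ring.
Qed.

(** From an index [N] with K/N <= 1/2 on, the products lose at most half of their modulus, since (1
    - x)(1 - y) >= 1 - x - y for x, y >= 0. The limit is thus bounded below by half of a nonzero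
    product. *)
Lemma rgamma_neq0 s : (forall n, poch s n <> 0%C) -> rgamma s <> 0%C.
Proof.
  intros Hs.
  destruct (gauss_ratio_estimate (Cmod s) (Cmod_ge_0 s)) as [K [K0 HK]].
  destruct (inv_INR_lim (/ (2 * K + 1))) as [N [N0 HN]]; [apply Rinv_0_lt_compat; lra|].
  have hN := HN N (Nat.le_refl N).
  have i0 : 0 < / INR N by apply Rinv_0_lt_compat, lt_0_INR; lia.
  have KN : K * / INR N <= / 2.
    have : (2 * K + 1) * / INR N < 1; [|lra].
    apply (Rmult_lt_reg_l (/ (2 * K + 1))); [apply Rinv_0_lt_compat; lra|].
    rewrite -Rmult_assoc Rinv_l; lra.
  have g0 : 0 < Cmod (gauss N s).
    apply Cmod_gt_0. rewrite /gauss. apply Cmult_neq_0; [apply Hs|].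
    intros E. have : (RtoC (INR (fact N)) * cpow (INR N) s <> 0)%C.
      apply Cmult_neq_0; [apply fact_C_neq0|apply cpow_neq0, lt_0_INR; lia].
    intros n; apply C1_nz. rewrite -(Cinv_r _ n) E; ring.
  have H : forall m, Cmod (gauss N s) * (1 - K * (/ INR N - / INR (N + m))) <= Cmod (gauss (N + m) s).
    elim => [|m IH]; [rewrite Nat.add_0_r; lra|].
    rewrite Nat.add_succ_r gauss_S; [|lia]. rewrite Cmod_mult.
    have h1 := HK s (N + m)%nat (Rle_refl _) ltac:(lia).
    have i1 : 0 < / INR (N + m) by apply Rinv_0_lt_compat, lt_0_INR; lia.
    have i2 : 0 < / INR (S (N + m)) by apply Rinv_0_lt_compat, lt_0_INR; lia.
    have i3 : / INR (S (N + m)) <= / INR (N + m).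
      apply Rinv_le_contravar; [apply lt_0_INR; lia|apply le_INR; lia].
    have i4 : / INR (N + m) <= / INR N.
      apply Rinv_le_contravar; [apply lt_0_INR; lia|apply le_INR; lia].
    have h2 : 1 - K * (/ INR (N + m) - / INR (S (N + m))) <= Cmod (gauss_ratio (N + m) s).
      have := Cmod_triangle_rev 1 (1 - gauss_ratio (N + m) s). rewrite Cmod_1 (Cmod_minus_sym 1 (gauss_ratio _ _)).
      have -> : (1 - (1 - gauss_ratio (N + m) s) = gauss_ratio (N + m) s)%C by ring. lra.
    set x := K * (/ INR N - / INR (N + m)) in IH *. set y := K * (/ INR (N + m) - / INR (S (N + m))) in h2 *.
    have x0 : 0 <= x by apply Rmult_le_pos; lra.
    have y0 : 0 <= y by apply Rmult_le_pos; lra.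
    have xy : x + y <= / 2.
      rewrite /x /y. have -> : K * (/ INR N - / INR (N + m)) + K * (/ INR (N + m) - / INR (S (N + m))) = K * / INR N - K * / INR (S (N + m)) by ring.
      have : 0 <= K * / INR (S (N + m)) by apply Rmult_le_pos; lra. lra.
    have -> : K * (/ INR N - / INR (S (N + m))) = x + y by rewrite /x /y; ring.
    apply Rle_trans with (Cmod (gauss N s) * (1 - x) * (1 - y)).
      rewrite Rmult_assoc; apply Rmult_le_compat_l; [lra|nra].
    apply Rmult_le_compat => //; [apply Rmult_le_pos; lra|lra].
  intros E.
  have L := rgamma_lim s. rewrite E in L.
  have e0 : 0 < Cmod (gauss N s) / 2 by lra.
  destruct (proj1 (Clim_eps _ _) L _ e0) as [N' HN'].
  have h1 := HN' (N + N')%nat ltac:(lia). have h2 := H N'.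
  have i1 : 0 < / INR (N + N') by apply Rinv_0_lt_compat, lt_0_INR; lia.
  have EE : (gauss (N + N') s - 0 = gauss (N + N') s)%C by ring. rewrite EE in h1.
  have : K * (/ INR N - / INR (N + N')) <= / 2 by nra.
  nra.
Qed.

Lemma poch_neq0 s : 0 < Re s -> forall n, poch s n <> 0%C.
Proof.
  intros h; elim => [|n IH]; [apply C1_nz|].
  apply Cmult_neq_0 => // E. have := f_equal Re E; rewrite /Re /= -/(Re s).
  have := pos_INR n; lra.
Qed.

Lemma rgamma_neq0_Re s : 0 < Re s -> rgamma s <> 0%C.
Proof. intros h; apply rgamma_neq0; by apply poch_neq0. Qed.

(** * The Beta integral *)

Lemma is_RInt_C_unique (f : R -> C) a b l m :
  is_RInt (V := C_R_NormedModule) f a b l -> is_RInt (V := C_R_NormedModule) f a b m -> l = m.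
Proof.
  intros H1 H2.
  have r1 := is_RInt_fct_extend_fst (U := R_NormedModule) (V := R_NormedModule) f a b l H1.
  have r2 := is_RInt_fct_extend_fst (U := R_NormedModule) (V := R_NormedModule) f a b m H2.
  have i1 := is_RInt_fct_extend_snd (U := R_NormedModule) (V := R_NormedModule) f a b l H1.
  have i2 := is_RInt_fct_extend_snd (U := R_NormedModule) (V := R_NormedModule) f a b m H2.
  apply injective_projections.
  - by rewrite -(is_RInt_unique _ _ _ _ r1) -(is_RInt_unique _ _ _ _ r2).
  - by rewrite -(is_RInt_unique _ _ _ _ i1) -(is_RInt_unique _ _ _ _ i2).
Qed.

Local Notation is_RInt01 f l := (is_RInt_gen (V := C_R_NormedModule) f (at_right 0) (at_left 1) l).

Lemma is_RInt01_unique (f : R -> C) l m : is_RInt01 f l -> is_RInt01 f m -> l = m.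
Proof.
  apply (filterlimi_locally_unique (V := C_R_NormedModule)).
  apply filter_forall => x y1 y2; apply is_RInt_C_unique.
Qed.

Lemma is_RInt01_ext (f g : R -> C) l : (forall u, 0 < u < 1 -> f u = g u) ->
  is_RInt01 f l -> is_RInt01 g l.
Proof.
  intros H; apply (is_RInt_gen_ext (V := C_R_NormedModule)).
  apply (Filter_prod _ _ _ (fun a => 0 < a < 1) (fun b => 0 < b < 1)).
  - apply locally_R; exists 1; split; [lra|] => y Hy y0; split_Rabs; lra.
  - apply locally_R; exists 1; split; [lra|] => y Hy y0; split_Rabs; lra.
  - move=> x y Hx Hy u /=; rewrite /Rmin /Rmax; case: (Rle_dec x y) => ? Hu; apply H; lra.
Qed.

Lemma is_RInt_C_scal k (f : R -> C) a b l :
  is_RInt (V := C_R_NormedModule) f a b l -> is_RInt (V := C_R_NormedModule) (fun u => k * f u)%C a b (k * l)%C.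
Proof.
  intros H.
  have r := is_RInt_fct_extend_fst (U := R_NormedModule) (V := R_NormedModule) f a b l H.
  have i := is_RInt_fct_extend_snd (U := R_NormedModule) (V := R_NormedModule) f a b l H.
  apply (is_RInt_fct_extend_pair (U := R_NormedModule) (V := R_NormedModule)).
  - exact (is_RInt_minus _ _ _ _ _ _ (is_RInt_scal _ _ _ (fst k) _ r) (is_RInt_scal _ _ _ (snd k) _ i)).
  - exact (is_RInt_plus _ _ _ _ _ _ (is_RInt_scal _ _ _ (fst k) _ i) (is_RInt_scal _ _ _ (snd k) _ r)).
Qed.

Lemma is_RInt01_scal k (f : R -> C) l : is_RInt01 f l -> is_RInt01 (fun u => k * f u)%C (k * l)%C.
Proof.
  intros H P HP.
  have Hc : continuous (fun y : C => k * y)%C l by contC.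
  have HF : Filter (filter_prod (at_right 0) (at_left 1)) by apply _.
  have K := H (fun y => P (k * y)%C) (Hc P HP). rewrite /filtermapi in K *.
  eapply filter_imp; [|exact K] => ab [y [Hy HPy]].
  exists (k * y)%C; split => //. by apply is_RInt_C_scal.
Qed.

(** Derivatives are required only inside the interval; the end points are handled by continuity of
    [Q]. Improper integrals are evaluated in this way. *)
Lemma is_RInt01_antiderivative (Q f : R -> C) : contR Q ->
  (forall u, 0 < u < 1 -> rdiff Q u (f u)) -> (forall u, 0 < u < 1 -> continuous f u) ->
  is_RInt01 f (Q 1 - Q 0)%C.
Proof.
  intros CQ HQ Hf.
  apply (filterlimi_lim_ext_loc (fun ab : R * R => Q (snd ab) - Q (fst ab))%C).
  - apply (Filter_prod _ _ _ (fun a => 0 < a < 1) (fun b => 0 < b < 1)).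
    + apply locally_R; exists 1; split; [lra|] => y Hy y0; split_Rabs; lra.
    + apply locally_R; exists 1; split; [lra|] => y Hy y0; split_Rabs; lra.
    + intros x y Hx Hy; apply is_RInt_C_FTC => t /=; rewrite /Rmin /Rmax; case: (Rle_dec x y) => ? Ht;
      [apply HQ|apply HQ|apply Hf|apply Hf]; lra.
  - apply (filterlim_to_C (filter_prod (at_right 0) (at_left 1))) => e e0.
    have e2 : 0 < e / 2 by lra.
    destruct (proj1 (continuous_RC _ _) (CQ 0) _ e2) as [d0 [d00 Hd0]].
    destruct (proj1 (continuous_RC _ _) (CQ 1) _ e2) as [d1 [d10 Hd1]].
    apply (Filter_prod _ _ _ (fun a => Rabs (a - 0) < d0) (fun b => Rabs (b - 1) < d1)).
    + apply locally_R; exists d0; split => //.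
    + apply locally_R; exists d1; split => //.
    + intros x y Hx Hy. have h0 := Hd0 _ Hx. have h1 := Hd1 _ Hy.
      have -> : (Q (snd (x, y)) - Q (fst (x, y)) - (Q 1 - Q 0) = (Q y - Q 1) - (Q x - Q 0))%C by simpl; ring.
      have := Cmod_triangle_minus (Q y - Q 1) (Q x - Q 0). lra.
Qed.

Lemma is_RInt01_CInt (f : R -> C) : contR f -> is_RInt01 f (CInt f 0 1).
Proof.
  intros Hf.
  have := is_RInt01_antiderivative (fun y => CInt f 0 y) f.
  rewrite CInt_point. have -> : (CInt f 0 1 - 0 = CInt f 0 1)%C by ring. apply => //.
  - intros y. apply (rdiff_continuous _ _ _ (CInt_antiderivative f 0 y Hf)).
  - intros u _; by apply CInt_antiderivative.
Qed.

(** Powers need not be differentiable at the end points, so the proper integral is read as an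
    improper one. *)
Lemma CInt_FTC_open (Q f : R -> C) : contR Q -> contR f ->
  (forall u, 0 < u < 1 -> rdiff Q u (f u)) -> CInt f 0 1 = (Q 1 - Q 0)%C.
Proof.
  intros CQ Cf HQ. apply (is_RInt01_unique f); [by apply is_RInt01_CInt|].
  apply is_RInt01_antiderivative => // u _; apply Cf.
Qed.

(** * The Beta weight and its integral *)

Definition beta_weight (a b : C) (u : R) : C := (cpow u a * cpow (1 - u) b)%C.

Lemma continuous_1minus x : continuous (fun u : R => 1 - u) x.
Proof. apply (continuous_minus (V := R_NormedModule)); [apply continuous_const|apply continuous_id]. Qed.

Lemma contR_cpow_1minus b : 0 < Re b -> contR (fun u => cpow (1 - u) b).
Proof.
  intros Hb u; apply (continuous_comp (fun u : R => 1 - u) (fun v => cpow v b)).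
  - apply continuous_1minus.
  - by apply contR_cpow.
Qed.

Lemma contR_beta_weight a b : 0 < Re a -> 0 < Re b -> contR (beta_weight a b).
Proof. intros Ha Hb; apply contR_mult; [by apply contR_cpow|by apply contR_cpow_1minus]. Qed.

Lemma rdiff_cpow_1minus b u : u < 1 ->
  rdiff (fun u => cpow (1 - u) b) u (- (b * cpow (1 - u) (b - 1)))%C.
Proof.
  intros Hu.
  have D : is_derive (fun u : R => 1 - u) u (-1) by auto_derive => //; ring.
  have h : 0 < 1 - u by lra.
  apply (rdiff_eq _ _ _ _ (rdiff_comp_r (fun v => cpow v b) (fun u => 1 - u) u _ _ (rdiff_cpow (1 - u) b h) D)).
  ring.
Qed.

Lemma rdiff_beta_weight a b u : 0 < u < 1 ->
  rdiff (beta_weight a b) u (a * beta_weight (a - 1) b u - b * beta_weight a (b - 1) u)%C.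
Proof.
  intros Hu.
  apply (rdiff_eq _ _ _ _ (rdiff_mult _ _ u _ _ (rdiff_cpow u a ltac:(lra)) (rdiff_cpow_1minus b u ltac:(lra)))).
  rewrite /beta_weight; ring.
Qed.

Lemma beta_weight_l a b u : beta_weight (a + 1) b u = (RtoC u * beta_weight a b u)%C.
Proof. rewrite /beta_weight cpow_plus1; ring. Qed.

Lemma beta_weight_r a b u : beta_weight a (b + 1) u = (RtoC (1 - u)%R * beta_weight a b u)%C.
Proof. rewrite /beta_weight cpow_plus1; ring. Qed.

Lemma beta_weight_0 a b : beta_weight a b 0 = 0%C.
Proof. rewrite /beta_weight cpow_nonpos; [ring|lra]. Qed.

Lemma beta_weight_1 a b : beta_weight a b 1 = 0%C.
Proof. rewrite /beta_weight (cpow_nonpos (1 - 1)); [ring|lra]. Qed.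

(** The arguments are the exponents, so this is Euler's B(a + 1, b + 1). *)
Definition Beta (a b : C) : C := CInt (beta_weight a b) 0 1.

Lemma Re_plus1 a : Re (a + 1) = Re a + 1.
Proof. by []. Qed.

(** Two relations are combined: u + (1 - u) = 1 splits the integral, and u^(a+1) (1-u)^(b+1)
    vanishes at both ends, so the integral of its derivative is zero. *)
Lemma Beta_raise a b : 0 < Re a -> 0 < Re b ->
  ((b + 1) * Beta a b = (a + b + 2) * Beta a (b + 1))%C.
Proof.
  intros Ha Hb.
  have Ha1 : 0 < Re (a + 1) by rewrite Re_plus1; lra.
  have Hb1 : 0 < Re (b + 1) by rewrite Re_plus1; lra.
  have c1 := contR_beta_weight a b Ha Hb.
  have c2 := contR_beta_weight (a + 1) b Ha1 Hb.
  have c3 := contR_beta_weight a (b + 1) Ha Hb1.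
  have c4 := contR_beta_weight (a + 1) (b + 1) Ha1 Hb1.
  have E1 : Beta a b = (Beta (a + 1) b + Beta a (b + 1))%C.
    rewrite /Beta -CInt_plus //. apply CInt_ext => u _.
    rewrite beta_weight_l beta_weight_r RtoC_minus; ring.
  have E2 : ((a + 1) * Beta a (b + 1) - (b + 1) * Beta (a + 1) b = 0)%C.
    rewrite /Beta -!CInt_scal // -CInt_minus; [|by apply contR_mult => //; apply contR_const..].
    rewrite (CInt_FTC_open (beta_weight (a + 1) (b + 1))) //.
    - rewrite beta_weight_0 beta_weight_1; ring.
    - by apply contR_minus; apply contR_mult => //; apply contR_const.
    - intros u Hu. apply (rdiff_eq _ _ _ _ (rdiff_beta_weight (a + 1) (b + 1) u Hu)).
      have -> : (a + 1 - 1 = a)%C by ring. by have -> : (b + 1 - 1 = b)%C by ring.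
  have E3 : ((b + 1) * Beta (a + 1) b = (a + 1) * Beta a (b + 1))%C.
    apply Ceq_minus. rewrite -Copp_0 -E2; ring.
  rewrite E1 Cmult_plus_distr_l E3; ring.
Qed.

Lemma Beta_raise_n a b n : 0 < Re a -> 0 < Re b ->
  (poch (b + 1) n * Beta a b = poch (a + b + 2) n * Beta a (b + RtoC (INR n)))%C.
Proof.
  intros Ha Hb; elim: n => [|n IH]; [by rewrite /= Cplus_0_r|].
  rewrite S_INR RtoC_plus.
  have Hbn : 0 < Re (b + INR n) by rewrite /Re /= -/(Re b); have := pos_INR n; lra.
  have E := Beta_raise a (b + INR n) Ha Hbn.
  have -> : (b + (INR n + 1) = b + INR n + 1)%C by ring.
  simpl.
  have -> : (poch (b + 1) n * (b + 1 + INR n) * Beta a b = (b + INR n + 1) * (poch (b + 1) n * Beta a b))%C by ring.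
  rewrite IH. have -> : ((b + INR n + 1) * (poch (a + b + 2) n * Beta a (b + INR n)) = poch (a + b + 2) n * ((b + INR n + 1) * Beta a (b + INR n)))%C by ring.
  rewrite E; ring.
Qed.

Lemma Beta_1 a : 0 < Re a -> (Beta a 1 * ((a + 1) * (a + 2)) = 1)%C.
Proof.
  intros Ha.
  have Ha1 : 0 < Re (a + 1) by rewrite Re_plus1; lra.
  have Ha2 : 0 < Re (a + 1 + 1) by rewrite !Re_plus1; lra.
  have h1 : 0 < Re 1 by simpl; lra.
  have c1 := contR_beta_weight a 1 Ha h1.
  rewrite Cmult_comm /Beta -CInt_scal //.
  rewrite (CInt_FTC_open (fun u => (a + 2) * cpow u (a + 1) - (a + 1) * cpow u (a + 1 + 1))%C).
  - rewrite !cpow_base1 !cpow_nonpos; try lra. ring.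
  - apply contR_minus; (apply contR_mult; [apply contR_const|by apply contR_cpow]).
  - apply contR_mult => //; apply contR_const.
  - intros u Hu.
    have u0 : 0 < u by lra.
    have D := rdiff_plus _ _ u _ _ (rdiff_scal (a + 2) _ u _ (rdiff_cpow u (a + 1) u0))
      (rdiff_scal (-(1)) _ u _ (rdiff_scal (a + 1) _ u _ (rdiff_cpow u (a + 1 + 1) u0))).
    apply (rdiff_ext (fun u => (a + 2) * cpow u (a + 1) + -(1) * ((a + 1) * cpow u (a + 1 + 1)))%C).
      intros v; ring.
    apply (rdiff_eq _ _ _ _ D).
    have -> : (a + 1 - 1 = a)%C by ring. have -> : (a + 1 + 1 - 1 = a + 1)%C by ring.
    rewrite /beta_weight cpow_1 ?cpow_plus1 ?RtoC_minus; [ring|lra].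
Qed.

Lemma Beta_nat a n : 0 < Re a ->
  (Beta a (1 + RtoC (INR n)) * poch (a + 1) (S (S n)) = RtoC (INR (fact (S n))))%C.
Proof.
  intros Ha.
  have h1 : 0 < Re 1 by simpl; lra.
  have E := Beta_raise_n a 1 n Ha h1.
  have p2 : (poch (1 + 1) n = RtoC (INR (fact (S n))))%C.
    have := poch_shift 1 n. rewrite poch_1 => ->; ring.
  rewrite p2 in E.
  have -> : poch (a + 1) (S (S n)) = ((a + 1) * (a + 2) * poch (a + 1 + 2) n)%C.
    rewrite !poch_shift. have -> : (a + 1 + 1 + 1 = a + 1 + 2)%C by ring. ring.
  have -> : (Beta a (1 + INR n) * ((a + 1) * (a + 2) * poch (a + 1 + 2) n) =
    (poch (a + 1 + 2) n * Beta a (1 + INR n)) * ((a + 1) * (a + 2)))%C by ring.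
  rewrite -E. have := Beta_1 a Ha => E1.
  have -> : (INR (fact (S n)) * Beta a 1 * ((a + 1) * (a + 2)) = INR (fact (S n)) * (Beta a 1 * ((a + 1) * (a + 2))))%C by ring.
  rewrite E1; ring.
Qed.

Lemma cpow_1minus_estimate c u : 1 < Re c -> 0 <= u < 1 -> Cmod (cpow (1 - u) c - 1) <= Cmod c * u.
Proof.
  intros Hc Hu.
  have h : 0 < Re (c - 1) by rewrite /Re /= -/(Re c); lra.
  have E : (cpow (1 - u) c - 1 = CInt (fun s => - (c * cpow (1 - s) (c - 1))) 0 u)%C.
    rewrite (CInt_FTC (fun s => cpow (1 - s) c)).
    - by rewrite Rminus_0_r cpow_base1.
    - intros t; rewrite Rmin_left ?Rmax_right; [|lra..] => Ht; apply rdiff_cpow_1minus; lra.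
    - intros t _; apply continuousC_opp. apply contR_mult; [apply contR_const|by apply contR_cpow_1minus].
  rewrite E. rewrite -[X in _ <= _ * X](Rminus_0_r u).
  apply CInt_norm_le; [lra| |].
  - intros t; apply continuousC_opp. apply contR_mult; [apply contR_const|by apply contR_cpow_1minus].
  - intros t Ht; rewrite Cmod_opp Cmod_mult -[X in _ <= X]Rmult_1_r.
    apply Rmult_le_compat_l; [apply Cmod_ge_0|].
    rewrite Cmod_cpow; [|lra]. apply Rle_trans with (exp 0); [apply exp_le|rewrite exp_0; lra].
    have : ln (1 - t) <= ln 1 by apply ln_le; lra. rewrite ln_1. nra.
Qed.

(** Since (1-t)^c - 1 is at most |c| t in modulus, the difference gains a factor t, worth an extra
    1/n as n grows. The bound is again a Beta integral, which [Beta_nat] evaluates. *)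
Lemma Beta_perturb a c n : 0 < Re a -> 1 < Re c ->
  Cmod (Beta a (c + 1 + RtoC (INR n)) - Beta a (1 + RtoC (INR n))) <=
  Cmod c * Re (Beta (RtoC (Re a + 1)) (1 + RtoC (INR n))).
Proof.
  intros Ha Hc. have n0 := pos_INR n.
  have h1 : 0 < Re (1 + INR n) by rewrite /Re /=; lra.
  have h2 : 0 < Re (c + 1 + INR n) by rewrite /Re /= -/(Re c); lra.
  have h3 : 0 < Re (RtoC (Re a + 1)) by rewrite /Re /= -/(Re a); lra.
  have c1 := contR_beta_weight _ _ Ha h1. have c2 := contR_beta_weight _ _ Ha h2.
  have c3 := contR_beta_weight _ _ h3 h1.
  rewrite /Beta -CInt_minus //.
  have -> : Cmod c * Re (CInt (beta_weight (Re a + 1)%R (1 + INR n)) 0 1) =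
    RInt (fun t => Cmod c * Re (beta_weight (Re a + 1)%R (1 + INR n) t)) 0 1.
    rewrite (RInt_scal (V := R_CompleteNormedModule)) //. by apply contR_exRe.
  apply CInt_norm_le_fct; [lra|by apply contR_minus| |].
  - intros x; apply (continuous_mult (K := R_AbsRing)); [apply continuous_const|].
    apply (continuous_Re (beta_weight (Re a + 1)%R (1 + INR n))). apply c3.
  - intros t Ht.
    destruct (Req_dec t 0) as [->|t0].
      rewrite !beta_weight_0. have -> : (0 - 0 = 0)%C by ring. rewrite Cmod_0 /=; lra.
    destruct (Req_dec t 1) as [->|t1].
      rewrite !beta_weight_1. have -> : (0 - 0 = 0)%C by ring. rewrite Cmod_0 /=; lra.
    have -> : (beta_weight a (c + 1 + INR n) t - beta_weight a (1 + INR n) t =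
      beta_weight a (1 + INR n) t * (cpow (1 - t) c - 1))%C.
      rewrite /beta_weight. have -> : (c + 1 + INR n = c + (1 + INR n))%C by ring.
      rewrite (cpow_plus (1 - t) c); ring.
    have -> : Re (beta_weight (Re a + 1)%R (1 + INR n) t) = Cmod (beta_weight a (1 + INR n) t) * t.
      rewrite /beta_weight RtoC_plus cpow_plus1 Cmod_mult !Cmod_cpow; [|lra..].
      rewrite !cpow_cexp; [|lra..].
      have -> : ((1 + INR n) * ln (1 - t) = RtoC ((1 + INR n) * ln (1 - t))%R)%C.
        rewrite RtoC_mult RtoC_plus; ring.
      rewrite -RtoC_mult /cexp /=. rewrite /Re /= -/(Re a) cos_0 sin_0; ring.
    rewrite Cmod_mult.
    have := cpow_1minus_estimate c t Hc ltac:(lra).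
    have := Cmod_ge_0 (beta_weight a (1 + INR n) t). nra.
Qed.

Lemma Clim_const k : Clim (fun _ => k) k.
Proof. apply filterlim_const. Qed.

Lemma Clim_mult u v l m : Clim u l -> Clim v m -> Clim (fun n => u n * v n)%C (l * m)%C.
Proof.
  intros Hu Hv.
  have Hc : continuous (fun p : C * C => fst p * snd p)%C ((l, m) : C * C).
    apply (@continuousC_mult (prod_UniformSpace C_UniformSpace C_UniformSpace) fst snd);
    [apply continuous_fst|apply continuous_snd].
  apply (filterlim_comp _ _ _ (fun n => (u n, v n)) (fun p : C * C => fst p * snd p)%C _ (locally ((l, m) : C * C))).
  - intros P [d Hd].
    have h1 := Hu (ball l d) (locally_ball l d). have h2 := Hv (ball m d) (locally_ball m d).
    destruct h1 as [N1 H1]; destruct h2 as [N2 H2]; exists (N1 + N2)%nat => n Hn.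
    apply Hd; split; [apply H1|apply H2]; lia.
  - exact Hc.
Qed.

Lemma Clim_inv (u : nat -> C) (l : C) : l <> 0%C -> Clim u l -> Clim (fun n => / u n)%C (/ l)%C.
Proof.
  intros l0 Hu. apply (filterlim_comp _ _ _ u Cinv _ (locally l)) => //.
  apply (continuousC_inv (fun x : C => x)) => //.
Qed.

Lemma Clim_plus u v l m : Clim u l -> Clim v m -> Clim (fun n => u n + v n)%C (l + m)%C.
Proof.
  move=> /Clim_eps Hu /Clim_eps Hv; apply Clim_eps => e e0.
  have e2 : 0 < e / 2 by lra.
  destruct (Hu _ e2) as [N1 H1]; destruct (Hv _ e2) as [N2 H2].
  exists (N1 + N2)%nat => n Hn. have h1 := H1 n ltac:(lia). have h2 := H2 n ltac:(lia).
  have -> : (u n + v n - (l + m) = (u n - l) + (v n - m))%C by ring.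
  have := Cmod_triangle (u n - l) (v n - m). lra.
Qed.

Lemma Clim_ext_pos u v l : (forall n, (0 < n)%nat -> u n = v n) -> Clim u l -> Clim v l.
Proof.
  intros H; apply filterlim_ext_loc; exists 1%nat => n Hn; apply H; lia.
Qed.

Lemma INR_plus_neq0 q n : 0 < Re q -> (q + RtoC (INR n) <> 0)%C.
Proof.
  intros Hq E. have := f_equal Re E. rewrite /Re /= -/(Re q). have := pos_INR n; lra.
Qed.

Lemma Clim_ratio p q : 0 < Re q -> Clim (fun n => (p + RtoC (INR n)) / (q + RtoC (INR n)))%C 1.
Proof.
  intros Hq; apply (Clim_rate _ _ (Cmod (p - q))) => n n0.
  have p0 : 0 < INR n by apply lt_0_INR.
  have nz := INR_plus_neq0 q n Hq.
  have -> : ((p + INR n) / (q + INR n) - 1 = (p - q) * / (q + INR n))%C by field.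
  rewrite Cmod_mult Cmod_inv //. apply Rmult_le_compat_l; [apply Cmod_ge_0|].
  apply Rinv_le_contravar => //.
  have := re_le_Cmod (q + INR n). have := Rle_abs (Re (q + INR n)).
  rewrite {1 2}/Re /= -/(Re q). lra.
Qed.

Lemma poch_gauss n s : (0 < n)%nat ->
  poch s (S n) = (gauss n s * (RtoC (INR (fact n)) * cpow (INR n) s))%C.
Proof.
  intros n0; rewrite /gauss; field; split; [|apply fact_C_neq0].
  apply cpow_neq0; by apply lt_0_INR.
Qed.

Lemma gauss_neq0 n s : (0 < n)%nat -> 0 < Re s -> gauss n s <> 0%C.
Proof.
  intros n0 Hs E. have := poch_neq0 s Hs (S n). by rewrite poch_gauss // E Cmult_0_l.
Qed.

Lemma Re_Beta_nat x n : 0 < x -> Re (Beta (RtoC x) (1 + RtoC (INR n))) = Cmod (Beta (RtoC x) (1 + RtoC (INR n))).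
Proof.
  intros hx.
  have E := Beta_nat (RtoC x) n hx.
  have [y [y0 Hy]] : exists y, 0 < y /\ poch (RtoC x + 1) (S (S n)) = RtoC y.
    elim: (S (S n)) => [|m [y [y0 Hy]]]; [exists 1; split => //; lra|].
    exists (y * (x + 1 + INR m)); split; [have := pos_INR m; nra|].
    by rewrite /= Hy RtoC_mult !RtoC_plus.
  have f0 : 0 < INR (fact (S n)) by apply lt_0_INR, lt_O_fact.
  have -> : Beta x (1 + INR n) = RtoC (INR (fact (S n)) / y).
    rewrite RtoC_div; [|lra]. rewrite -E Hy. field. apply RtoC_neq0; lra.
  rewrite Cmod_R Rabs_pos_eq //. left; by apply Rdiv_lt_0_compat.
Qed.

(* Letting [n -> oo] in [Beta_raise_n]: [Beta a (b + n)] is compared with the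
   explicit [Beta a (1 + n)], and all Pochhammer symbols with Gauss's products. *)
Lemma Beta_rgamma_large a c : 0 < Re a -> 1 < Re c ->
  (Beta a (c + 1) * rgamma (c + 1 + 1) * rgamma (a + 1) = rgamma (a + (c + 1) + 2))%C.
Proof.
  intros Ha Hc.
  set b := (c + 1)%C. have Hb : 0 < Re b by rewrite /b Re_plus1; lra.
  set s := (a + b + 2)%C.
  have Hs : 0 < Re s by change (0 < Re a + Re b + 2); lra.
  have Ha1 : 0 < Re (a + 1) by rewrite Re_plus1; lra.
  have Hb1 : 0 < Re (b + 1) by rewrite Re_plus1; lra.
  have Ha2 : 0 < Re (a + 2) by rewrite /Re /= -/(Re a); lra.
  set x := Re a. set xs := RtoC (x + 1 + 1).
  have Hx : 0 < Re xs by rewrite /xs /=; rewrite /x; lra.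
  have Hx3 : 0 < Re (RtoC (x + 3)) by rewrite /= /x; lra.
  pose err n := (Beta a (b + RtoC (INR n)) - Beta a (1 + RtoC (INR n)))%C.
  (* The power n^(a+1) is the one that Gauss's product at a + 1 attaches to the error. The factor
     [gauss n xs] stands in the denominator of the integral bounding [err n]; multiplying by it
     gives w n = O(1/n) at once, and it is divided out again in the limit, where [rgamma xs] is
     nonzero. *)
  pose w n := (err n * (cpow (INR n) (a + 1) * gauss n xs))%C.
  have Herr : forall n, (0 < n)%nat -> Cmod (w n) <= 2 * Cmod c * / INR n.
    intros n n0. have p0 : 0 < INR n by apply lt_0_INR.
    have p1 : 1 <= INR n by apply (le_INR 1).
    have H := Beta_perturb a c n Ha Hc.
    rewrite Re_Beta_nat in H; [|rewrite -/x; rewrite /x; lra].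
    have E := Beta_nat (RtoC (Re a + 1)) n ltac:(rewrite /=; lra).
    rewrite -/x in E H.
    have Exs : (RtoC (x + 1) + 1 = xs)%C by rewrite /xs (RtoC_plus (x + 1)).
    rewrite Exs in E. rewrite -[poch xs (S (S n))]/(poch xs (S n) * (xs + RtoC (INR (S n))))%C poch_gauss // in E.
    have fS : INR (fact (S n)) = INR (fact n) * (INR n + 1).
      have -> : fact (S n) = (S n * fact n)%nat by []. rewrite mult_INR S_INR; ring.
    rewrite fS in E.
    have f0 : 0 < INR (fact n) by apply lt_0_INR, lt_O_fact.
    have EM := f_equal Cmod E. rewrite (Cmod_mult (Beta _ _)) (Cmod_mult (gauss n xs * _)%C) (Cmod_mult (gauss n xs)) (Cmod_mult (RtoC _) (cpow _ _)) !Cmod_R in EM.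
    rewrite (Rabs_pos_eq (INR (fact n))) ?(Rabs_pos_eq (INR (fact n) * (INR n + 1))) in EM; [|nra|lra].
    have EC : Cmod (xs + INR (S n)) = x + INR n + 3.
      rewrite /xs -RtoC_plus Cmod_R S_INR Rabs_pos_eq; [ring|]. rewrite /x; lra.
    have xsR : Re xs = x + 2 by rewrite /xs /=; ring.
    rewrite EC (Cmod_cpow _ xs) // xsR in EM.
    have Ew : Cmod (w n) = Cmod (err n) * (exp ((x + 1) * ln (INR n)) * Cmod (gauss n xs)).
      by rewrite /w (Cmod_mult (err n)) (Cmod_mult (cpow _ _)) Cmod_cpow.
    rewrite Ew.
    have Ex : exp ((x + 2) * ln (INR n)) = exp ((x + 1) * ln (INR n)) * INR n.
      have -> : (x + 2) * ln (INR n) = (x + 1) * ln (INR n) + ln (INR n) by ring.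
      by rewrite exp_plus (exp_ln (INR n)).
    rewrite Ex in EM.
    set e1 := exp ((x + 1) * ln (INR n)) in EM *.
    have e10 : 0 < e1 by apply exp_pos.
    set g := Cmod (gauss n xs) in EM *.
    have g0 : 0 <= g by apply Cmod_ge_0.
    set B0 := Cmod (Beta (x + 1)%R (1 + INR n)) in EM H.
    have B00 : 0 <= B0 by apply Cmod_ge_0.
    have eg : 0 <= e1 * g by apply Rmult_le_pos; lra.
    have K : B0 * (e1 * g) * INR n * (x + INR n + 3) = INR n + 1.
      apply (Rmult_eq_reg_l (INR (fact n))); [|lra]. rewrite -EM; ring.
    have K0 : 0 <= B0 * (e1 * g) * INR n by apply Rmult_le_pos; [apply Rmult_le_pos|lra].
    have K1 : B0 * (e1 * g) <= / INR n.
      apply (Rmult_le_reg_r (INR n)) => //. rewrite Rinv_l; [|lra].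
      rewrite /x in K *; nra.
    have c0 := Cmod_ge_0 c. have i0 : 0 < / INR n by apply Rinv_0_lt_compat.
    apply Rle_trans with (Cmod c * B0 * (e1 * g)).
      apply Rmult_le_compat_r => //.
    rewrite Rmult_assoc. apply Rle_trans with (Cmod c * / INR n); [by apply Rmult_le_compat_l|nra].
  have id : forall n, (0 < n)%nat ->
    (Beta a b * gauss n (b + 1) * gauss n (a + 1) =
     gauss n s * (((b + 1) + RtoC (INR n)) / (s + RtoC (INR n)) * ((1 + RtoC (INR n)) / ((a + 2) + RtoC (INR n)))) +
     gauss n s * (((b + 1) + RtoC (INR n)) / (s + RtoC (INR n))) * (gauss n (a + 1) * (w n * / gauss n xs)))%C.
    intros n n0. have p0 : 0 < INR n by apply lt_0_INR.
    have nz1 := INR_plus_neq0 s n Hs. have nz2 := INR_plus_neq0 (a + 2) n Ha2.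
    have nz3 := INR_plus_neq0 (b + 1) n Hb1.
    have cn : forall q, cpow (INR n) q <> 0%C by intros q; by apply cpow_neq0.
    have g1 := gauss_neq0 n xs n0 Hx. have g2 := gauss_neq0 n (a + 1) n0 Ha1.
    have f0 := fact_C_neq0 n.
    have -> : (gauss n (a + 1) * (w n * / gauss n xs) = gauss n (a + 1) * cpow (INR n) (a + 1) * err n)%C.
      rewrite /w; by field.
    have E := Beta_raise_n a b n Ha Hb. rewrite -/s in E.
    have Eb : poch (b + 1) n = (gauss n (b + 1) * (RtoC (INR (fact n)) * cpow (INR n) (b + 1)) / ((b + 1) + INR n))%C.
      rewrite -poch_gauss //=; by field.
    have Es : poch s n = (gauss n s * (RtoC (INR (fact n)) * cpow (INR n) s) / (s + INR n))%C.
      rewrite -poch_gauss //=; by field.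
    have EB : (Beta a (b + INR n) = RtoC (INR (fact n)) * (1 + INR n) / (gauss n (a + 1) * (RtoC (INR (fact n)) * cpow (INR n) (a + 1)) * ((a + 2) + INR n)) + err n)%C.
      rewrite /err. have := Beta_nat a n Ha.
      rewrite -[poch (a + 1) (S (S n))]/(poch (a + 1) (S n) * (a + 1 + RtoC (INR (S n))))%C poch_gauss //.
      have -> : fact (S n) = (S n * fact n)%nat by [].
      rewrite mult_INR RtoC_mult S_INR RtoC_plus.
      have -> : (a + 1 + (INR n + 1) = a + 2 + INR n)%C by ring.
      intros EN.
      have -> : (RtoC (INR (fact n)) * (1 + INR n) = Beta a (1 + INR n) * (gauss n (a + 1) * (INR (fact n) * cpow (INR n) (a + 1)) * (a + 2 + INR n)))%C.
        rewrite EN; ring.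
      field; repeat split => //.
    rewrite Eb Es EB in E.
    have Ec : cpow (INR n) s = (cpow (INR n) (b + 1) * cpow (INR n) (a + 1))%C.
      rewrite -cpow_plus; f_equal; rewrite /s; ring.
    rewrite Ec in E.
    set gb := gauss n (b + 1) in E *. set ga := gauss n (a + 1) in E g2 *. set gs := gauss n s in E *.
    set F := RtoC (INR (fact n)) in E f0 *. set N := RtoC (INR n) in E nz1 nz2 nz3 *.
    set pb := cpow (INR n) (b + 1) in E *. set pa := cpow (INR n) (a + 1) in E *.
    have pb0 : pb <> 0%C by apply cn. have pa0 : pa <> 0%C by apply cn.
    have -> : (Beta a b * gb * ga = (gb * (F * pb) / (b + 1 + N) * Beta a b) * (ga * (b + 1 + N) / (F * pb)))%C by field.
    rewrite E; by field.
  have L1 : Clim (fun n => Beta a b * gauss n (b + 1) * gauss n (a + 1))%C (Beta a b * rgamma (b + 1) * rgamma (a + 1))%C.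
    apply Clim_mult; [apply Clim_mult; [apply Clim_const|]|]; apply rgamma_lim.
  apply (Clim_unique _ _ _ L1).
  have -> : (rgamma s = rgamma s * (1 * 1) + rgamma s * 1 * (rgamma (a + 1) * (0 * / rgamma xs)))%C by ring.
  apply (Clim_ext_pos _ _ _ (fun n n0 => eq_sym (id n n0))).
  have Lw : Clim w 0 .
    apply (Clim_rate _ _ (2 * Cmod c)) => n n0. have -> : (w n - 0 = w n)%C by ring. by apply Herr.
  have r1 := Clim_ratio (b + 1) s Hs. have r2 := Clim_ratio 1 (a + 2) Ha2.
  apply Clim_plus.
  - apply Clim_mult; [apply rgamma_lim|]. by apply Clim_mult.
  - apply Clim_mult; [apply Clim_mult; [apply rgamma_lim|done]|].
    apply Clim_mult; [apply rgamma_lim|]. apply Clim_mult => //.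
    apply Clim_inv; [by apply rgamma_neq0_Re|apply rgamma_lim].
Qed.

(** [Beta_rgamma_large] applies to b + 2, which is c + 1 with c = b + 1 of real part above 1; two
    uses of [Beta_raise] then come down to b. *)
Lemma Beta_rgamma a b : 0 < Re a -> 0 < Re b ->
  (Beta a b * rgamma (b + 1) * rgamma (a + 1) = rgamma (a + b + 2))%C.
Proof.
  intros Ha Hb.
  have R1 : forall b, 0 < Re b ->
    (Beta a (b + 1) * rgamma (b + 1 + 1) * rgamma (a + 1) = rgamma (a + (b + 1) + 2))%C ->
    (Beta a b * rgamma (b + 1) * rgamma (a + 1) = rgamma (a + b + 2))%C.
    clear b Hb; intros b Hb E.
    rewrite (rgamma_shift (b + 1)).
    have -> : (Beta a b * ((b + 1) * rgamma (b + 1 + 1)) * rgamma (a + 1) =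
      (b + 1) * Beta a b * rgamma (b + 1 + 1) * rgamma (a + 1))%C by ring.
    rewrite Beta_raise // (rgamma_shift (a + b + 2)).
    have -> : (a + b + 2 + 1 = a + (b + 1) + 2)%C by ring. rewrite -E; ring.
  apply R1 => //. apply R1; [rewrite Re_plus1; lra|].
  apply Beta_rgamma_large => //; rewrite Re_plus1; lra.
Qed.

(** * Analytic continuation of phi_ab *)

(* A test function is carried along with the sequence of all its derivatives, so
   that no junk value of [Derive_n] ever enters. *)
Definition jet (g : nat -> R -> C) := forall k x, rdiff (g k) x (g (S k) x).
Definition jshift (g : nat -> R -> C) : nat -> R -> C := fun k => g (S k).

Lemma jet_contR g k : jet g -> contR (g k).
Proof. intros Hg x; apply (rdiff_continuous _ _ _ (Hg k x)). Qed.

Lemma jet_shift g : jet g -> jet (jshift g).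
Proof. intros Hg k x; apply Hg. Qed.

(** Thanks to the normalisation by 1/Gamma, raising an exponent by one costs only a polynomial
    factor, so no pole obstructs the continuation. *)
Definition phi_weight (a b : C) (u : R) : C :=
  (rgamma (a + RtoC 1) * rgamma (b + RtoC 1) * cpow u a * cpow (1 - u) b)%C.

Lemma phi_weight_beta a b u :
  phi_weight a b u = (rgamma (a + 1) * rgamma (b + 1) * beta_weight a b u)%C.
Proof. rewrite /phi_weight /beta_weight; ring. Qed.

Lemma contR_phi_weight a b : 0 < Re a -> 0 < Re b -> contR (phi_weight a b).
Proof.
  intros Ha Hb x. apply (continuous_ext (fun u => rgamma (a + 1) * rgamma (b + 1) * beta_weight a b u)%C).
    intros u; by rewrite phi_weight_beta.
  by apply contR_mult; [apply contR_const|apply contR_beta_weight].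
Qed.

Lemma phi_weight_0 a b : phi_weight a b 0 = 0%C.
Proof. rewrite phi_weight_beta beta_weight_0; ring. Qed.

Lemma phi_weight_1 a b : phi_weight a b 1 = 0%C.
Proof. rewrite phi_weight_beta beta_weight_1; ring. Qed.

Lemma phi_weight_l a b u :
  ((a + 1) * phi_weight (a + 1) b u = RtoC u * phi_weight a b u)%C.
Proof. rewrite !phi_weight_beta beta_weight_l (rgamma_shift (a + 1)); ring. Qed.

Lemma phi_weight_r a b u :
  ((b + 1) * phi_weight a (b + 1) u = RtoC (1 - u)%R * phi_weight a b u)%C.
Proof. rewrite !phi_weight_beta beta_weight_r (rgamma_shift (b + 1)); ring. Qed.

Lemma phi_weight_sum a b u :
  phi_weight a b u = ((a + 1) * phi_weight (a + 1) b u + (b + 1) * phi_weight a (b + 1) u)%C.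
Proof. rewrite phi_weight_l phi_weight_r RtoC_minus; ring. Qed.

Lemma rdiff_phi_weight a b u : 0 < u < 1 ->
  rdiff (phi_weight (a + 1) (b + 1)) u (phi_weight a (b + 1) u - phi_weight (a + 1) b u)%C.
Proof.
  intros Hu.
  apply (rdiff_ext (fun u => rgamma (a + 1 + 1) * rgamma (b + 1 + 1) * beta_weight (a + 1) (b + 1) u)%C).
    intros v; by rewrite phi_weight_beta.
  apply (rdiff_eq _ _ _ _ (rdiff_scal _ _ u _ (rdiff_beta_weight (a + 1) (b + 1) u Hu))).
  have -> : (a + 1 - 1 = a)%C by ring. have -> : (b + 1 - 1 = b)%C by ring.
  rewrite !phi_weight_beta (rgamma_shift (a + 1)) (rgamma_shift (b + 1)); ring.
Qed.

(* [phi_cont n] continues [g |-> <phi_{ab}, g>] to [Re a, Re b > -n]: each step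
   uses [phi_{a,b} = (a+1) phi_{a+1,b} + (b+1) phi_{a,b+1}] and
   [phi_{a+1,b+1}' = phi_{a,b+1} - phi_{a+1,b}] to raise both exponents,
   at the price of one derivative of the test function. *)
Fixpoint phi_cont (n : nat) (a b : C) (g : nat -> R -> C) : C :=
  match n with
  | O => CInt (fun u => phi_weight a b u * g O u)%C 0 1
  | S m => ((a + b + 2) * (a + b + 3) * phi_cont m (a + 1) (b + 1) g
      + (a + b + 2) * (a + 2) * phi_cont m (a + 1 + 1) (b + 1) (jshift g)
      - (b + 1) * phi_cont m (a + 1) (b + 1) (jshift g))%C
  end.

(** [E] collects the boundary terms of the integrations by parts and vanishes at 0 and 1. Then
    [CInt H 0 y + E y] is an antiderivative of the integrand that is continuous up to the end
    points, even where the weight itself is unbounded. *)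
Lemma phi_cont_1 a b g : jet g -> -1 < Re a -> -1 < Re b ->
  is_RInt01 (fun u => phi_weight a b u * g O u)%C (phi_cont 1 a b g).
Proof.
  intros Hg Ha Hb.
  have Ha1 : 0 < Re (a + 1) by rewrite Re_plus1; lra.
  have Ha2 : 0 < Re (a + 1 + 1) by rewrite !Re_plus1; lra.
  have Hb1 : 0 < Re (b + 1) by rewrite Re_plus1; lra.
  have w1 := contR_phi_weight _ _ Ha1 Hb1. have w2 := contR_phi_weight _ _ Ha2 Hb1.
  have g0 := jet_contR g 0 Hg. have g1 := jet_contR g 1 Hg.
  set p := ((a + b + 2) * (a + b + 3))%C. set q := ((a + b + 2) * (a + 2))%C.
  pose H (u : R) := (p * (phi_weight (a + 1) (b + 1) u * g O u) + q * (phi_weight (a + 1 + 1) (b + 1) u * g 1%nat u)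
     - (b + 1) * (phi_weight (a + 1) (b + 1) u * g 1%nat u))%C.
  pose E (u : R) := ((b + 1) * (phi_weight (a + 1) (b + 1) u * g O u) - q * (phi_weight (a + 1 + 1) (b + 1) u * g O u))%C.
  have k1 : contR (fun u => p * (phi_weight (a + 1) (b + 1) u * g O u))%C.
    apply contR_mult; [apply contR_const|by apply contR_mult].
  have k2 : contR (fun u => q * (phi_weight (a + 1 + 1) (b + 1) u * g 1%nat u))%C.
    apply contR_mult; [apply contR_const|by apply contR_mult].
  have k3 : contR (fun u => (b + 1) * (phi_weight (a + 1) (b + 1) u * g 1%nat u))%C.
    apply contR_mult; [apply contR_const|by apply contR_mult].
  have cH : contR H by apply contR_minus => //; apply contR_plus.
  have cE : contR E.
    apply contR_minus; (apply contR_mult; [apply contR_const|by apply contR_mult]).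
  have V : phi_cont 1 a b g = ((CInt H 0 1 + E 1) - (CInt H 0 0 + E 0))%C.
    rewrite /E !phi_weight_0 !phi_weight_1 CInt_point /= /H.
    rewrite CInt_minus // ?CInt_plus // ?CInt_scal; [|by apply contR_mult..|by apply contR_plus].
    rewrite /jshift /p /q; ring.
  rewrite V. apply (is_RInt01_antiderivative (fun y => CInt H 0 y + E y)%C).
  - intros y; apply continuousC_plus; [|apply cE].
    apply (rdiff_continuous _ _ _ (CInt_antiderivative H 0 y cH)).
  - intros u Hu.
    have D1 := rdiff_phi_weight a b u Hu. have D2 := rdiff_phi_weight (a + 1) b u Hu.
    have D := rdiff_plus _ _ u _ _ (rdiff_scal (b + 1) _ u _ (rdiff_mult _ _ u _ _ D1 (Hg O u)))
      (rdiff_scal (- q) _ u _ (rdiff_mult _ _ u _ _ D2 (Hg O u))).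
    have D' : rdiff E u ((b + 1) * ((phi_weight a (b + 1) u - phi_weight (a + 1) b u) * g O u + phi_weight (a + 1) (b + 1) u * g 1%nat u)
       + - q * ((phi_weight (a + 1) (b + 1) u - phi_weight (a + 1 + 1) b u) * g O u + phi_weight (a + 1 + 1) (b + 1) u * g 1%nat u))%C.
      apply rdiff_ext with (2 := D) => v; rewrite /E; ring.
    apply (rdiff_eq _ _ _ _ (rdiff_plus _ _ u _ _ (CInt_antiderivative H 0 u cH) D')).
    rewrite /H /p /q.
    have e1 := phi_weight_sum a b u. have e2 := phi_weight_sum (a + 1) b u.
    rewrite e1.
    have -> : ((b + 1) * phi_weight a (b + 1) u = phi_weight a b u - (a + 1) * phi_weight (a + 1) b u)%C.
      rewrite e1; ring.
    rewrite e1 e2. ring.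
  - intros u Hu. apply continuousC_mult; [|apply g0].
    have D := rdiff_beta_weight a b u Hu.
    apply (continuous_ext (fun u => rgamma (a + 1) * rgamma (b + 1) * beta_weight a b u)%C).
      intros v; by rewrite phi_weight_beta.
    apply continuousC_mult; [apply continuous_const|]. apply (rdiff_continuous _ _ _ D).
Qed.

Lemma phi_cont_0 a b g : jet g -> 0 < Re a -> 0 < Re b ->
  is_RInt01 (fun u => phi_weight a b u * g O u)%C (phi_cont 0 a b g).
Proof.
  intros Hg Ha Hb; apply is_RInt01_CInt.
  apply contR_mult; [by apply contR_phi_weight|by apply jet_contR].
Qed.

(** Successive levels obey the same recursion, so only levels 0 and 1 need analysis; there both
    values are limits of one improper integral. *)
Lemma phi_cont_S n a b g : jet g -> - INR n < Re a -> - INR n < Re b ->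
  phi_cont (S n) a b g = phi_cont n a b g.
Proof.
  elim: n a b g => [|n IH] a b g Hg Ha Hb.
  - simpl in Ha, Hb. apply (is_RInt01_unique (fun u => phi_weight a b u * g O u)%C).
      apply phi_cont_1 => //; lra.
    apply phi_cont_0 => //; lra.
  - rewrite S_INR in Ha Hb.
    rewrite -[LHS]/((a + b + 2) * (a + b + 3) * phi_cont (S n) (a + 1) (b + 1) g
      + (a + b + 2) * (a + 2) * phi_cont (S n) (a + 1 + 1) (b + 1) (jshift g)
      - (b + 1) * phi_cont (S n) (a + 1) (b + 1) (jshift g))%C.
    rewrite -[RHS]/((a + b + 2) * (a + b + 3) * phi_cont n (a + 1) (b + 1) g
      + (a + b + 2) * (a + 2) * phi_cont n (a + 1 + 1) (b + 1) (jshift g)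
      - (b + 1) * phi_cont n (a + 1) (b + 1) (jshift g))%C.
    by rewrite !IH //; try (by apply jet_shift); rewrite ?Re_plus1; lra.
Qed.

Lemma phi_cont_le n m a b g : jet g -> - INR n < Re a -> - INR n < Re b -> (n <= m)%nat ->
  phi_cont m a b g = phi_cont n a b g.
Proof.
  intros Hg Ha Hb; elim => [//|{}m Hm IH].
  rewrite phi_cont_S //; have := le_INR _ _ Hm; lra.
Qed.

Lemma ln_neg_le u : 0 < u <= 1 -> ln u <= 0.
Proof. intros Hu; rewrite -ln_1; apply ln_le; lra. Qed.

(** Square of y <= exp y at y = x L / 4. With L = - ln v it bounds a squared logarithm by the power
    v^(-x/2). *)
Lemma sq_exp_bound x L : 0 < x -> 0 <= L -> L * L <= 16 / (x * x) * exp (x / 2 * L).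
Proof.
  intros x0 L0.
  have h := exp_ineq1_le (x / 4 * L).
  have h0 : 0 <= x / 4 * L by nra.
  have E : exp (x / 2 * L) = exp (x / 4 * L) * exp (x / 4 * L) by rewrite -exp_plus; f_equal; field.
  have h2 : (x / 4 * L) * (x / 4 * L) <= exp (x / 2 * L) by rewrite E; nra.
  replace (L * L) with (16 / (x * x) * ((x / 4 * L) * (x / 4 * L))) by (field; lra).
  apply Rmult_le_compat_l => //. left; apply Rdiv_lt_0_compat; nra.
Qed.

Lemma contR_cpow_ln a : 0 < Re a -> contR (fun u => cpow u a * RtoC (ln u))%C.
Proof.
  intros Ha u.
  destruct (Rlt_dec 0 u) as [h|h].
    apply continuousC_mult; [by apply contR_cpow|]. apply continuousC_RtoC.
    apply (ex_derive_continuous (V := R_NormedModule)). exists (/ u).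
    by apply is_derive_Reals, derivable_pt_lim_ln.
  set x := Re a in Ha *.
  have ha2 : 0 < Re (a / 2) by rewrite /Cdiv -RtoC_inv; [rewrite re_scal_r -/x; lra|lra].
  (* The factor [v^(a/2)] absorbs the logarithm: |v^a ln v| <= (4/x) |v^(a/2)| for v < 1. *)
  have B : forall v, v < 1 -> Cmod (cpow v a * RtoC (ln v)) <= 4 / x * Cmod (cpow v (a / 2)).
    intros v v1. destruct (Rlt_dec 0 v) as [v0|v0]; last first.
      rewrite !cpow_nonpos; try lra. rewrite Cmult_0_l Cmod_0; lra.
    rewrite Cmod_mult Cmod_R !Cmod_cpow //.
    have l0 := ln_neg_le v ltac:(lra).
    rewrite Rabs_left1 //.
    have -> : Re (a / 2) = x / 2 by rewrite /Cdiv -RtoC_inv; [rewrite re_scal_r|lra].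
    have E : exp (Re a * ln v) = exp (x / 2 * ln v) * exp (x / 2 * ln v) by rewrite -exp_plus; f_equal; rewrite /x; field.
    rewrite E.
    have e1 : exp (x / 2 * ln v) * (- ln v) <= 2 / x.
      have h1 := exp_ineq1_le (x / 2 * - ln v).
      have E2 : exp (x / 2 * ln v) * exp (x / 2 * - ln v) = 1.
        rewrite -exp_plus -exp_0; f_equal; ring.
      have e0 := exp_pos (x / 2 * ln v). set ee := exp (x / 2 * ln v) in E2 e0 *.
      apply (Rmult_le_reg_l (x / 2)); [lra|].
      have -> : x / 2 * (2 / x) = 1 by field; lra. nra.
    have e0 := exp_pos (x / 2 * ln v).
    have : 2 / x <= 4 / x by apply Rmult_le_compat_r; [left; by apply Rinv_0_lt_compat|lra].
    have -> : exp (x / 2 * ln v) * exp (x / 2 * ln v) * - ln v = (exp (x / 2 * ln v) * - ln v) * exp (x / 2 * ln v) by ring.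
    intros; apply Rmult_le_compat_r; lra.
  apply continuous_RC => e e0.
  have Z : (cpow u a * RtoC (ln u))%C = 0%C by rewrite cpow_nonpos; [ring|lra].
  rewrite Z.
  have e1 : 0 < e * (x / 4) by nra.
  destruct (proj1 (continuous_RC _ _) (contR_cpow (a / 2) ha2 u) _ e1) as [d [d0 Hd]].
  exists (Rmin 1 d); split; [apply Rmin_pos; lra|] => y Hy.
  have k1 := Rmin_l 1 d; have k2 := Rmin_r 1 d.
  have -> : (cpow y a * ln y - 0 = cpow y a * ln y)%C by ring.
  apply Rle_lt_trans with (1 := B y ltac:(split_Rabs; lra)).
  have := Hd y ltac:(lra). rewrite (cpow_nonpos u); [|lra].
  have -> : (cpow y (a / 2) - 0 = cpow y (a / 2))%C by ring. intros H.
  have -> : e = 4 / x * (e * (x / 4)) by field; lra.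
  apply Rmult_lt_compat_l => //. apply Rdiv_lt_0_compat; lra.
Qed.

(** Used with f u = u and f u = 1 - u. The second order remainder is v^a (exp (h ln v) - 1 - h ln
    v). For |h| < x/2 the exponential in its bound costs v^(-x/2) and the squared logarithm another
    v^(-x/2); the modulus v^x of v^a pays for both. *)
Lemma cdiff_CInt_cpow (f : R -> R) (W : R -> C) a : 0 < Re a ->
  (forall x, continuous f x) -> (forall u, 0 <= u <= 1 -> f u <= 1) -> contR W ->
  exists l, cdiff (fun a => CInt (fun u => cpow (f u) a * W u)%C 0 1) a l.
Proof.
  intros Ha Cf f1 CW. set x := Re a in Ha *.
  destruct (contR_bounded W 0 1 CW) as [M [M0 HM]].
  have cont : forall q, 0 < Re q -> contR (fun u => cpow (f u) q * W u)%C.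
    intros q Hq; apply contR_mult => // u.
    by apply (continuous_comp f (fun v => cpow v q)); [apply Cf|apply contR_cpow].
  have CD : contR (fun u => (cpow (f u) a * RtoC (ln (f u))) * W u)%C.
    apply contR_mult => // u.
    apply (continuous_comp f (fun v => cpow v a * RtoC (ln v))%C); [apply Cf|by apply contR_cpow_ln].
  exists (CInt (fun u => (cpow (f u) a * RtoC (ln (f u))) * W u)%C 0 1).
  have x2 : 0 < x / 2 by lra.
  apply (cdiff_CInt 0 1 _ Rle_0_1 CD (fun a u => cpow (f u) a * W u)%C a (M * (16 / (x * x))) (x / 2) x2).
  - intros q Hq; apply cont.
    have := re_le_Cmod (q - a). have -> : Re (q - a) = Re q - x by rewrite /x /Re /=; ring.
    split_Rabs; lra.
  - intros h u Hh Hu.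
    have Hm := Cmod_ge_0 h.
    destruct (Rlt_dec 0 (f u)) as [v0|v0]; last first.
      rewrite !cpow_nonpos; try lra. rewrite !Cmult_0_l Cmult_0_r.
      have -> : (0 - 0 - 0 = 0)%C by ring. rewrite Cmod_0.
      apply Rmult_le_pos; [apply Rmult_le_pos => //|nra]. left; apply Rdiv_lt_0_compat; nra.
    set v := f u in v0 *. have v1 : v <= 1 by apply f1.
    have l0 := ln_neg_le v ltac:(lra). set L := - ln v.
    have L0 : 0 <= L by rewrite /L; lra.
    have -> : (cpow v (a + h) * W u - cpow v a * W u - h * (cpow v a * ln v * W u) =
      W u * (cpow v a * (cexp (h * RtoC (ln v)) - 1 - h * RtoC (ln v))))%C.
      rewrite cpow_plus (cpow_cexp v h) //; ring.
    rewrite Cmod_mult (Rmult_assoc M). apply Rmult_le_compat; [apply Cmod_ge_0|apply Cmod_ge_0|by apply HM|].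
    rewrite Cmod_mult Cmod_cpow //.
    have E2 := cexp_estimate2 (h * RtoC (ln v)).
    have EL : Cmod (h * RtoC (ln v)) = Cmod h * L by rewrite Cmod_mult Cmod_R Rabs_left1.
    rewrite EL in E2.
    have e0 := exp_pos (Re a * ln v).
    apply Rle_trans with (exp (Re a * ln v) * (Cmod h * L * (Cmod h * L) * exp (Cmod h * L))).
      apply Rmult_le_compat_l; lra.
    have S := sq_exp_bound x L Ha L0.
    have Ex : exp (Re a * ln v) * exp (x / 2 * L) * exp (x / 2 * L) = 1.
      rewrite -!exp_plus -exp_0; f_equal; rewrite /L /x; field.
    have Eh : exp (Cmod h * L) <= exp (x / 2 * L) by apply exp_le; nra.
    have p0 := exp_pos (x / 2 * L). have p1 := exp_pos (Cmod h * L).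
    have hh : 0 <= Cmod h * Cmod h by nra.
    apply Rle_trans with (exp (Re a * ln v) * ((16 / (x * x) * exp (x / 2 * L)) * (Cmod h * Cmod h) * exp (x / 2 * L))).
    - apply Rmult_le_compat_l; [lra|].
      apply Rmult_le_compat => //; [nra|lra|].
      have -> : Cmod h * L * (Cmod h * L) = (L * L) * (Cmod h * Cmod h) by ring.
      by apply Rmult_le_compat_r.
    - right. transitivity ((16 / (x * x)) * (Cmod h * Cmod h) * (exp (Re a * ln v) * exp (x / 2 * L) * exp (x / 2 * L))); [ring|].
      rewrite Ex; ring.
Qed.

Lemma cdiff_rgamma_shift a : exists l, cdiff (fun a => rgamma (a + 1)%C) a l.
Proof.
  destruct (entire_rgamma (a + 1)%C) as [l Hl]; eexists.
  apply (cdiff_comp rgamma); [exact Hl|]. apply cdiff_plus; [apply cdiff_id|apply cdiff_const].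
Qed.

Lemma phi_cont_cdiff_0 a b g : jet g -> 0 < Re a -> 0 < Re b ->
  (exists l, cdiff (fun a => phi_cont 0 a b g) a l) /\ (exists l, cdiff (fun b => phi_cont 0 a b g) b l).
Proof.
  intros Hg Ha Hb. have g0 := jet_contR g 0 Hg.
  have E : forall a b, 0 < Re a -> 0 < Re b -> phi_cont 0 a b g =
    (rgamma (a + 1) * rgamma (b + 1) * CInt (fun u => beta_weight a b u * g O u) 0 1)%C.
    intros a' b' Ha' Hb'; rewrite -CInt_scal; [|by apply contR_mult => //; apply contR_beta_weight].
    apply CInt_ext => u _; rewrite phi_weight_beta; ring.
  have loc : forall c, 0 < Re c -> locally c (fun z : C => 0 < Re z).
    intros c Hc; apply locally_C; exists (Re c); split => // y Hy.
    have := re_le_Cmod (y - c). have -> : Re (y - c) = Re y - Re c by rewrite /Re /=; ring.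
    split_Rabs; lra.
  split.
  - destruct (cdiff_CInt_cpow (fun u => u) (fun u => cpow (1 - u) b * g O u)%C a Ha) as [l Hl].
    + intros; apply continuous_id.
    + intros; lra.
    + apply contR_mult => //; by apply contR_cpow_1minus.
    + destruct (cdiff_rgamma_shift a) as [l' Hl']. eexists.
      apply (cdiff_ext_loc (fun a => rgamma (a + 1) * rgamma (b + 1) * CInt (fun u => cpow u a * (cpow (1 - u) b * g O u)) 0 1)%C).
        apply: filter_imp (loc a Ha) => y Hy. rewrite E //. f_equal.
        apply CInt_ext => u _; rewrite /beta_weight; ring.
      apply cdiff_mult; [|exact Hl]. apply cdiff_mult; [exact Hl'|apply cdiff_const].
  - destruct (cdiff_CInt_cpow (fun u => 1 - u) (fun u => cpow u a * g O u)%C b Hb) as [l Hl].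
    + intros; apply continuous_1minus.
    + intros; lra.
    + apply contR_mult => //; by apply contR_cpow.
    + destruct (cdiff_rgamma_shift b) as [l' Hl']. eexists.
      apply (cdiff_ext_loc (fun b => rgamma (a + 1) * rgamma (b + 1) * CInt (fun u => cpow (1 - u) b * (cpow u a * g O u)) 0 1)%C).
        apply: filter_imp (loc b Hb) => y Hy. rewrite E //. f_equal.
        apply CInt_ext => u _; rewrite /beta_weight; ring.
      apply cdiff_mult; [|exact Hl]. apply cdiff_mult; [apply cdiff_const|exact Hl'].
Qed.

Lemma cdiff_shift f c k : (exists l, cdiff f (c + k)%C l) -> exists l, cdiff (fun z => f (z + k)%C) c l.
Proof.
  intros [l Hl]; eexists. apply (cdiff_comp f); [exact Hl|].
  apply cdiff_plus; [apply cdiff_id|apply cdiff_const].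
Qed.

Lemma ex_cdiff_plus f g c : (exists l, cdiff f c l) -> (exists l, cdiff g c l) ->
  exists l, cdiff (fun z => f z + g z)%C c l.
Proof. intros [l Hl] [m Hm]; eexists; by apply cdiff_plus; [exact Hl|exact Hm]. Qed.

Lemma ex_cdiff_mult f g c : (exists l, cdiff f c l) -> (exists l, cdiff g c l) ->
  exists l, cdiff (fun z => f z * g z)%C c l.
Proof. intros [l Hl] [m Hm]; eexists; by apply cdiff_mult; [exact Hl|exact Hm]. Qed.

Lemma ex_cdiff_const k c : exists l, cdiff (fun _ => k) c l.
Proof. eexists; apply cdiff_const. Qed.

Lemma ex_cdiff_id c : exists l, cdiff (fun z => z) c l.
Proof. eexists; apply cdiff_id. Qed.

Lemma ex_cdiff_opp f c : (exists l, cdiff f c l) -> exists l, cdiff (fun z => - f z)%C c l.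
Proof.
  intros H; destruct (ex_cdiff_mult _ _ c (ex_cdiff_const (-(1)) c) H) as [l Hl]; exists l.
  apply cdiff_ext with (2 := Hl) => z; ring.
Qed.

Lemma phi_cont_cdiff n a b g : jet g -> - INR n < Re a -> - INR n < Re b ->
  (exists l, cdiff (fun a => phi_cont n a b g) a l) /\ (exists l, cdiff (fun b => phi_cont n a b g) b l).
Proof.
  elim: n a b g => [|n IH] a b g Hg Ha Hb.
  - simpl in Ha, Hb; apply phi_cont_cdiff_0 => //; lra.
  - rewrite S_INR in Ha Hb.
    have K := fun g Hg => IH (a + 1)%C (b + 1)%C g Hg ltac:(rewrite !Re_plus1; lra) ltac:(rewrite !Re_plus1; lra).
    have K2 := fun g Hg => IH (a + 1 + 1)%C (b + 1)%C g Hg ltac:(rewrite !Re_plus1; lra) ltac:(rewrite !Re_plus1; lra).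
    have Hs := jet_shift g Hg.
    split; simpl;
    repeat match goal with
    | |- exists l, cdiff (fun z => _ + _)%C _ _ => apply ex_cdiff_plus
    | |- exists l, cdiff (fun z => _ - _)%C _ _ => apply ex_cdiff_plus
    | |- exists l, cdiff (fun z => _ * _)%C _ _ => apply ex_cdiff_mult
    | |- exists l, cdiff (fun z => - _)%C _ _ => apply ex_cdiff_opp
    | |- exists l, cdiff (fun z => ?k) _ _ => apply ex_cdiff_const
    | |- exists l, cdiff (fun z => z) _ _ => apply ex_cdiff_id
    | |- exists l, cdiff (Cplus ?k) _ _ => apply (ex_cdiff_plus (fun _ => k) (fun z => z))
    end.
    + apply (cdiff_shift (fun a => phi_cont n a (b + 1)%C g)). by apply K.
    + apply (cdiff_shift (fun a => phi_cont n (a + 1)%C (b + 1)%C (jshift g))).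
      apply (cdiff_shift (fun a => phi_cont n a (b + 1)%C (jshift g))). by apply K2.
    + apply (cdiff_shift (fun a => phi_cont n a (b + 1)%C (jshift g))). by apply K.
    + apply (cdiff_shift (fun b => phi_cont n (a + 1)%C b g)). by apply K.
    + apply (cdiff_shift (fun b => phi_cont n (a + 1 + 1)%C b (jshift g))). by apply K2.
    + apply (cdiff_shift (fun b => phi_cont n (a + 1)%C b (jshift g))). by apply K.
Qed.

(** * Continuation to all exponents, and its uniqueness *)

Definition above (x : R) : nat := proj1_sig (constructive_indefinite_description _ (INR_unbounded x)).

Lemma above_lt x : x < INR (above x).
Proof. exact (proj2_sig (constructive_indefinite_description _ (INR_unbounded x))). Qed.

Definition phi_ext (g : nat -> R -> C) (a b : C) : C :=
  phi_cont (above (Rabs (Re a) + Rabs (Re b))) a b g.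

Lemma phi_ext_cont n a b g : jet g -> - INR n < Re a -> - INR n < Re b ->
  phi_ext g a b = phi_cont n a b g.
Proof.
  intros Hg Ha Hb. rewrite /phi_ext. set m := above _.
  have Hm := above_lt (Rabs (Re a) + Rabs (Re b)). rewrite -/m in Hm.
  have Hma : - INR m < Re a by split_Rabs; lra.
  have Hmb : - INR m < Re b by split_Rabs; lra.
  by rewrite -(phi_cont_le m (m + n) a b g) ?(phi_cont_le n (m + n) a b g) //; lia.
Qed.

(** All sufficiently high levels agree, so the level, which varies with the exponents, may be frozen
    near a given point. The added 1 makes it high enough on the whole unit disc around that
    point. *)
Lemma phi_ext_entire g : jet g -> entire2 (phi_ext g).
Proof.
  intros Hg.
  have loc : forall (c z : C), Cmod (z - c) < 1 -> Rabs (Re z - Re c) < 1.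
    intros c z Hz. apply Rle_lt_trans with (2 := Hz).
    have -> : Re z - Re c = Re (z - c) by rewrite /Re /=; ring. apply re_le_Cmod.
  split=> a b; set n := above (Rabs (Re a) + Rabs (Re b) + 1);
  have Hn := above_lt (Rabs (Re a) + Rabs (Re b) + 1); rewrite -/n in Hn.
  - destruct (phi_cont_cdiff n a b g Hg) as [[l Hl] _]; [split_Rabs; lra|split_Rabs; lra|].
    exists l. apply cdiff_derive. apply (cdiff_ext_loc (fun a => phi_cont n a b g)) => //.
    apply locally_C; exists 1; split; [lra|] => y Hy. have := loc _ _ Hy => Hy'.
    symmetry; apply phi_ext_cont => //; split_Rabs; lra.
  - destruct (phi_cont_cdiff n a b g Hg) as [_ [l Hl]]; [split_Rabs; lra|split_Rabs; lra|].
    exists l. apply cdiff_derive. apply (cdiff_ext_loc (fun b => phi_cont n a b g)) => //.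
    apply locally_C; exists 1; split; [lra|] => y Hy. have := loc _ _ Hy => Hy'.
    symmetry; apply phi_ext_cont => //; split_Rabs; lra.
Qed.

(** The half-plane contains the open unit disc. *)
Lemma entire_vanishing_halfplane f : entire f -> (forall z, -1 < Re z -> f z = 0%C) -> forall w, f w = 0%C.
Proof.
  intros Hf H; apply entire_vanishing => // z Hz; apply H.
  have := re_le_Cmod z; split_Rabs; lra.
Qed.

(** One variable at a time: equality spreads to all a while Re b > -1, and then, for each fixed a,
    to all b. *)
Lemma phi2_cont_prop_unique psi G1 G2 : phi2_cont_prop psi G1 -> phi2_cont_prop psi G2 ->
  forall a b, G1 a b = G2 a b.
Proof.
  intros [[E1a E1b] I1] [[E2a E2b] I2].
  have eq0 : forall a b, -1 < Re a -> -1 < Re b -> G1 a b = G2 a b.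
    intros a b Ha Hb; apply (is_RInt01_unique _ _ _ (I1 a b Ha Hb) (I2 a b Ha Hb)).
  have sub : forall f1 f2 : C -> C, (forall c, ex_derive (K := C_AbsRing) (V := C_NormedModule) f1 c) ->
    (forall c, ex_derive (K := C_AbsRing) (V := C_NormedModule) f2 c) -> entire (fun z => f1 z + - f2 z)%C.
    intros f1 f2 H1 H2 c; apply ex_cdiff_plus; [|apply ex_cdiff_opp].
    - destruct (H1 c) as [l Hl]; exists l; by apply cdiff_of_derive.
    - destruct (H2 c) as [l Hl]; exists l; by apply cdiff_of_derive.
  have eq1 : forall a b, -1 < Re b -> G1 a b = G2 a b.
    intros a b Hb. apply Ceq_minus.
    apply (entire_vanishing_halfplane (fun z => G1 z b + - G2 z b)%C).
      by apply (sub (fun z => G1 z b) (fun z => G2 z b)).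
    intros z Hz; rewrite eq0 //; ring.
  intros a b. apply Ceq_minus.
  apply (entire_vanishing_halfplane (fun z => G1 a z + - G2 a z)%C).
    by apply (sub (fun z => G1 a z) (fun z => G2 a z)).
  intros z Hz; rewrite eq1 //; ring.
Qed.

Lemma phi2_eq psi G a b : phi2_cont_prop psi G -> phi2 a b psi = G a b.
Proof.
  intros HG. apply (phi2_cont_prop_unique psi) => //.
  apply (epsilon_spec inhCC (phi2_cont_prop psi)). by exists G.
Qed.

Lemma phi_ext_prop g psi : jet g -> (forall u, g O u = psi u) -> phi2_cont_prop psi (phi_ext g).
Proof.
  intros Hg E; split; [by apply phi_ext_entire|] => a b Ha Hb.
  rewrite (phi_ext_cont 1) //=; try lra.
  apply is_RInt01_ext with (2 := phi_cont_1 a b g Hg Ha Hb) => u _; by rewrite E.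
Qed.

Lemma phi2_jet g psi a b : jet g -> (forall u, g O u = psi u) -> phi2 a b psi = phi_ext g a b.
Proof. intros Hg E; apply phi2_eq; by apply phi_ext_prop. Qed.

(** One step of the continuation applied to the constant 1, whose derivatives vanish: Beta exponents
    become positive, and the factor (a+b+2)(a+b+3) is absorbed by the functional equation of
    1/Gamma. *)
Lemma phi_weight_integral a b : -1 < Re a -> -1 < Re b ->
  is_RInt01 (phi_weight a b) (rgamma (a + b + 2)).
Proof.
  intros Ha Hb.
  pose one (k : nat) (u : R) : C := match k with O => 1%C | _ => 0%C end.
  have J : jet one.
    intros [|k] x; [apply (rdiff_const 1%C x)|apply (rdiff_const 0%C x)].
  have Ha1 : 0 < Re (a + 1) by rewrite Re_plus1; lra.
  have Ha2 : 0 < Re (a + 1 + 1) by rewrite !Re_plus1; lra.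
  have Hb1 : 0 < Re (b + 1) by rewrite Re_plus1; lra.
  have := phi_cont_1 a b one J Ha Hb.
  have -> : phi_cont 1 a b one = rgamma (a + b + 2).
    have z : forall a b, phi_cont 0 a b (jshift one) = 0%C.
      intros; rewrite /= (CInt_ext _ (fun _ => 0%C)); [by rewrite CInt_const Cmult_0_r|].
      intros; rewrite /jshift /one; ring.
    rewrite -[LHS]/((a + b + 2) * (a + b + 3) * phi_cont 0 (a + 1) (b + 1) one
      + (a + b + 2) * (a + 2) * phi_cont 0 (a + 1 + 1) (b + 1) (jshift one)
      - (b + 1) * phi_cont 0 (a + 1) (b + 1) (jshift one))%C !z.
    have -> : phi_cont 0 (a + 1) (b + 1) one = rgamma (a + b + 4).
      have -> : (a + b + 4 = (a + 1) + (b + 1) + 2)%C by ring.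
      rewrite -Beta_rgamma // /=.
      rewrite (CInt_ext _ (fun u => rgamma (a + 1 + 1) * rgamma (b + 1 + 1) * beta_weight (a + 1) (b + 1) u)%C).
        rewrite CInt_scal; [|by apply contR_beta_weight]. rewrite /Beta; ring.
      intros u _; rewrite phi_weight_beta /one; ring.
    rewrite (rgamma_shift (a + b + 2)) (rgamma_shift (a + b + 2 + 1)).
    have -> : (a + b + 2 + 1 + 1 = a + b + 4)%C by ring. ring.
  apply is_RInt01_ext => u _; rewrite /one; ring.
Qed.

Lemma phi_weight_pow a b l u :
  (phi_weight a b u * RtoC u ^ l = poch (a + 1) l * phi_weight (a + RtoC (INR l)) b u)%C.
Proof.
  elim: l => [|l IH]; [rewrite /= Cplus_0_r; ring|].
  rewrite Cpow_S S_INR RtoC_plus.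
  have -> : (phi_weight a b u * (u * u ^ l) = u * (phi_weight a b u * u ^ l))%C by ring.
  rewrite IH. have -> : (a + (INR l + 1) = a + INR l + 1)%C by ring.
  have E := phi_weight_l (a + INR l) b u. simpl.
  have -> : (u * (poch (a + 1) l * phi_weight (a + INR l) b u) = poch (a + 1) l * (u * phi_weight (a + INR l) b u))%C by ring.
  rewrite -E; ring.
Qed.

(** The right-hand side is entire in each exponent, so by uniqueness it needs to be checked only
    where the integral converges; there u^l shifts a to a + l. *)
Lemma phi2_moment a b l : phi2 a b (fun u => RtoC u ^ l)%C = (poch (a + 1) l * rgamma (a + b + RtoC (INR l) + 2))%C.
Proof.
  apply (phi2_eq _ (fun a b => poch (a + 1) l * rgamma (a + b + RtoC (INR l) + 2))%C).
  have hp : forall c, exists m, cdiff (fun a => poch (a + 1) l) c m.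
    intros c; apply (cdiff_shift (fun s => poch s l)). apply entire_poch.
  split; [split|].
  - intros x y; have [m Hm] : exists m, cdiff (fun x => poch (x + 1) l * rgamma (x + y + RtoC (INR l) + 2))%C x m.
      apply ex_cdiff_mult; [apply hp|].
      destruct (cdiff_shift rgamma x (y + RtoC (INR l) + 2)) as [m Hm]; [apply entire_rgamma|].
      exists m; apply cdiff_ext with (2 := Hm) => z; f_equal; ring.
    exists m; by apply cdiff_derive.
  - intros x y; have [m Hm] : exists m, cdiff (fun y => poch (x + 1) l * rgamma (x + y + RtoC (INR l) + 2))%C y m.
      apply ex_cdiff_mult; [apply ex_cdiff_const|].
      destruct (cdiff_shift rgamma y (x + RtoC (INR l) + 2)) as [m Hm]; [apply entire_rgamma|].
      exists m; apply cdiff_ext with (2 := Hm) => z; f_equal; ring.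
    exists m; by apply cdiff_derive.
  - intros x y Hx Hy.
    have Hxl : -1 < Re (x + INR l) by rewrite /Re /= -/(Re x); have := pos_INR l; lra.
    have I := phi_weight_integral (x + INR l) y Hxl Hy.
    have I' := is_RInt01_scal (poch (x + 1) l) _ _ I.
    have -> : (x + y + INR l + 2 = x + INR l + y + 2)%C by ring.
    apply is_RInt01_ext with (2 := I') => u _. by rewrite -phi_weight_pow.
Qed.

(** * Operators on test functions *)

Lemma smooth_jet psi : smooth psi -> exists g, jet g /\ forall u, g O u = psi u.
Proof.
  intros H.
  exists (fun k u => (Derive_n (fun u => Re (psi u)) k u, Derive_n (fun u => Im (psi u)) k u)); split.
  - intros k x; destruct (H (S k) x) as [H1 H2].
    apply rdiff_ReIm; [exact (Derive_correct _ _ H1)|exact (Derive_correct _ _ H2)].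
  - intros u; simpl; by destruct (psi u).
Qed.

Definition jlin (g : nat -> R -> C) (c : C) (h : nat -> R -> C) : nat -> R -> C :=
  fun k x => (g k x + c * h k x)%C.

Lemma jet_jlin g c h : jet g -> jet h -> jet (jlin g c h).
Proof. intros Hg Hh k x; apply rdiff_plus; [apply Hg|apply rdiff_scal, Hh]. Qed.

(* Functionals of this shape are closed under differentiation in parameters and
   are visibly bounded by finitely many derivatives on [0, 1]. *)
Inductive jetfun : ((nat -> R -> C) -> C) -> Prop :=
| jetfun_int k W : contR W -> jetfun (fun g => CInt (fun u => W u * g k u)%C 0 1)
| jetfun_plus A B : jetfun A -> jetfun B -> jetfun (fun g => A g + B g)%C
| jetfun_scal c A : jetfun A -> jetfun (fun g => c * A g)%C.

Lemma jetfun_shift A : jetfun A -> jetfun (fun g => A (jshift g)).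
Proof.
  elim => [k W HW|A1 B1 _ H1 _ H2|c A1 _ H1].
  - by apply (jetfun_int (S k)).
  - by apply (jetfun_plus (fun g => A1 (jshift g)) (fun g => B1 (jshift g))).
  - by apply (jetfun_scal c (fun g => A1 (jshift g))).
Qed.

Lemma jetfun_phi_cont n a b : - INR n < Re a -> - INR n < Re b -> jetfun (phi_cont n a b).
Proof.
  elim: n a b => [|n IH] a b Ha Hb.
  - simpl in Ha, Hb; apply (jetfun_int 0). apply contR_phi_weight; lra.
  - rewrite S_INR in Ha Hb.
    have K1 := IH (a + 1)%C (b + 1)%C ltac:(rewrite !Re_plus1; lra) ltac:(rewrite !Re_plus1; lra).
    have K2 := IH (a + 1 + 1)%C (b + 1)%C ltac:(rewrite !Re_plus1; lra) ltac:(rewrite !Re_plus1; lra).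
    have -> : phi_cont (S n) a b = (fun g => (a + b + 2) * (a + b + 3) * phi_cont n (a + 1) (b + 1) g
      + ((a + b + 2) * (a + 2) * phi_cont n (a + 1 + 1) (b + 1) (jshift g)
      + (- (b + 1)) * phi_cont n (a + 1) (b + 1) (jshift g)))%C.
      apply functional_extensionality => g /=; ring.
    apply (jetfun_plus (fun g => _ * phi_cont n (a + 1)%C (b + 1)%C g)%C); [by apply jetfun_scal|].
    apply (jetfun_plus (fun g => _ * phi_cont n (a + 1 + 1)%C (b + 1)%C (jshift g))%C
      (fun g => _ * phi_cont n (a + 1)%C (b + 1)%C (jshift g))%C);
    by apply (jetfun_scal _ (fun g => _ (jshift g))); apply jetfun_shift.
Qed.

Lemma jetfun_phi_ext a b : jetfun (fun g => phi_ext g a b).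
Proof.
  rewrite /phi_ext. set n := above _.
  have Hn := above_lt (Rabs (Re a) + Rabs (Re b)). rewrite -/n in Hn.
  apply jetfun_phi_cont; split_Rabs; lra.
Qed.

Lemma jetfun_linear A g c h : jetfun A -> jet g -> jet h -> A (jlin g c h) = (A g + c * A h)%C.
Proof.
  intros HA Hg Hh; elim: HA => [k W HW|A1 B1 _ H1 _ H2|d A1 _ H1].
  - have cg := jet_contR g k Hg. have ch := jet_contR h k Hh.
    rewrite -CInt_scal; [|by apply contR_mult].
    rewrite -CInt_plus; [|by apply contR_mult|by apply contR_mult; [apply contR_const|apply contR_mult]].
    apply CInt_ext => u _; rewrite /jlin; ring.
  - rewrite H1 H2; ring.
  - rewrite H1; ring.
Qed.

Lemma jetfun_bounded A : jetfun A -> exists K B, 0 <= B /\ forall g, jet g -> forall M,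
  (forall j x, (j <= K)%nat -> 0 <= x <= 1 -> Cmod (g j x) <= M) -> Cmod (A g) <= B * M.
Proof.
  elim => [k W HW|A1 B1 _ [K1 [C1 [C10 H1]]] _ [K2 [C2 [C20 H2]]]|c A1 _ [K1 [C1 [C10 H1]]]].
  - destruct (contR_bounded W 0 1 HW) as [B [B0 HB]].
    exists k, B; split => // g Hg M HM.
    have -> : B * M = B * M * (1 - 0) by ring.
    apply CInt_norm_le; [lra|by apply contR_mult => //; apply jet_contR|].
    intros t Ht; rewrite Cmod_mult; apply Rmult_le_compat; [apply Cmod_ge_0..|by apply HB|by apply HM].
  - exists (K1 + K2)%nat, (C1 + C2); split; [lra|] => g Hg M HM.
    apply Rle_trans with (1 := Cmod_triangle _ _). rewrite Rmult_plus_distr_r.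
    apply Rplus_le_compat; [apply H1|apply H2] => // j x Hj Hx; apply HM => //; lia.
  - exists K1, (Cmod c * C1); split; [apply Rmult_le_pos => //; apply Cmod_ge_0|] => g Hg M HM.
    rewrite Cmod_mult Rmult_assoc; apply Rmult_le_compat_l; [apply Cmod_ge_0|by apply H1].
Qed.

(* Continuous operators: [O g] on [-s, s] is controlled by [g] on [-r, r]. *)
Record jop (r s : R) (O : (nat -> R -> C) -> nat -> R -> C) : Prop := {
  jop_jet : forall g, jet g -> jet (O g);
  jop_lin : forall g c h, jet g -> jet h -> forall k x, O (jlin g c h) k x = (O g k x + c * O h k x)%C;
  jop_bd : forall k, exists K B, 0 <= B /\ forall g, jet g -> forall M,
    (forall j x, (j <= K)%nat -> Rabs x <= r -> Cmod (g j x) <= M) ->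
    forall x, Rabs x <= s -> Cmod (O g k x) <= B * M }.

(** An outer operator consults several derivatives of its argument, so composing needs one bound for
    all orders up to k. *)
Lemma jop_bd_upto r s O : jop r s O -> forall k, exists K B, 0 <= B /\ forall g, jet g -> forall M,
    (forall j x, (j <= K)%nat -> Rabs x <= r -> Cmod (g j x) <= M) ->
    forall i x, (i <= k)%nat -> Rabs x <= s -> Cmod (O g i x) <= B * M.
Proof.
  intros HO; elim => [|k [K1 [B1 [B10 H1]]]].
  - destruct (jop_bd _ _ _ HO 0%nat) as [K [B [B0 H]]]; exists K, B; split => // g Hg M HM i x Hi Hx.
    have -> : i = 0%nat by lia. by apply H.
  - destruct (jop_bd _ _ _ HO (S k)) as [K [B [B0 H]]].
    exists (K + K1)%nat, (B + B1); split; [lra|] => g Hg M HM i x Hi Hx.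
    have h1 := H g Hg M (fun j y Hj Hy => HM j y ltac:(lia) Hy) x Hx.
    have h2 := H1 g Hg M (fun j y Hj Hy => HM j y ltac:(lia) Hy) i x.
    have M0 : 0 <= B * M by apply Rle_trans with (2 := h1); apply Cmod_ge_0.
    destruct (Nat.eq_dec i (S k)) as [->|n].
    + have : 0 <= B1 * M; [|lra].
      have := H1 g Hg M (fun j y Hj Hy => HM j y ltac:(lia) Hy) 0%nat x ltac:(lia) Hx.
      have := Cmod_ge_0 (O g 0%nat x). lra.
    + have := h2 ltac:(lia) Hx; lra.
Qed.

Lemma jop_plus r s O P : jop r s O -> jop r s P -> jop r s (fun g k x => O g k x + P g k x)%C.
Proof.
  intros HO HP; split.
  - intros g Hg k x; apply rdiff_plus; [by apply (jop_jet _ _ _ HO)|by apply (jop_jet _ _ _ HP)].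
  - intros; rewrite (jop_lin _ _ _ HO) // (jop_lin _ _ _ HP) //; ring.
  - intros k; destruct (jop_bd _ _ _ HO k) as [K1 [B1 [B10 H1]]]; destruct (jop_bd _ _ _ HP k) as [K2 [B2 [B20 H2]]].
    exists (K1 + K2)%nat, (B1 + B2); split; [lra|] => g Hg M HM x Hx.
    apply Rle_trans with (1 := Cmod_triangle _ _). rewrite Rmult_plus_distr_r.
    apply Rplus_le_compat; [apply H1|apply H2] => // j y Hj Hy; apply HM => //; lia.
Qed.

Lemma jop_scal r s c O : jop r s O -> jop r s (fun g k x => c * O g k x)%C.
Proof.
  intros HO; split.
  - intros g Hg k x; apply rdiff_scal; by apply (jop_jet _ _ _ HO).
  - intros; rewrite (jop_lin _ _ _ HO) //; ring.
  - intros k; destruct (jop_bd _ _ _ HO k) as [K1 [B1 [B10 H1]]].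
    exists K1, (Cmod c * B1); split; [apply Rmult_le_pos => //; apply Cmod_ge_0|] => g Hg M HM x Hx.
    rewrite Cmod_mult Rmult_assoc; apply Rmult_le_compat_l; [apply Cmod_ge_0|by apply H1].
Qed.

Lemma jop_shift r s O : jop r s O -> jop r s (fun g => O (jshift g)).
Proof.
  intros HO; split.
  - intros g Hg; apply (jop_jet _ _ _ HO); by apply jet_shift.
  - intros g c h Hg Hh k x; apply (jop_lin _ _ _ HO (jshift g) c (jshift h)); by apply jet_shift.
  - intros k; destruct (jop_bd _ _ _ HO k) as [K1 [B1 [B10 H1]]].
    exists (S K1), B1; split => // g Hg M HM x Hx.
    apply H1 => //; [by apply jet_shift|] => j y Hj Hy. apply HM => //; lia.
Qed.

(** Leibniz's rule for multiplication by x. *)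
Definition jmulX (g : nat -> R -> C) (k : nat) (x : R) : C :=
  (RtoC x * g k x + match k with O => 0 | S m => RtoC (INR k) * g m x end)%C.

Lemma jop_mulX r s O : jop r s O -> jop r s (fun g => jmulX (O g)).
Proof.
  intros HO; split.
  - intros g Hg k x. have J := jop_jet _ _ _ HO g Hg.
    have D0 := rdiff_RtoC _ _ _ (is_derive_id x).
    have D1 := rdiff_mult _ _ x _ _ D0 (J k x).
    destruct k as [|k].
    + apply (rdiff_eq _ _ _ _ (rdiff_plus _ _ x _ _ D1 (rdiff_const 0%C x))).
      rewrite /jmulX /one /=; ring.
    + apply (rdiff_eq _ _ _ _ (rdiff_plus _ _ x _ _ D1 (rdiff_scal (RtoC (INR (S k))) _ x _ (J k x)))).
      rewrite /jmulX (S_INR (S k)) RtoC_plus /one. change (Ring.one _ _) with 1. ring.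
  - intros g c h Hg Hh [|k] x; rewrite /jmulX !(jop_lin _ _ _ HO) //; ring.
  - intros k; destruct (jop_bd_upto _ _ _ HO k) as [K1 [B1 [B10 H1]]].
    exists K1, (Rabs s * B1 + INR k * B1); split.
      have := Rabs_pos s; have := pos_INR k; nra.
    intros g Hg M HM x Hx.
    have h := H1 g Hg M HM.
    rewrite /jmulX; apply Rle_trans with (1 := Cmod_triangle _ _).
    rewrite Rmult_plus_distr_r; apply Rplus_le_compat.
    + rewrite Cmod_mult Cmod_R Rmult_assoc; apply Rmult_le_compat; [apply Rabs_pos|apply Cmod_ge_0| |].
        apply Rle_trans with (1 := Hx), Rle_abs.
      by apply h.
    + destruct k as [|k]; [rewrite Cmod_0 /=; lra|].
      rewrite Cmod_mult Cmod_R Rabs_pos_eq; [|apply pos_INR]. rewrite Rmult_assoc.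
      apply Rmult_le_compat_l; [apply pos_INR|]. apply h => //; lia.
Qed.

(** Only the component of order 0 is specified; the others, being its derivatives, are forced. *)
Lemma jop_mulX_pow r s O m : jop r s O ->
  exists P, jop r s P /\ forall g y, P g 0%nat y = (RtoC y ^ m * O g 0%nat y)%C.
Proof.
  intros HO; elim: m => [|m [P [HP E]]].
  - exists O; split => // g y; rewrite /=; ring.
  - exists (fun g => jmulX (P g)); split; [by apply jop_mulX|] => g y.
    rewrite /jmulX E /=; ring.
Qed.

Lemma jet_lipschitz g k r : jet g -> exists M, 0 <= M /\ forall x h, Rabs x <= r -> Rabs h <= 1 ->
  Cmod (g k (x + h)%R - g k x) <= M * Rabs h.
Proof.
  intros Hg. destruct (contR_bounded (g (S k)) (- r - 1) (r + 1) (jet_contR g (S k) Hg)) as [M [M0 HM]].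
  exists M; split => // x h Hx Hh.
  rewrite -(CInt_FTC (g k) (g (S k)) x (x + h)%R).
  - have E : Rabs h = Rabs (x + h - x) by f_equal; ring. rewrite E.
    apply CInt_norm_le_abs; [by apply jet_contR|] => t; rewrite /Rmin /Rmax; case: (Rle_dec _ _) => ? Ht;
    apply HM; split_Rabs; lra.
  - intros t _; apply Hg.
  - intros t _; by apply jet_contR.
Qed.

Lemma jet_taylor g k r : jet g -> exists M, 0 <= M /\ forall x h, Rabs x <= r -> Rabs h <= 1 ->
  Cmod (g k (x + h)%R - g k x - RtoC h * g (S k) x) <= M * (Rabs h * Rabs h).
Proof.
  intros Hg. destruct (jet_lipschitz g (S k) r Hg) as [M [M0 HM]].
  exists M; split => // x h Hx Hh.
  have c1 := jet_contR g (S k) Hg.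
  have E : (g k (x + h)%R - g k x - h * g (S k) x = CInt (fun t => g (S k) t - g (S k) x) x (x + h)%R)%C.
    rewrite CInt_minus ?CInt_const //; [|apply contR_const].
    rewrite (CInt_FTC (g k)); [|by intros; apply Hg|by intros; apply c1].
    have -> : x + h - x = h by ring. ring.
  rewrite E -Rmult_assoc.
  have E2 : Rabs h = Rabs (x + h - x) by f_equal; ring. rewrite {2}E2.
  apply CInt_norm_le_abs.
  - apply contR_minus => //; apply contR_const.
  - intros t Ht. have -> : t = x + (t - x) by ring.
    have ht : Rabs (t - x) <= Rabs h.
      move: Ht; rewrite /Rmin /Rmax; case: (Rle_dec _ _) => ? Ht; split_Rabs; lra.
    apply Rle_trans with (1 := HM x (t - x) Hx ltac:(lra)). by apply Rmult_le_compat_l.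
Qed.

(** * Convolutions as operators on sequences of derivatives *)

Section AffineIntegral.
Variables (W : R -> C) (al be : R -> R) (r s : R).
Hypothesis HW : contR W.
Hypothesis Cal : forall x, continuous al x.
Hypothesis Cbe : forall x, continuous be x.
Hypothesis Hal : forall w, 0 <= w <= 1 -> Rabs (al w) <= 1.
Hypothesis Hbe : forall w, 0 <= w <= 1 -> Rabs (be w) <= 1.
Hypothesis Hrs : forall w y, 0 <= w <= 1 -> Rabs y <= s -> Rabs (al w * y + be w) <= r.

(** Common form of both convolutions: [al w = w], [be w = 0] is the multiplicative one, [al w = 1],
    [be w = - w] the reflected additive one. Differentiation in y produces the powers of [al w]. *)
Definition jaffine (g : nat -> R -> C) (k : nat) (y : R) : C :=
  CInt (fun w => W w * (RtoC (al w) ^ k * g k (al w * y + be w)%R))%C 0 1.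

Lemma contR_jaffine g k m y : jet g -> contR (fun w => W w * (RtoC (al w) ^ m * g k (al w * y + be w)%R))%C.
Proof.
  intros Hg w. apply continuousC_mult; [apply HW|]. apply continuousC_mult.
  - apply continuousC_pow; by apply continuousC_RtoC.
  - apply (continuous_comp (fun w => al w * y + be w) (g k)); [|by apply jet_contR].
    apply (continuous_plus (V := R_NormedModule)) => //.
    apply (continuous_mult (K := R_AbsRing)) => //; apply continuous_const.
Qed.

Lemma jop_jaffine : jop r s jaffine.
Proof.
  destruct (contR_bounded W 0 1 HW) as [B [B0 HB]].
  have pw : forall w k, 0 <= w <= 1 -> Cmod (RtoC (al w) ^ k) <= 1.
    intros w k Hw; rewrite Cmod_pow Cmod_R. rewrite -(pow1 k). apply pow_incr; split; [apply Rabs_pos|by apply Hal].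
  split.
  - intros g Hg k y.
    destruct (jet_taylor g k (Rabs y + 1) Hg) as [M [M0 HM]].
    apply (rdiff_CInt 0 1 _ Rle_0_1 (contR_jaffine g (S k) (S k) y Hg)
      (fun y w => W w * (RtoC (al w) ^ k * g k (al w * y + be w)%R))%C y (B * M) 1 Rlt_0_1).
    + intros q _; by apply contR_jaffine.
    + intros h w Hh Hw.
      have ha := Hal w Hw. have hb := Hbe w Hw.
      set x := al w * y + be w.
      have -> : al w * (y + h) + be w = x + al w * h by rewrite /x; ring.
      have hx : Rabs x <= Rabs y + 1.
        apply Rle_trans with (1 := Rabs_triang _ _). rewrite Rabs_mult.
        have := Rabs_pos y; have := Rabs_pos (al w); nra.
      have hah : Rabs (al w * h) <= Rabs h.
        rewrite Rabs_mult; have := Rabs_pos h; have := Rabs_pos (al w); nra.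
      have T := HM x (al w * h) hx ltac:(lra).
      have -> : (W w * (RtoC (al w) ^ k * g k (x + al w * h)%R) - W w * (RtoC (al w) ^ k * g k x) -
        h * (W w * (RtoC (al w) ^ S k * g (S k) x)) =
        W w * (RtoC (al w) ^ k * (g k (x + al w * h)%R - g k x - RtoC (al w * h)%R * g (S k) x)))%C.
        rewrite Cpow_S RtoC_mult; ring.
      rewrite !Cmod_mult Rmult_assoc.
      apply Rmult_le_compat; [apply Cmod_ge_0| |by apply HB|].
        apply Rmult_le_pos; apply Cmod_ge_0.
      rewrite -[X in _ <= X]Rmult_1_l. apply Rmult_le_compat; [apply Cmod_ge_0..|by apply pw|].
      apply Rle_trans with (1 := T). apply Rmult_le_compat_l => //.
      apply Rmult_le_compat => //; apply Rabs_pos.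
  - intros g c h Hg Hh k x. rewrite /jaffine -CInt_scal; [|by apply contR_jaffine].
    rewrite -CInt_plus; [|by apply contR_jaffine|by apply contR_mult; [apply contR_const|apply contR_jaffine]].
    apply CInt_ext => w _; rewrite /jlin; ring.
  - intros k; exists k, B; split => // g Hg M HM x Hx.
    have -> : B * M = B * M * (1 - 0) by ring.
    apply CInt_norm_le; [lra|by apply contR_jaffine|].
    intros w Hw. rewrite !Cmod_mult. apply Rmult_le_compat; [apply Cmod_ge_0| |by apply HB|].
      apply Rmult_le_pos; apply Cmod_ge_0.
    rewrite -[X in _ <= X]Rmult_1_l. apply Rmult_le_compat; [apply Cmod_ge_0..|by apply pw|].
    apply HM => //. by apply Hrs.
Qed.
End AffineIntegral.

(** Carries out the induction on [jetfun] once for both convolutions, leaving only the generating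
    integrals to be treated. *)
Lemma jetfun_family r s (Fam : (nat -> R -> C) -> R -> nat -> R -> C) :
  (forall k W, contR W -> exists O, jop r s O /\
     forall g y, jet g -> O g 0%nat y = CInt (fun w => W w * Fam g y k w)%C 0 1) ->
  forall A, jetfun A -> exists O, jop r s O /\ forall g y, jet g -> O g 0%nat y = A (Fam g y).
Proof.
  intros Hint A; elim => [k W HW|A1 B1 _ [O1 [J1 E1]] _ [O2 [J2 E2]]|c A1 _ [O1 [J1 E1]]].
  - by apply Hint.
  - exists (fun g k x => O1 g k x + O2 g k x)%C; split; [by apply jop_plus|] => g y Hg; by rewrite E1 // E2.
  - exists (fun g k x => c * O1 g k x)%C; split; [by apply jop_scal|] => g y Hg; by rewrite E1.
Qed.

(** The derivatives in the inner variable of w |-> g (y w) and v |-> g (u - v), to which the inner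
    distributions are applied; the chain rule supplies y^k and (-1)^k. *)
Definition jdilate (g : nat -> R -> C) (y : R) (k : nat) (w : R) : C := (RtoC y ^ k * g k (y * w)%R)%C.
Definition jreflect (g : nat -> R -> C) (u : R) (k : nat) (v : R) : C := (RtoC (-1) ^ k * g k (u - v)%R)%C.

Lemma jet_affine g (a b : R) : jet g -> jet (fun k w => RtoC a ^ k * g k (a * w + b)%R)%C.
Proof.
  intros Hg k w.
  have D : is_derive (fun w : R => a * w + b) w a by auto_derive => //; ring.
  apply (rdiff_eq _ _ _ _ (rdiff_scal _ _ w _ (rdiff_comp_r (g k) (fun w => a * w + b) w _ _ (Hg k _) D))).
  rewrite Cpow_S; ring.
Qed.

Lemma jet_jdilate g y : jet g -> jet (jdilate g y).
Proof.
  intros Hg k w; have := jet_affine g y 0 Hg k w. rewrite /jdilate.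
  rewrite Rplus_0_r. apply rdiff_ext => v; by rewrite Rplus_0_r.
Qed.

Lemma jet_jreflect g u : jet g -> jet (jreflect g u).
Proof.
  intros Hg k w; have := jet_affine g (-1) u Hg k w. rewrite /jreflect.
  have -> : -1 * w + u = u - w by ring. apply rdiff_ext => v; by have -> : -1 * v + u = u - v by ring.
Qed.

Lemma iter_jshift k g j x : Nat.iter k jshift g j x = g (k + j)%nat x.
Proof.
  elim: k g j => [//|k IH] g j. rewrite /= {1}/jshift IH. f_equal; lia.
Qed.

Lemma jop_iter_shift r s O k : jop r s O -> jop r s (fun g => O (Nat.iter k jshift g)).
Proof.
  intros HO; elim: k => [//|k IH].
  have := jop_shift _ _ _ IH => J.
  have -> : (fun g => O (Nat.iter (S k) jshift g)) = (fun g => O (Nat.iter k jshift (jshift g))); [|done].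
  apply functional_extensionality => g; f_equal. by rewrite Nat.iter_succ_r.
Qed.

(** A generating integral of order k brings out y^k, which depends on the outer variable: the
    operator is an affine integral of the k-th derivative followed by multiplication by y^k.
    Dilation by w in [0, 1] preserves [-r, r]. *)
Lemma jop_dilate r A : jetfun A -> 0 <= r ->
  exists O, jop r r O /\ forall g y, jet g -> O g 0%nat y = A (jdilate g y).
Proof.
  intros HA r0. apply jetfun_family => // k W HW.
  have J : jop r r (jaffine W (fun w => w) (fun _ => 0)).
    apply jop_jaffine => //.
    - intros; apply continuous_id.
    - intros; apply continuous_const.
    - intros; split_Rabs; lra.
    - intros; rewrite Rabs_R0; lra.
    - intros w y Hw Hy; rewrite Rplus_0_r Rabs_mult (Rabs_pos_eq w); [|lra].
      have := Rabs_pos y; nra.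
  destruct (jop_mulX_pow _ _ _ k (jop_iter_shift _ _ _ k J)) as [P [HP E]].
  exists P; split => // g y Hg. rewrite E /jaffine -CInt_scal.
  - apply CInt_ext => w _. rewrite iter_jshift Nat.add_0_r /jdilate Rplus_0_r (Rmult_comm w) /=; ring.
  - have C1 := contR_jaffine W (fun w => w) (fun _ => 0) HW (fun _ => continuous_id _) (fun _ => continuous_const _ _) g k 0 y Hg.
    intros w; apply (continuous_ext (fun w : R => W w * (RtoC w ^ 0 * g k (w * y + 0)%R))%C); [|apply C1].
    intros v; by rewrite iter_jshift Nat.add_0_r.
Qed.

Lemma jop_reflect s A : jetfun A -> 0 <= s ->
  exists O, jop (s + 1) s O /\ forall g y, jet g -> O g 0%nat y = A (jreflect g y).
Proof.
  intros HA s0. apply jetfun_family => // k W HW.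
  have Co : forall x : R, continuous (fun w => - w) x.
    intros; apply (continuous_opp (V := R_NormedModule)), continuous_id.
  have J : jop (s + 1) s (jaffine W (fun _ => 1) (fun w => - w)).
    apply jop_jaffine => //.
    - intros; apply continuous_const.
    - intros; rewrite Rabs_R1; lra.
    - intros; split_Rabs; lra.
    - intros w y Hw Hy; split_Rabs; lra.
  exists (fun g k' x => RtoC (-1) ^ k * jaffine W (fun _ => 1) (fun w => (- w)%R) (Nat.iter k jshift g) k' x)%C.
  split; [by apply jop_scal; apply (jop_iter_shift _ _ _ k J)|] => g y Hg.
  rewrite /jaffine -CInt_scal.
  - apply CInt_ext => w _. rewrite iter_jshift Nat.add_0_r /jreflect Rmult_1_l /Rminus /=; ring.
  - have C1 := contR_jaffine W (fun _ => 1) (fun w => - w) HW (fun _ => continuous_const _ _) Co g k 0 y Hg.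
    intros w; apply (continuous_ext (fun w : R => W w * (RtoC 1 ^ 0 * g k (1 * y + - w)%R))%C); [|apply C1].
    intros v; by rewrite iter_jshift Nat.add_0_r.
Qed.

(** The radii come from the supports: the outermost functional looks at u in [0, 1], contained in
    [-1, 1]; u - v with v in [0, 1] stays in [-2, 2], and so does its product with w in [0, 1]. *)
Lemma rhs_distr_jet z z' : exists L : (nat -> R -> C) -> C,
  (forall psi g, jet g -> (forall u, g 0%nat u = psi u) -> rhs_distr z z' psi = L g) /\
  (forall g c h, jet g -> jet h -> L (jlin g c h) = (L g + c * L h)%C) /\
  (exists K B, 0 <= B /\ forall g, jet g -> forall M,
    (forall j x, (j <= K)%nat -> Rabs x <= 2 -> Cmod (g j x) <= M) -> Cmod (L g) <= B * M).
Proof.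
  set t := (z * z')%C.
  destruct (jop_dilate 2 _ (jetfun_phi_ext (RtoC 1) (t - RtoC 2))) as [O1 [J1 E1]]; [lra|].
  destruct (jop_reflect 1 _ (jetfun_phi_ext (- z') z')) as [O2 [J2 E2]]; [lra|].
  have J3 := jetfun_phi_ext z (- z).
  exists (fun g => phi_ext (O2 (O1 g)) z (- z)). split; [|split].
  - intros psi g Hg E.
    have H1 := jop_jet _ _ _ J1 g Hg. have H2 := jop_jet _ _ _ J2 _ H1.
    rewrite /rhs_distr /dmconv /dconv /phi2m -/t.
    apply phi2_jet => // u.
    rewrite E2 //. symmetry. apply phi2_jet; [by apply jet_jreflect|] => v.
    rewrite /jreflect /= Cmult_1_l E1 //. symmetry.
    apply phi2_jet; [by apply jet_jdilate|] => w.
    by rewrite /jdilate /= Cmult_1_l E.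
  - intros g c h Hg Hh.
    have j1 := fun g Hg => jop_jet _ _ _ J2 _ (jop_jet _ _ _ J1 g Hg).
    have <- := jetfun_linear _ _ c _ J3 (j1 g Hg) (j1 h Hh).
    congr (phi_ext _ z (- z)%C). apply functional_extensionality => k; apply functional_extensionality => x.
    have -> : O1 (jlin g c h) = jlin (O1 g) c (O1 h).
      apply functional_extensionality => k'; apply functional_extensionality => x'.
      by apply (jop_lin _ _ _ J1).
    by apply (jop_lin _ _ _ J2); apply (jop_jet _ _ _ J1).
  - destruct (jetfun_bounded _ J3) as [K3 [B3 [B30 H3]]].
    destruct (jop_bd_upto _ _ _ J2 K3) as [K2 [B2 [B20 H2]]].
    destruct (jop_bd_upto _ _ _ J1 K2) as [K1 [B1 [B10 H1]]].
    exists K1, (B3 * (B2 * B1)); split; [by apply Rmult_le_pos => //; apply Rmult_le_pos|].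
    intros g Hg M HM. rewrite !Rmult_assoc.
    have j1 := jop_jet _ _ _ J1 g Hg.
    apply H3; [by apply (jop_jet _ _ _ J2)|] => j x Hj Hx.
    apply H2 => //; [|split_Rabs; lra] => j' x' Hj' Hx'.
    apply H1 => //.
Qed.

(** * Density of polynomials *)

(* [bern n phi t] is the expectation of [phi] under the binomial law [B(n,t)],
   i.e. the Bernstein polynomial of [x |-> phi (n x)]. *)
Fixpoint bern (n : nat) (phi : nat -> C) (t : R) : C :=
  match n with
  | O => phi O
  | S m => (RtoC t * bern m (fun k => phi (S k)) t + RtoC (1 - t)%R * bern m phi t)%C
  end.

Fixpoint bernR (n : nat) (phi : nat -> R) (t : R) : R :=
  match n with
  | O => phi O
  | S m => t * bernR m (fun k => phi (S k)) t + (1 - t) * bernR m phi t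
  end.

Lemma bern_minus_const n phi c t : bern n (fun k => phi k - c)%C t = (bern n phi t - c)%C.
Proof.
  elim: n phi => [//|n IH] phi /=. rewrite (IH (fun k => phi (S k))) IH RtoC_minus; ring.
Qed.

Lemma bern_bound n phi psi t : 0 <= t <= 1 -> (forall k, (k <= n)%nat -> Cmod (phi k) <= psi k) ->
  Cmod (bern n phi t) <= bernR n psi t.
Proof.
  intros Ht; elim: n phi psi => [|n IH] phi psi H /=; [by apply H|].
  apply Rle_trans with (1 := Cmod_triangle _ _).
  rewrite !Cmod_mult !Cmod_R !Rabs_pos_eq; [|lra..].
  apply Rplus_le_compat; apply Rmult_le_compat_l; try lra; apply IH => k Hk; apply H; lia.
Qed.

(** Mean square of a shifted binomial variable, hence its variance. The shift [c] is free so that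
    the induction can absorb a success of the first trial. *)
Lemma bernR_quadratic n a b c t :
  bernR n (fun k => a + b * ((INR k + c) * (INR k + c))) t =
  a + b * ((INR n * t + c) * (INR n * t + c) + INR n * t * (1 - t)).
Proof.
  elim: n c => [|n IH] c; [rewrite /=; ring|].
  rewrite -[LHS]/(t * bernR n (fun k => a + b * ((INR (S k) + c) * (INR (S k) + c))) t +
    (1 - t) * bernR n (fun k => a + b * ((INR k + c) * (INR k + c))) t) IH.
  have -> : (fun k => a + b * ((INR (S k) + c) * (INR (S k) + c))) =
            (fun k => a + b * ((INR k + (1 + c)) * (INR k + (1 + c)))).
    apply functional_extensionality => k; rewrite S_INR; ring.
  rewrite IH S_INR; ring.
Qed.

(** Chebyshev's argument. The error at k is at most eps/2 + b (k - n t)^2: by uniform continuity if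
    k/n is within d of t, and otherwise because 2 M <= b (k - n t)^2. The expectation of this bound
    is explicit, and its second part is at most eps/2 for the chosen n. *)
Lemma bernstein_approx (f : R -> C) eps : contR f -> 0 < eps ->
  exists n, forall t, 0 <= t <= 1 -> Cmod (bern n (fun k => f (INR k / INR n)) t - f t) <= eps.
Proof.
  intros Hf e0. have e2 : 0 < eps / 2 by lra.
  destruct (contR_bounded f 0 1 Hf) as [M [M0 HM]].
  (* Composing with Re makes uniform continuity on an interval a case of the planar statement. *)
  have Cf : contC_all (fun z => f (Re z)).
    intros z; apply (continuous_comp Re f); [apply continuous_Re, continuous_id|apply Hf].
  destruct (contC_all_uniform _ 1 _ Cf e2) as [d [d0 Hd]].
  destruct (inv_INR_lim (eps / 2 * (d * d) / (2 * M + 1))) as [n [n0 Hn]].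
    apply Rdiv_lt_0_compat; [|lra]. apply Rmult_lt_0_compat; nra.
  have hn := Hn n (Nat.le_refl n).
  exists n => t Ht. have p0 : 0 < INR n by apply lt_0_INR.
  rewrite -bern_minus_const.
  set b := 2 * M / (d * d * (INR n * INR n)).
  have b0 : 0 <= b.
    rewrite /b; apply Rmult_le_pos; [lra|]. left; apply Rinv_0_lt_compat. apply Rmult_lt_0_compat; nra.
  apply Rle_trans with (bernR n (fun k => eps / 2 + b * ((INR k + - (INR n * t)) * (INR k + - (INR n * t)))) t).
  - apply bern_bound => // k Hk.
    have kn : INR k <= INR n by apply le_INR.
    have k0 := pos_INR k.
    have hq : 0 <= INR k / INR n <= 1.
      split; [apply Rle_div_r; lra|apply Rle_div_l; lra].
    have q0 : 0 <= (INR k + - (INR n * t)) * (INR k + - (INR n * t)) by apply Rle_0_sqr.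
    destruct (Rlt_dec (Rabs (INR k / INR n - t)) d) as [h|h].
    + have := Hd (RtoC t) (RtoC (INR k / INR n)).
      rewrite -RtoC_minus !Cmod_R Rabs_pos_eq; [|lra]. move=> /(_ ltac:(lra) h) /= H.
      have : 0 <= b * ((INR k + - (INR n * t)) * (INR k + - (INR n * t))) by apply Rmult_le_pos. lra.
    + have h1 : d * d <= (INR k / INR n - t) * (INR k / INR n - t) by split_Rabs; nra.
      have E : b * ((INR k + - (INR n * t)) * (INR k + - (INR n * t))) =
        2 * M * ((INR k / INR n - t) * (INR k / INR n - t) / (d * d)).
        rewrite /b; field; lra.
      rewrite E.
      have : 1 <= (INR k / INR n - t) * (INR k / INR n - t) / (d * d) by apply Rle_div_r; nra.
      have := Cmod_triangle_minus (f (INR k / INR n)) (f t).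
      have := HM _ hq. have := HM _ Ht. nra.
  - rewrite bernR_quadratic.
    have -> : eps / 2 + b * ((INR n * t + - (INR n * t)) * (INR n * t + - (INR n * t)) + INR n * t * (1 - t)) =
      eps / 2 + (2 * M * (t * (1 - t))) * (/ INR n) / (d * d) by rewrite /b; field; lra.
    have tt : 0 <= t * (1 - t) <= 1 by nra.
    have h1 : / INR n * (2 * M + 1) < eps / 2 * (d * d) by apply Rlt_div_r in hn; lra.
    have i0 : 0 < / INR n by apply Rinv_0_lt_compat.
    have : (2 * M * (t * (1 - t))) * (/ INR n) / (d * d) <= eps / 2; [|lra].
    apply Rle_div_l; [nra|].
    have : 2 * M * (t * (1 - t)) <= 2 * M by nra. nra.
Qed.

(** * Polynomials and their derivatives *)

Fixpoint mono (l : nat) : nat -> R -> C :=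
  match l with
  | O => fun k _ => match k with O => 1%C | S _ => 0%C end
  | S m => jmulX (mono m)
  end.

Lemma jop_id r : jop r r (fun g => g).
Proof.
  split => // k; exists k, 1; split; [lra|] => g Hg M HM x Hx. rewrite Rmult_1_l; by apply HM.
Qed.

Lemma jet_mono l : jet (mono l).
Proof.
  elim: l => [|l IH].
  - intros [|k] x; [apply (rdiff_const 1%C x)|apply (rdiff_const 0%C x)].
  - exact (jop_jet _ _ _ (jop_mulX _ _ _ (jop_id 0)) (mono l) IH).
Qed.

Lemma mono_0 l x : mono l 0%nat x = (RtoC x ^ l)%C.
Proof. elim: l => [//|l IH]. rewrite /= /jmulX IH /=; ring. Qed.

Lemma jet_unique g h : jet g -> jet h -> (forall x, g 0%nat x = h 0%nat x) -> forall k x, g k x = h k x.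
Proof.
  intros Hg Hh E; elim => [//|k IH] x.
  apply (rdiff_unique (g k) x); [apply Hg|]. apply rdiff_ext with (2 := Hh k x) => y; by rewrite IH.
Qed.

(** Only the first order is computed; a sequence of derivatives is determined by its bottom
    function, which gives the rest. The auxiliary identity is multiplied by x to avoid the exponent
    l - 1. *)
Lemma mono_derivative l k x : mono (S l) (S k) x = (RtoC (INR (S l)) * mono l k x)%C.
Proof.
  have E : forall x, (RtoC x * mono l 1%nat x = RtoC (INR l) * RtoC x ^ l)%C.
    clear k x; intros x; elim: l => [|l IH]; [rewrite /=; ring|].
    rewrite -[mono (S l) 1%nat x]/(RtoC x * mono l 1%nat x + RtoC 1 * mono l 0%nat x)%C.
    rewrite IH mono_0 S_INR RtoC_plus Cpow_S; ring.
  apply (jet_unique (jshift (mono (S l))) (fun k x => RtoC (INR (S l)) * mono l k x)%C).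
  - apply jet_shift, jet_mono.
  - intros j y; apply rdiff_scal, jet_mono.
  - intros y. rewrite -[jshift (mono (S l)) 0%nat y]/(RtoC y * mono l 1%nat y + RtoC 1 * mono l 0%nat y)%C.
    rewrite E mono_0 S_INR RtoC_plus; ring.
Qed.

Inductive polyjet : (nat -> R -> C) -> Prop :=
| polyjet_0 : polyjet (fun _ _ => 0%C)
| polyjet_add g c l : polyjet g -> polyjet (jlin g c (mono l)).

Lemma jet_polyjet p : polyjet p -> jet p.
Proof.
  elim => [k x|g c l _ IH]; [apply (rdiff_const 0%C x)|]. apply jet_jlin => //; apply jet_mono.
Qed.

Lemma polyjet_antiderivative p c0 : polyjet p ->
  exists q, polyjet q /\ (forall k x, q (S k) x = p k x) /\ q 0%nat 0 = c0.
Proof.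
  elim => [|g c l _ [q [Hq [E E0]]]].
  - exists (jlin (fun _ _ => 0%C) c0 (mono 0)); split; [by apply polyjet_add, polyjet_0|].
    split; [intros k x|]; rewrite /jlin /=; ring.
  - exists (jlin q (c / RtoC (INR (S l))) (mono (S l))); split; [by apply polyjet_add|].
    have n0 : RtoC (INR (S l)) <> 0%C by apply INR_C_neq0; lia.
    split; [intros k x|].
    + rewrite /jlin E mono_derivative. by field.
    + rewrite /jlin E0 mono_0 Cpow_S; ring.
Qed.

Definition polyfun (f : R -> C) := exists p, polyjet p /\ forall x, p 0%nat x = f x.

Lemma polyfun_add_mono f c l : polyfun f -> polyfun (fun x => f x + c * RtoC x ^ l)%C.
Proof.
  intros [p [Hp E]]; exists (jlin p c (mono l)); split; [by apply polyjet_add|] => x.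
  by rewrite /jlin E mono_0.
Qed.

Lemma polyfun_ext f g : (forall x, f x = g x) -> polyfun f -> polyfun g.
Proof. intros E [p [Hp H]]; exists p; split => // x; by rewrite -E. Qed.

Lemma polyfun_const c : polyfun (fun _ => c).
Proof.
  apply (polyfun_ext (fun x => 0 + c * RtoC x ^ 0)%C); [intros; rewrite /=; ring|].
  apply polyfun_add_mono. exists (fun _ _ => 0%C); split => //; apply polyjet_0.
Qed.

Lemma polyfun_lin f c g : polyfun f -> polyfun g -> polyfun (fun x => f x + c * g x)%C.
Proof.
  intros Hf [p [Hp E]].
  apply (polyfun_ext (fun x => f x + c * p 0%nat x)%C); [intros; by rewrite E|].
  elim: Hp => [|q d l _ IH].
  - apply (polyfun_ext f) => // x; ring.
  - apply (polyfun_ext (fun x => (f x + c * q 0%nat x) + (c * d) * RtoC x ^ l)%C).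
      intros x; rewrite /jlin mono_0; ring.
    by apply polyfun_add_mono.
Qed.

Lemma polyfun_mulX f : polyfun f -> polyfun (fun x => RtoC x * f x)%C.
Proof.
  intros [p [Hp E]].
  apply (polyfun_ext (fun x => RtoC x * p 0%nat x)%C); [intros; by rewrite E|].
  elim: Hp => [|q d l _ IH].
  - apply (polyfun_ext (fun x => 0%C)); [intros; ring|apply polyfun_const].
  - apply (polyfun_ext (fun x => RtoC x * q 0%nat x + d * RtoC x ^ (S l))%C).
      intros x; rewrite /jlin mono_0 Cpow_S; ring.
    by apply polyfun_add_mono.
Qed.

Lemma polyfun_bern n phi a b : polyfun (fun x => bern n phi (a * x + b)).
Proof.
  elim: n phi => [|n IH] phi; [apply (polyfun_const (phi 0%nat))|].
  set f := fun x => bern n (fun k => phi (S k)) (a * x + b).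
  set g := fun x => bern n phi (a * x + b).
  have Hf : polyfun f by apply IH. have Hg : polyfun g by apply IH.
  apply (polyfun_ext (fun x => ((g x + RtoC a * (RtoC x * f x)) + RtoC b * f x) + (- RtoC a) * (RtoC x * g x) + (- RtoC b) * g x)%C).
    intros x; rewrite /f /g /= RtoC_minus !RtoC_plus !RtoC_mult; ring.
  repeat (apply polyfun_lin => //); by apply polyfun_mulX.
Qed.

Lemma weierstrass (f : R -> C) eps : contR f -> 0 < eps ->
  exists p, polyjet p /\ forall x, Rabs x <= 2 -> Cmod (f x - p 0%nat x) <= eps.
Proof.
  intros Hf e0.
  have Hf' : contR (fun t => f (4 * t - 2)).
    intros t; apply (continuous_comp (fun t => 4 * t - 2) f); [|apply Hf].
    apply (continuous_minus (V := R_NormedModule)); [|apply continuous_const].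
    apply (continuous_mult (K := R_AbsRing)); [apply continuous_const|apply continuous_id].
  destruct (bernstein_approx _ eps Hf' e0) as [n Hn].
  destruct (polyfun_bern n (fun k => f (4 * (INR k / INR n) - 2)) (/ 4) (/ 2)) as [p [Hp E]].
  exists p; split => // x Hx. rewrite E Cmod_minus_sym.
  have := Hn (/ 4 * x + / 2) ltac:(split_Rabs; lra).
  by have -> : 4 * (/ 4 * x + / 2) - 2 = x by field.
Qed.

(** The K-th derivative is approximated uniformly and integrated back from 0, with the values at 0
    matched. Each integration runs over a length at most 2 and so at most doubles the error, whence
    eps/2 for the derivative. *)
Lemma polyjet_dense K g eps : jet g -> 0 < eps ->
  exists p, polyjet p /\ forall j x, (j <= K)%nat -> Rabs x <= 2 -> Cmod (g j x - p j x) <= eps.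
Proof.
  elim: K g eps => [|K IH] g eps Hg e0.
  - destruct (weierstrass (g 0%nat) eps (jet_contR g 0 Hg) e0) as [p [Hp H]].
    exists p; split => // j x Hj Hx. have -> : j = 0%nat by lia. by apply H.
  - have e2 : 0 < eps / 2 by lra.
    destruct (IH (jshift g) (eps / 2) (jet_shift g Hg) e2) as [p [Hp H]].
    destruct (polyjet_antiderivative p (g 0%nat 0) Hp) as [q [Hq [E E0]]].
    exists q; split => // [[|j]] x Hj Hx.
    + have Jq := jet_polyjet q Hq. have Jp := jet_polyjet p Hp.
      have -> : (g 0%nat x - q 0%nat x = CInt (fun t => g 1%nat t - q 1%nat t) 0 x)%C.
        rewrite CInt_minus; [|by apply jet_contR..].
        rewrite (CInt_FTC (g 0%nat)); [|by intros; apply Hg|by intros; apply jet_contR].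
        rewrite (CInt_FTC (q 0%nat)); [|by intros; apply Jq|by intros; apply jet_contR].
        rewrite E0; ring.
      apply Rle_trans with (eps / 2 * Rabs (x - 0)); [|rewrite Rminus_0_r; nra].
      apply CInt_norm_le_abs; [by apply contR_minus; apply jet_contR|].
      intros t Ht; rewrite E; apply (H 0%nat); [lia|].
      move: Ht; rewrite /Rmin /Rmax; case: (Rle_dec _ _) => ? Ht; split_Rabs; lra.
    + rewrite E. apply Rle_trans with (eps / 2); [|lra]. apply (H j) => //; lia.
Qed.

Lemma jet_functional_ext (D : (nat -> R -> C) -> C) :
  (forall g c h, jet g -> jet h -> D (jlin g c h) = (D g + c * D h)%C) ->
  (exists K B, 0 <= B /\ forall g, jet g -> forall M,
    (forall j x, (j <= K)%nat -> Rabs x <= 2 -> Cmod (g j x) <= M) -> Cmod (D g) <= B * M) ->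
  (forall l, D (mono l) = 0%C) -> forall g, jet g -> D g = 0%C.
Proof.
  intros Hlin [K [B [B0 HB]]] Hmono g Hg.
  have D0 : D (fun _ _ => 0%C) = 0%C.
    have J : jet (fun _ _ => 0%C) by apply jet_polyjet, polyjet_0.
    have := Hlin _ 1%C _ J J.
    have -> : jlin (fun _ _ => 0%C) 1 (fun _ _ => 0%C) = (fun _ _ => 0%C).
      apply functional_extensionality => k; apply functional_extensionality => x; rewrite /jlin; ring.
    intros E. set d := D _ in E *. have -> : d = (d + 1 * d - d)%C by ring. rewrite -E; ring.
  have Dp : forall p, polyjet p -> D p = 0%C.
    intros p; elim => [//|q c l Hq IH]. rewrite Hlin ?IH ?Hmono; [ring|by apply jet_polyjet|apply jet_mono].
  apply (C_eq_of_Cmod_small _ _ B) => e e0.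
  destruct (polyjet_dense K g e Hg e0) as [p [Hp H]].
  have Jp := jet_polyjet p Hp.
  have -> : (D g - 0 = D (jlin g (-(1)) p))%C by rewrite Hlin // (Dp p Hp); ring.
  apply HB; [by apply jet_jlin|] => j x Hj Hx.
  have -> : jlin g (- (1)) p j x = (g j x - p j x)%C by rewrite /jlin; ring. by apply H.
Qed.

(** * Moments *)

Definition csum (f : nat -> C) (n : nat) : C := sum_n (G := C_AbelianMonoid) f n.

Lemma csum_S f n : csum f (S n) = (csum f n + f (S n))%C.
Proof. by rewrite /csum sum_Sn. Qed.

Lemma csum_0 f : csum f 0%nat = f 0%nat.
Proof. by rewrite /csum sum_O. Qed.

Lemma csum_ext f g n : (forall k, (k <= n)%nat -> f k = g k) -> csum f n = csum g n.
Proof. apply sum_n_ext_loc. Qed.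

Lemma csum_plus f g n : csum (fun k => f k + g k)%C n = (csum f n + csum g n)%C.
Proof. exact (sum_n_plus (G := C_AbelianMonoid) f g n). Qed.

Lemma csum_scal c f n : csum (fun k => c * f k)%C n = (c * csum f n)%C.
Proof. elim: n => [|n IH]; [by rewrite !csum_0|rewrite !csum_S IH; ring]. Qed.

Lemma csum_first f n : csum f (S n) = (f 0%nat + csum (fun k => f (S k)) n)%C.
Proof.
  elim: n => [|n IH]; [by rewrite csum_S !csum_0|]. rewrite csum_S IH csum_S; ring.
Qed.

Lemma csum_triangle (f : nat -> nat -> C) l :
  csum (fun p => csum (fun r => f p r) (l - p)) l = csum (fun k => csum (fun p => f p (k - p)%nat) k) l.
Proof.
  elim: l => [|l IH]; [by rewrite !csum_0|].
  rewrite csum_S (csum_S (fun k => csum (fun p => f p (k - p)%nat) k)) -IH csum_S.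
  rewrite Nat.sub_diag csum_0.
  rewrite (csum_ext _ (fun p => csum (fun r => f p r) (l - p) + f p (S l - p)%nat)%C); last first.
    intros k Hk. have -> : (S l - k = S (l - k))%nat by lia. by rewrite csum_S.
  rewrite csum_plus; ring.
Qed.

(* Both [a_p = (x)_p / p!] (with [la = 1]) and [a_p = x^p / p!] (with [la = 0])
   obey this recursion: Vandermonde's identity and the binomial theorem at once. *)
Lemma conv_recursion (a b : nat -> C) (x y la : C) :
  (forall p, RtoC (INR (S p)) * a (S p) = (x + la * RtoC (INR p)) * a p)%C ->
  (forall p, RtoC (INR (S p)) * b (S p) = (y + la * RtoC (INR p)) * b p)%C ->
  forall k, (RtoC (INR (S k)) * csum (fun p => a p * b (S k - p)%nat) (S k) =
    (x + y + la * RtoC (INR k)) * csum (fun p => a p * b (k - p)%nat) k)%C.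
Proof.
  intros Ha Hb k.
  have E1 : csum (fun p => RtoC (INR p) * (a p * b (S k - p)%nat))%C (S k) =
     csum (fun p => (x + la * RtoC (INR p)) * (a p * b (k - p)%nat))%C k.
    rewrite csum_first /= !Cmult_0_l Cplus_0_l. apply csum_ext => p Hp.
    rewrite Cmult_assoc -/(INR (S p)) Ha; ring.
  have E2 : csum (fun p => RtoC (INR (S k - p)) * (a p * b (S k - p)%nat))%C (S k) =
     csum (fun p => (y + la * RtoC (INR (k - p))) * (a p * b (k - p)%nat))%C k.
    rewrite csum_S Nat.sub_diag !Cmult_0_l Cplus_0_r. apply csum_ext => p Hp.
    have -> : (S k - p = S (k - p))%nat by lia.
    have -> : (INR (S (k - p)) * (a p * b (S (k - p))) = a p * (INR (S (k - p)) * b (S (k - p))))%C by ring.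
    rewrite Hb; ring.
  rewrite -!csum_scal.
  rewrite (csum_ext _ (fun p => RtoC (INR p) * (a p * b (S k - p)%nat) + RtoC (INR (S k - p)) * (a p * b (S k - p)%nat))%C); last first.
    intros p Hp. rewrite -Cmult_plus_distr_r -RtoC_plus -plus_INR. by have -> : (p + (S k - p) = S k)%nat by lia.
  rewrite csum_plus E1 E2 -csum_plus. apply csum_ext => p Hp.
  have -> : RtoC (INR k) = (RtoC (INR p) + RtoC (INR (k - p)))%C.
    rewrite -RtoC_plus -plus_INR. by have -> : (p + (k - p) = k)%nat by lia.
  ring.
Qed.

(** * Factorials and Pochhammer symbols *)

Definition cfact (n : nat) : C := RtoC (INR (fact n)).

Lemma cfact_S n : cfact (S n) = (RtoC (INR (S n)) * cfact n)%C.
Proof. rewrite /cfact -RtoC_mult -mult_INR //. Qed.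

Lemma cfact_0 : cfact 0 = 1%C.
Proof. by []. Qed.

Lemma poch_S a n : poch a (S n) = (poch a n * (a + RtoC (INR n)))%C.
Proof. by []. Qed.

Lemma cfact_neq0 n : cfact n <> 0%C.
Proof. apply fact_C_neq0. Qed.

Lemma INRS_neq0 n : RtoC (INR (S n)) <> 0%C.
Proof. apply INR_C_neq0; lia. Qed.

Lemma vandermonde x y k :
  csum (fun p => poch x p / cfact p * (poch y (k - p) / cfact (k - p)))%C k = (poch (x + y) k / cfact k)%C.
Proof.
  have H : forall x p, (RtoC (INR (S p)) * (poch x (S p) / cfact (S p)) = (x + 1 * RtoC (INR p)) * (poch x p / cfact p))%C.
    intros x' p; rewrite cfact_S poch_S; field; split; [apply cfact_neq0|apply INRS_neq0].
  elim: k => [|k IH]; [rewrite csum_0 /= cfact_0; field; apply C1_nz|].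
  have E := conv_recursion _ _ x y 1 (H x) (H y) k. rewrite IH -H in E.
  have n0 := INRS_neq0 k.
  set s := csum _ (S k) in E *. have -> : (s = / INR (S k) * (INR (S k) * s))%C by field.
  rewrite E. by field; split; [apply cfact_neq0|].
Qed.

Lemma binomial_C x y k :
  ((x + y) ^ k = csum (fun p => cfact k / (cfact p * cfact (k - p)) * (x ^ (k - p) * y ^ p)) k)%C.
Proof.
  have H : forall x p, (RtoC (INR (S p)) * (x ^ (S p) / cfact (S p)) = (x + 0 * RtoC (INR p)) * (x ^ p / cfact p))%C.
    intros x' p; rewrite cfact_S Cpow_S; field; split; [apply cfact_neq0|apply INRS_neq0].
  have E : csum (fun p => y ^ p / cfact p * (x ^ (k - p) / cfact (k - p)))%C k = ((y + x) ^ k / cfact k)%C.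
    elim: k => [|k IH]; [rewrite csum_0 /= cfact_0; field; apply C1_nz|].
    have E := conv_recursion _ _ y x 0 (H y) (H x) k. rewrite IH -H in E.
    have n0 := INRS_neq0 k.
    set s := csum _ (S k) in E *. have -> : (s = / INR (S k) * (INR (S k) * s))%C by field.
    rewrite E. by field; split; [apply cfact_neq0|].
  have n0 := cfact_neq0 k.
  have -> : ((x + y) ^ k = cfact k * ((y + x) ^ k / cfact k))%C by rewrite (Cplus_comm x y); field.
  rewrite -E -csum_scal. apply csum_ext => p _; field; split; apply cfact_neq0.
Qed.

Lemma poch_add a m n : poch a (m + n) = (poch a m * poch (a + RtoC (INR m)) n)%C.
Proof.
  elim: n => [|n IH]; [rewrite Nat.add_0_r /=; ring|].
  rewrite Nat.add_succ_r !poch_S IH plus_INR RtoC_plus; ring.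
Qed.

Lemma poch_INR m n : (poch (RtoC (INR (S m))) n * cfact m = cfact (m + n))%C.
Proof.
  elim: n => [|n IH]; [rewrite Nat.add_0_r /=; ring|].
  rewrite Nat.add_succ_r cfact_S -IH poch_S !S_INR plus_INR !RtoC_plus; ring.
Qed.

Lemma poch_reverse w m : poch w m = (RtoC (-1) ^ m * poch (1 - w - RtoC (INR m)) m)%C.
Proof.
  elim: m w => [|m IH] w; [rewrite /=; ring|].
  rewrite poch_shift IH -[poch (1 - w - INR (S m)) (S m)]/(poch (1 - w - INR (S m)) m * (1 - w - INR (S m) + INR m))%C.
  rewrite S_INR RtoC_plus Cpow_S.
  have -> : (1 - (w + 1) - INR m = 1 - w - (INR m + 1))%C by ring. ring.
Qed.

Lemma sign_sq m : (RtoC (-1) ^ m * RtoC (-1) ^ m = 1)%C.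
Proof. rewrite -Cpow_mult_l. have -> : (RtoC (-1) * RtoC (-1) = 1)%C by rewrite -RtoC_mult; f_equal; ring. apply Cpow_1_l. Qed.

(** Vandermonde's identity for the sum of y and 1 - x - y - q, read through [poch_reverse]: reversal
    gives all the factors (x+y+r)_(q-r) the same base. *)
Lemma poch_expansion x y q :
  (poch x q / cfact q = csum (fun r => RtoC (-1) ^ r * (poch y r / cfact r) *
     (poch (x + y + RtoC (INR r)) (q - r) / cfact (q - r))) q)%C.
Proof.
  rewrite (csum_ext _ (fun r => RtoC (-1) ^ q * (poch y r / cfact r * (poch (1 - x - y - RtoC (INR q)) (q - r) / cfact (q - r))))%C).
  - rewrite csum_scal vandermonde.
    have -> : (y + (1 - x - y - INR q) = 1 - x - INR q)%C by ring.
    rewrite (poch_reverse x q) /Cdiv; ring.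
  - intros r Hr. rewrite (poch_reverse (x + y + INR r) (q - r)).
    have -> : (1 - (x + y + INR r) - INR (q - r) = 1 - x - y - INR q)%C.
      have -> : INR q = INR r + INR (q - r) by rewrite -plus_INR; f_equal; lia.
      rewrite RtoC_plus; ring.
    have -> : (RtoC (-1) ^ q = RtoC (-1) ^ r * RtoC (-1) ^ (q - r))%C.
      rewrite -Cpow_add_r; f_equal; lia.
    rewrite /Cdiv; ring.
Qed.

(* A terminating 3F2 transformation: expand [(1-z)_q] by [poch_expansion],
   interchange the sums, and sum the inner one by Vandermonde. *)
Lemma moment_identity z z' l :
  csum (fun p => let q := (l - p)%nat in
    RtoC (-1) ^ q * (poch (z + 1) p * poch (1 - z) q * poch (z' + 1) p * poch (1 - z') q) / (cfact p * cfact q))%C l =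
  (cfact (S l) * cfact (S l) * csum (fun k => let m := (l - k)%nat in
    RtoC (-1) ^ m * (poch (z + 1) k * poch (1 - z') m) / (cfact k * cfact m * cfact (S k) * cfact (S m))) l)%C.
Proof.
  pose f p r := (RtoC (-1) ^ (l - p) * RtoC (-1) ^ r * (poch (z + 1) (p + r) * poch (z' + 1) p * poch (1 - z') (l - p)) *
    cfact (S l) / (cfact p * cfact r * cfact (l - p - r) * cfact (S (p + r))))%C.
  transitivity (csum (fun p => csum (fun r => f p r) (l - p)) l).
  - apply csum_ext => p Hp. set q := (l - p)%nat. cbv zeta.
    (* With y = z + 1 + p the base x + y + r is the integer p + r + 2, so its Pochhammer symbol is a
       quotient of factorials; moreover (z+1)_p (y)_r merges into (z+1)_(p+r). *)
    have E := poch_expansion (1 - z) (z + 1 + RtoC (INR p)) q.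
    have -> : (RtoC (-1) ^ q * (poch (z + 1) p * poch (1 - z) q * poch (z' + 1) p * poch (1 - z') q) / (cfact p * cfact q) =
      (RtoC (-1) ^ q * poch (z + 1) p * poch (z' + 1) p * poch (1 - z') q / cfact p) * (poch (1 - z) q / cfact q))%C.
      field; split; apply cfact_neq0.
    rewrite E -csum_scal. apply csum_ext => r Hr. rewrite /f -/q.
    rewrite (poch_add (z + 1) p r).
    have -> : (1 - z + (z + 1 + INR p) + INR r = RtoC (INR (S (S (p + r)))))%C.
      rewrite !S_INR plus_INR !RtoC_plus; ring.
    have := poch_INR (S (p + r)) (q - r).
    have -> : (S (p + r) + (q - r) = S l)%nat by rewrite /q; lia.
    intros <-. field; repeat split; apply cfact_neq0.
  - rewrite csum_triangle -csum_scal. apply csum_ext => k Hk. set m := (l - k)%nat. cbv zeta.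
    (* In the sum of the two parameters z' cancels and leaves the integer m + 2, so the inner sum is
       again a quotient of factorials. *)
    have V := vandermonde (z' + 1) (1 - z' + RtoC (INR m)) k.
    have e2 : (z' + 1 + (1 - z' + INR m) = RtoC (INR (S (S m))))%C.
      rewrite !S_INR !RtoC_plus; ring.
    rewrite e2 in V. have P := poch_INR (S m) k.
    have lk : (S m + k = S l)%nat by rewrite /m; lia. rewrite lk in P.
    transitivity ((RtoC (-1) ^ m * poch (z + 1) k * poch (1 - z') m * cfact (S l) / (cfact m * cfact (S k))) *
      (poch (RtoC (INR (S (S m)))) k / cfact k))%C; last first.
      rewrite -P; field; repeat split; apply cfact_neq0.
    rewrite -V -csum_scal. apply csum_ext => p Hp. rewrite /f.
    have -> : (p + (k - p) = k)%nat by lia. have -> : (l - p - (k - p) = m)%nat by rewrite /m; lia.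
    have -> : (l - p = m + (k - p))%nat by rewrite /m; lia.
    rewrite poch_add Cpow_add_r.
    have S := sign_sq (k - p).
    set s := (RtoC (-1) ^ (k - p))%C in S *. set s' := (RtoC (-1) ^ m)%C.
    have -> : (s' * s * s = s')%C by rewrite -Cmult_assoc S; ring.
    field; repeat split; apply cfact_neq0.
Qed.

(** Linearity is not visible in the definition of [phi2]; it comes from [phi_ext], evaluated at a
    single sequence of derivatives built term by term. *)
Lemma phi2_sum a b (c : nat -> C) (e : nat -> nat) N :
  phi2 a b (fun u => csum (fun i => c i * RtoC u ^ e i)%C N) = csum (fun i => c i * phi2 a b (fun u => RtoC u ^ e i))%C N.
Proof.
  have Hm : forall i, phi2 a b (fun u => RtoC u ^ e i)%C = phi_ext (mono (e i)) a b.
    intros i; apply phi2_jet; [apply jet_mono|apply mono_0].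
  have HL := jetfun_phi_ext a b.
  have [g [Hg [E1 E2]]] : exists g, jet g /\ (forall u, g 0%nat u = csum (fun i => c i * RtoC u ^ e i)%C N) /\
     phi_ext g a b = csum (fun i => c i * phi_ext (mono (e i)) a b)%C N.
    elim: N => [|N [g [Hg [E1 E2]]]].
    - exists (jlin (fun _ _ => 0%C) (c 0%nat) (mono (e 0%nat))).
      have J0 : jet (fun _ _ => 0%C) by apply jet_polyjet, polyjet_0.
      split; [by apply jet_jlin => //; apply jet_mono|split].
      + intros u; rewrite csum_0 /jlin mono_0; ring.
      + rewrite csum_0 (jetfun_linear _ _ (c 0%nat) _ HL J0 (jet_mono _)).
        have := jetfun_linear _ _ 1%C _ HL J0 J0.
        have -> : jlin (fun _ _ => 0%C) 1 (fun _ _ => 0%C) = (fun _ _ => 0%C).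
          apply functional_extensionality => k; apply functional_extensionality => x; rewrite /jlin; ring.
        intros E. set d := phi_ext (fun _ _ => 0%C) a b in E *.
        have -> : d = 0%C by have -> : d = (d + 1 * d - d)%C; [ring|rewrite -E; ring]. ring.
    - exists (jlin g (c (S N)) (mono (e (S N)))).
      split; [by apply jet_jlin => //; apply jet_mono|split].
      + intros u; by rewrite csum_S /jlin mono_0 E1.
      + by rewrite csum_S (jetfun_linear _ _ (c (S N)) _ HL Hg (jet_mono _)) E2.
  rewrite (phi2_jet g) // E2. apply csum_ext => i _; by rewrite Hm.
Qed.

Lemma phi2_pow_scal a b c l : phi2 a b (fun u => c * RtoC u ^ l)%C = (c * phi2 a b (fun u => RtoC u ^ l))%C.
Proof.
  have := phi2_sum a b (fun _ => c) (fun _ => l) 0. rewrite csum_0.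
  have -> : (fun u => csum (fun _ => c * RtoC u ^ l)%C 0) = (fun u => c * RtoC u ^ l)%C.
    apply functional_extensionality => u; by rewrite csum_0.
  done.
Qed.

Lemma phi2_moment_anti a l : phi2 a (- a) (fun u => RtoC u ^ l)%C = (poch (a + 1) l / cfact (S l))%C.
Proof.
  rewrite phi2_moment.
  have -> : (a + - a + INR l + 2 = RtoC (INR (S (S l))))%C by rewrite !S_INR !RtoC_plus; ring.
  by rewrite rgamma_nat.
Qed.

Lemma rhs_distr_pow z z' l :
  rhs_distr z z' (fun x => RtoC x ^ l)%C =
  (cfact (S l) * rgamma (z * z' + 1 + RtoC (INR l)) *
   csum (fun k => let m := (l - k)%nat in
    cfact l * (RtoC (-1) ^ m * (poch (z + 1) k * poch (1 - z') m)) / (cfact k * cfact m * cfact (S k) * cfact (S m))) l)%C.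
Proof.
  set t := (z * z')%C.
  (* The l-th moment of phi_{1,t-2}, that is (2)_l / Gamma (t + 1 + l), where (2)_l = (l + 1)!. *)
  pose M := (poch (1 + 1) l * rgamma (t + 1 + RtoC (INR l)))%C.
  have E1 : forall y : R, phi2 (RtoC 1) (t - RtoC 2) (fun w => RtoC (y * w)%R ^ l)%C = (M * RtoC y ^ l)%C.
    intros y.
    have -> : (fun w => RtoC (y * w)%R ^ l)%C = (fun w => RtoC y ^ l * RtoC w ^ l)%C.
      apply functional_extensionality => w; by rewrite RtoC_mult Cpow_mult_l.
    rewrite phi2_pow_scal phi2_moment.
    have -> : (1 + (t - 2) + INR l + 2 = t + 1 + INR l)%C by ring. rewrite /M; ring.
  have E2 : forall u : R, phi2 (- z') z' (fun v => M * RtoC (u + - v)%R ^ l)%C =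
    csum (fun k => (M * (cfact l / (cfact (l - k) * cfact k)) * (RtoC (-1) ^ (l - k) * (poch (1 - z') (l - k) / cfact (S (l - k))))) * RtoC u ^ k)%C l.
    intros u.
    have -> : (fun v => M * RtoC (u + - v)%R ^ l)%C =
      (fun v => csum (fun p => (M * (cfact l / (cfact (l - p) * cfact p)) * (RtoC (-1) ^ (l - p) * RtoC u ^ p)) * RtoC v ^ (l - p)) l)%C.
      apply functional_extensionality => v.
      have -> : (RtoC (u + - v)%R = RtoC (-1) * RtoC v + RtoC u)%C by rewrite -RtoC_mult -RtoC_plus; f_equal; ring.
      rewrite binomial_C -csum_scal. apply csum_ext => p Hp. rewrite Cpow_mult_l.
      rewrite /Cdiv (Cmult_comm (cfact p)); ring.
    rewrite (phi2_sum _ _ _ (fun p => (l - p)%nat)). apply csum_ext => k Hk.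
    have := phi2_moment_anti (- z') (l - k). have -> : (- - z' = z')%C by ring. intros ->.
    have -> : (- z' + 1 = 1 - z')%C by ring. ring.
  rewrite /rhs_distr /dmconv /dconv /phi2m -/t.
  have -> : (fun y1 : R => phi2 (- z') z' (fun u : R => phi2 1 (t - 2) (fun y2 : R => RtoC ((y1 + - u) * y2)%R ^ l)))%C =
    (fun u => csum (fun k => (M * (cfact l / (cfact (l - k) * cfact k)) * (RtoC (-1) ^ (l - k) * (poch (1 - z') (l - k) / cfact (S (l - k))))) * RtoC u ^ k)%C l).
    apply functional_extensionality => u. rewrite -E2. f_equal.
    apply functional_extensionality => v. by rewrite E1.
  rewrite (phi2_sum _ _ _ (fun k => k)) -csum_scal. apply csum_ext => k Hk. cbv zeta.
  rewrite phi2_moment_anti /M.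
  have -> : poch (1 + 1) l = cfact (S l).
    have := poch_INR 1 l. rewrite /= /cfact /=. have -> : (RtoC (1 + 1)%R = 1 + 1)%C by rewrite RtoC_plus.
    rewrite Cmult_1_r. by move=> ->.
  field; repeat split; apply cfact_neq0.
Qed.

(** As p + q = l, the factors (t)_(l+1) and l + 1 come out of the sum. The numerator t cancels
    against (t)_(l+1) = t (t+1)_l, and Gamma (t+1) / Gamma (t+1+l) is 1 / (t+1)_l; what remains is
    [moment_identity]. *)
Lemma sigma1_moment_rhs z z' l : 0 < Re (z * z') ->
  sigma1_moment z z' l = (cgamma (z * z' + 1) * rhs_distr z z' (fun x => RtoC x ^ l))%C.
Proof.
  intros Ht. set t := (z * z')%C in Ht *.
  have Ht1 : 0 < Re (t + 1) by rewrite Re_plus1; lra.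
  have g0 := rgamma_neq0_Re (t + 1) Ht1.
  have p0 := poch_neq0 (t + 1) Ht1 l.
  have t0 : t <> 0%C by intros E; rewrite E /= in Ht; lra.
  have G := rgamma_poch (t + 1) l.
  have r0 : rgamma (t + 1 + INR l) <> 0%C by intros E; apply g0; rewrite G E; ring.
  rewrite rhs_distr_pow -/t /cgamma G.
  have I := moment_identity z z' l.
  set R1 := csum (fun k => _) l in I.
  transitivity (csum (fun p => let q := (l - p)%nat in
    RtoC (-1) ^ q * (poch (z + 1) p * poch (1 - z) q * poch (z' + 1) p * poch (1 - z') q) / (cfact p * cfact q))%C l / (poch (t + 1) l * RtoC (INR (S l))))%C.
  - rewrite /sigma1_moment -/t -/(csum _ _) {2}/Cdiv Cmult_comm -csum_scal. apply csum_ext => p Hp. cbv zeta.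
    have -> : (p + (l - p) + 1 = S l)%nat by lia.
    rewrite poch_shift RtoC_pow.
    have -> : (- z + 1 = 1 - z)%C by ring. have -> : (- z' + 1 = 1 - z')%C by ring.
    rewrite -/(cfact p) -/(cfact (l - p)).
    field; repeat split; try apply cfact_neq0; try apply INRS_neq0; done.
  - have -> : csum (fun p => let q := (l - p)%nat in
    RtoC (-1) ^ q * (poch (z + 1) p * poch (1 - z) q * poch (z' + 1) p * poch (1 - z') q) / (cfact p * cfact q))%C l = _ := I.
    rewrite (csum_ext (fun k => let m := (l - k)%nat in cfact l * _ / _)%C (fun k => cfact l * (let m := (l - k)%nat in
    RtoC (-1) ^ m * (poch (z + 1) k * poch (1 - z') m) / (cfact k * cfact m * cfact (S k) * cfact (S m))))%C); last first.
      intros k _; cbv zeta; rewrite /Cdiv; ring.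
    rewrite csum_scal. set Y := csum _ l.
    rewrite !cfact_S. field; repeat split; try apply cfact_neq0; try apply INRS_neq0; done.
Qed.

(** * Reduction to moments *)

(** In the conjugate case t = |z|^2 and z is not the integer 0. In the real case the open interval
    between consecutive integers avoids 0, so z and z' have the same sign. *)
Lemma admissible_pos z z' : admissible z z' -> 0 < Re (z * z').
Proof.
  intros [[-> Hz]|[Hi [Hi' [m [H1 H2]]]]].
  - have E : Re (z * (Re z, (- Im z)%R)) = Re z * Re z + Im z * Im z by rewrite /Re /Im /=; ring.
    rewrite E. destruct (Req_dec (Re z) 0) as [hr|hr]; [|nra].
    destruct (Req_dec (Im z) 0) as [hi|hi]; [|nra].
    exfalso; apply Hz; exists 0%Z. by apply injective_projections.
  - have -> : Re (z * z') = Re z * Re z'.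
      change (Re z * Re z' - Im z * Im z' = Re z * Re z'); rewrite Hi; ring.
    destruct (Z_lt_le_dec m 0) as [h|h].
    + have : IZR m + 1 <= 0 by rewrite -plus_IZR; apply IZR_le; lia. nra.
    + have : 0 <= IZR m by apply IZR_le. nra.
Qed.

(** The measure enters only as a functional [P]: linear on continuous functions, bounded by the
    supremum over [-1, 1], and with the prescribed moments. *)
Lemma moment_representation (P : (R -> C) -> C) z z' : admissible z z' ->
  (forall f c h, contR f -> contR h -> P (fun x => f x + c * h x)%C = (P f + c * P h)%C) ->
  (exists B, 0 <= B /\ forall f M, contR f -> (forall x, Rabs x <= 1 -> Cmod (f x) <= M) -> Cmod (P f) <= B * M) ->
  (forall l, P (fun x => RtoC x ^ l)%C = sigma1_moment z z' l) ->
  forall psi g, jet g -> (forall u, g 0%nat u = psi u) ->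
  P psi = (cgamma (z * z' + 1) * rhs_distr z z' psi)%C.
Proof.
  intros Hadm Hlin [B [B0 HB]] Hmom psi g Hg Epsi.
  have Ht := admissible_pos z z' Hadm.
  destruct (rhs_distr_jet z z') as [L [L1 [L2 [K [BL [BL0 L3]]]]]].
  set G := cgamma (z * z' + 1).
  have H := jet_functional_ext (fun g => P (g 0%nat) - G * L g)%C.
  have Z : (P (g 0%nat) - G * L g = 0)%C.
    apply H => //.
    - intros g1 c h Hg1 Hh; rewrite L2 //.
      have := Hlin (g1 0%nat) c (h 0%nat) (jet_contR _ _ Hg1) (jet_contR _ _ Hh).
      rewrite /jlin => ->; ring.
    - exists K, (B + Cmod G * BL); split; [have := Cmod_ge_0 G; nra|] => g1 Hg1 M HM.
      apply Rle_trans with (1 := Cmod_triangle_minus _ _). rewrite Cmod_mult Rmult_plus_distr_r Rmult_assoc.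
      apply Rplus_le_compat; [|apply Rmult_le_compat_l; [apply Cmod_ge_0|by apply L3]].
      apply HB; [by apply jet_contR|] => x Hx; apply HM; [lia|lra].
    - intros l. rewrite -(L1 (fun x => RtoC x ^ l)%C); [|apply jet_mono|apply mono_0].
      have -> : mono l 0%nat = (fun x => RtoC x ^ l)%C by apply functional_extensionality => x; apply mono_0.
      rewrite Hmom (sigma1_moment_rhs z z' l Ht) -/G; ring.
  rewrite (L1 psi g Hg Epsi).
  have -> : psi = g 0%nat by apply functional_extensionality => u.
  by apply Ceq_minus.
Qed.

(** * Division by the absolute value *)

Lemma rdiff_inv_pow m x : x <> 0 -> rdiff (fun y => RtoC ((/ y) ^ m)) x (RtoC (- INR m * (/ x) ^ S m)).
Proof.
  intros x0. apply rdiff_RtoC.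
  elim: m => [|m IH].
  - have -> : - INR 0 * (/ x) ^ 1 = 0 by rewrite /=; ring. exact (is_derive_const (K := R_AbsRing) (V := R_NormedModule) 1 x).
  - have D : is_derive (fun y => / y) x (- / (x * x)).
      auto_derive => //; field => //.
    have := is_derive_mult (fun y => / y) (fun y => (/ y) ^ m) x _ _ D IH Rmult_comm.
    have -> : plus (mult (- / (x * x)) ((/ x) ^ m)) (mult (/ x) (- INR m * (/ x) ^ S m)) = - INR (S m) * (/ x) ^ S (S m); [|done].
    rewrite S_INR /plus /mult /= !pow_inv; field; split => //; by apply pow_nonzero.
Qed.

Section DivAbs.
Variables (g : nat -> R -> C) (d : R).
Hypothesis Hg : jet g.
Hypothesis d0 : 0 < d.
Hypothesis Hv : forall x, Rabs x < d -> g 0%nat x = 0%C.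

Lemma jet_vanishes k x : Rabs x < d -> g k x = 0%C.
Proof.
  elim: k x => [|k IH] x Hx; [by apply Hv|].
  apply (rdiff_unique (g k) x); [apply Hg|].
  apply (rdiff_ext_loc (fun _ => 0%C)); [|apply rdiff_const].
  apply locally_R; exists (d - Rabs x); split; [lra|] => y Hy. symmetry; apply IH. split_Rabs; lra.
Qed.

Definition div_pow (m k : nat) (x : R) : C := (RtoC (/ Rabs x * (/ x) ^ m) * g k x)%C.

(** The family of the functions g_k / (|x| x^m) is closed under differentiation. Within distance d
    of 0 everything vanishes identically; elsewhere 1/|x| is locally a constant sign times 1/x, so
    the power to differentiate is m + 1. *)
Lemma rdiff_div_pow m k x :
  rdiff (div_pow m k) x (RtoC (- INR (S m)) * div_pow (S m) k x + div_pow m (S k) x)%C.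
Proof.
  destruct (Rlt_dec (Rabs x) d) as [h|h].
  - apply (rdiff_ext_loc (fun _ => 0%C)).
      apply locally_R; exists (d - Rabs x); split; [lra|] => y Hy.
      rewrite /div_pow jet_vanishes; [ring|split_Rabs; lra].
    apply (rdiff_eq _ _ _ _ (rdiff_const 0%C x)). rewrite /div_pow !jet_vanishes //; ring.
  - have x0 : x <> 0 by intros E; apply h; rewrite E Rabs_R0.
    have [s Hs] : exists s, locally x (fun y => / Rabs y = s * / y).
      destruct (Rlt_dec 0 x) as [hx|hx].
      - exists 1. apply locally_R; exists x; split => // y Hy.
        rewrite Rabs_pos_eq; [ring|split_Rabs; lra].
      - exists (-1). apply locally_R; exists (- x); split; [lra|] => y Hy.
        rewrite Rabs_left; [field; split_Rabs; lra|split_Rabs; lra].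
    have Hx := locally_singleton _ _ Hs. simpl in Hx.
    apply (rdiff_ext_loc (fun y => RtoC s * (RtoC ((/ y) ^ S m) * g k y))%C).
      apply: filter_imp Hs => y Hy. rewrite /div_pow Hy /= !RtoC_mult; ring.
    apply (rdiff_eq _ _ _ _ (rdiff_scal (RtoC s) _ x _ (rdiff_mult _ _ x _ _ (rdiff_inv_pow (S m) x x0) (Hg k x)))).
    rewrite /div_pow Hx RtoC_mult. simpl pow. rewrite !RtoC_mult; ring.
Qed.

(* [div_jet n m k] is the n-th derivative of [g k x / (|x| x^m)]. *)
Fixpoint div_jet (n m k : nat) : R -> C :=
  match n with
  | O => div_pow m k
  | S n' => fun x => (RtoC (- INR (S m)) * div_jet n' (S m) k x + div_jet n' m (S k) x)%C
  end.

Lemma jet_div_jet : jet (fun n => div_jet n 0 0).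
Proof.
  have H : forall n m k x, rdiff (div_jet n m k) x (div_jet (S n) m k x).
    elim => [|n IH] m k x; [apply rdiff_div_pow|].
    apply rdiff_plus; [apply rdiff_scal, IH|apply IH].
  intros n x; apply H.
Qed.

Lemma div_jet_0 x : div_jet 0 0 0 x = div_abs (g 0%nat) x.
Proof.
  rewrite /= /div_pow /div_abs /= Rmult_1_r.
  destruct (Req_EM_T x 0) as [->|n] => //. rewrite Hv; [ring|by rewrite Rabs_R0].
Qed.
End DivAbs.

Lemma div_abs_jet psi : smooth psi -> (exists d, 0 < d /\ forall x, Rabs x < d -> psi x = 0%C) ->
  exists g, jet g /\ forall u, g 0%nat u = div_abs psi u.
Proof.
  intros Hs [d [d0 Hv]]. destruct (smooth_jet psi Hs) as [g [Hg E]].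
  have Hv' : forall x, Rabs x < d -> g 0%nat x = 0%C by intros x Hx; rewrite E; apply Hv.
  exists (fun n => div_jet g n 0 0); split; [by apply (jet_div_jet g d)|] => u.
  rewrite (div_jet_0 g d) //. have -> : g 0%nat = psi by apply functional_extensionality. done.
Qed.

(* Composing with [clamp] turns a continuous function into a bounded one with the
   same integral, since the measure is concentrated on [-1, 1]. *)
Definition clamp (x : R) : R := (Rabs (x + 1) - Rabs (x - 1)) / 2.

Lemma clamp_bound x : Rabs (clamp x) <= 1.
Proof. rewrite /clamp; split_Rabs; lra. Qed.

Lemma clamp_id x : Rabs x <= 1 -> clamp x = x.
Proof. intros H; rewrite /clamp; split_Rabs; lra. Qed.

Lemma continuity_clamp (f : R -> R) : (forall x, continuity_pt f x) -> forall x, continuity_pt (fun x => f (clamp x)) x.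
Proof.
  intros Hf x. apply (continuity_pt_comp clamp f); [|apply Hf].
  apply continuity_pt_filterlim. apply (continuous_mult (K := R_AbsRing)); [|apply continuous_const].
  apply (continuous_minus (V := R_NormedModule)); apply continuous_Rabs_comp.
  - apply (continuous_plus (V := R_NormedModule)); [apply continuous_id|apply continuous_const].
  - apply (continuous_minus (V := R_NormedModule)); [apply continuous_id|apply continuous_const].
Qed.

Lemma clamp_bounded (f : R -> R) : (forall x, continuity_pt f x) -> exists M, forall x, Rabs (f (clamp x)) <= M.
Proof.
  intros Hf.
  destruct (contR_bounded (fun t => RtoC (f t)) (-1) 1) as [M [_ HM]].
    intros t; apply continuousC_RtoC; by apply continuity_pt_filterlim.
  exists M => x. rewrite -Cmod_R. apply HM. have := clamp_bound x; split_Rabs; lra.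
Qed.

Lemma contR_continuity_Re f : contR f -> forall x, continuity_pt (fun t => Re (f t)) x.
Proof. intros Hf x; apply continuity_pt_filterlim; by apply continuous_Re. Qed.

Lemma contR_continuity_Im f : contR f -> forall x, continuity_pt (fun t => Im (f t)) x.
Proof. intros Hf x; apply continuity_pt_filterlim; by apply continuous_Im. Qed.

(** * From a real functional to its complex extension *)

Section RealFunctional.
Variable I : (R -> R) -> R.
Hypothesis I_lin : forall f h a, (forall x, continuity_pt f x) -> (forall x, continuity_pt h x) ->
  I (fun x => f x + a * h x) = I f + a * I h.
Hypothesis I_bd : exists B, forall f M, (forall x, continuity_pt f x) ->
  (forall x, Rabs x <= 1 -> Rabs (f x) <= M) -> Rabs (I f) <= M * B.

Let P (f : R -> C) : C := (I (fun x => Re (f x)), I (fun x => Im (f x))).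

Lemma real_functional_lin f c h : contR f -> contR h ->
  P (fun x => f x + c * h x)%C = (P f + c * P h)%C.
Proof.
  intros Hf Hh.
  have fr := contR_continuity_Re f Hf. have fi := contR_continuity_Im f Hf.
  have hr := contR_continuity_Re h Hh. have hi := contR_continuity_Im h Hh.
  have step : forall u v w a b, (forall x, continuity_pt u x) -> (forall x, continuity_pt v x) ->
    (forall x, continuity_pt w x) -> I (fun x => (u x + a * v x) + b * w x) = I u + a * I v + b * I w.
    intros u v w a b Hu Hv Hw. rewrite (I_lin (fun x => u x + a * v x)) ?I_lin // => x.
    apply continuity_pt_plus => //. by apply continuity_pt_scal.
  apply injective_projections; rewrite /P.
  - rewrite -[LHS]/(I (fun x => Re (f x + c * h x))).
    have -> : (fun x => Re (f x + c * h x)) = (fun x => (Re (f x) + Re c * Re (h x)) + - Im c * Im (h x)).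
      apply functional_extensionality => x; rewrite /Re /Im /=; ring.
    rewrite step // /Re /Im /=; ring.
  - rewrite -[LHS]/(I (fun x => Im (f x + c * h x))).
    have -> : (fun x => Im (f x + c * h x)) = (fun x => (Im (f x) + Re c * Im (h x)) + Im c * Re (h x)).
      apply functional_extensionality => x; rewrite /Re /Im /=; ring.
    rewrite step // /Re /Im /=; ring.
Qed.

Lemma real_functional_representation z z' : admissible z z' ->
  (forall l, sigma1_moment z z' l = RtoC (I (fun x => x ^ l))) ->
  forall psi g, jet g -> (forall u, g 0%nat u = psi u) ->
  P psi = (cgamma (z * z' + 1) * rhs_distr z z' psi)%C.
Proof.
  intros Hadm Hmom. apply moment_representation => //; [apply real_functional_lin| |].
  - destruct I_bd as [B HB]. exists (2 * Rabs B); split; [have := Rabs_pos B; lra|] => f M Hf HM.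
    have M0 : 0 <= M by apply Rle_trans with (2 := HM 0 ltac:(rewrite Rabs_R0; lra)); apply Cmod_ge_0.
    have h1 := HB _ M (contR_continuity_Re f Hf) (fun x Hx => Rle_trans _ _ _ (re_le_Cmod _) (HM x Hx)).
    have h2 := HB _ M (contR_continuity_Im f Hf) (fun x Hx => Rle_trans _ _ _ (im_le_Cmod _) (HM x Hx)).
    have := Cmod_le_ReIm (P f). rewrite {2 3}/P /=. have := Rle_abs B. nra.
  - intros l; rewrite Hmom /P. apply injective_projections; simpl.
    + f_equal; apply functional_extensionality => x; by rewrite -RtoC_pow.
    (* The zero function is written so that linearity yields I 0 = I 0 - I 0 = 0. *)
    + have -> : (fun x => Im (RtoC x ^ l)) = (fun _ => 0 + -1 * 0).
        apply functional_extensionality => x; rewrite -RtoC_pow /=; ring.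
      have c0 : forall x, continuity_pt (fun _ => 0) x by intros x; apply continuity_pt_const.
      have := I_lin (fun _ => 0) (fun _ => 0) (-1) c0 c0 => ->; ring.
Qed.
End RealFunctional.

Local Close Scope general_if_scope.
Local Close Scope R_scope.

From mathcomp Require Import all_boot all_algebra all_classical all_reals.
From mathcomp Require Import all_analysis Rstruct Rstruct_topology measurable_realfun.

Lemma div_abs0 (psi : R -> C) : div_abs psi 0 = RtoC 0.
Proof. by rewrite /div_abs; case: RIneq.Req_EM_T. Qed.

Lemma div_absE (psi : R -> C) (x : R) : x <> R0 -> div_abs psi x = Cmult (RtoC (Rinv (Rabs x))) (psi x).
Proof. by move=> x0; rewrite /div_abs; case: RIneq.Req_EM_T. Qed.

(** * Integration against the controlling measure *)

Section SigmaIntegral.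
Local Open Scope classical_set_scope.
Local Open Scope ring_scope.
Import mathcomp.order.order.Order.TTheory GRing.Theory Num.Theory.

Variable sigma : {measure set (measurableTypeR R) -> \bar R}.
Hypothesis sigma_fin : (sigma setT < +oo)%E.
Hypothesis sigma_out : sigma [set x : R | (x < -1)%R \/ (1 < x)%R] = 0%E.

Lemma continuity_measurable (f : R -> R) : (forall x, continuity_pt f x) ->
  measurable_fun [set: measurableTypeR R] (f : measurableTypeR R -> measurableTypeR R).
Proof.
by move=> Hf; apply: (@continuous_measurable_fun R f) => x; apply/continuity_ptE.
Qed.

Lemma measurable_out : measurable ([set x : R | (x < -1)%R \/ (1 < x)%R] : set (measurableTypeR R)).
Proof.
apply: (@measurableU _ (measurableTypeR R) [set x : R | (x < -1)%R] [set x : R | (1 < x)%R]).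
- by apply: open_measurable; exact: open_lt.
- by apply: open_measurable; exact: open_gt.
Qed.

Lemma ae_eq_inside (f g : measurableTypeR R -> \bar R) :
  (forall x : R, Rle (Rabs x) 1 -> f x = g x) -> ae_eq sigma setT f g.
Proof.
move=> H; exists [set x : R | (x < -1)%R \/ (1 < x)%R]; split => //; first exact: measurable_out.
move=> x /=; apply: contra_notP => /not_orP[/negP h1 /negP h2] _.
by apply: H; apply/RleP; rewrite RabsE ler_norml !leNgt h1 h2.
Qed.

Lemma integral_clamp (f : R -> R) : (forall x, continuity_pt f x) ->
  (\int[sigma]_x (f x)%:E = \int[sigma]_x (f (clamp x))%:E)%E.
Proof.
move=> Hf; apply: ae_eq_integral => //.
- by apply/measurable_EFinP; exact: continuity_measurable.
- by apply/measurable_EFinP; apply: continuity_measurable; exact: continuity_clamp.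
- by apply: ae_eq_inside => x Hx; rewrite clamp_id.
Qed.

Lemma integrable_clamp (f : R -> R) : (forall x, continuity_pt f x) ->
  sigma.-integrable setT (EFin \o (fun x => f (clamp x))).
Proof.
move=> Hf; apply: measurable_bounded_integrable => //.
  by apply: continuity_measurable; exact: continuity_clamp.
have [M HM] := clamp_bounded f Hf.
exists M; split; rewrite ?num_real // => y My x _ /=.
by apply: le_trans (ltW My); rewrite -RabsE; apply/RleP; apply: HM.
Qed.

(** [fine] sends infinite values to 0, so linearity is not automatic. It is obtained after passing
    to [f (clamp x)], which is bounded and hence integrable against a finite measure. *)
Definition sigma_int (f : R -> R) : R := fine (\int[sigma]_x (f x)%:E)%E.

Lemma sigma_int_clamp (f : R -> R) : (forall x, continuity_pt f x) ->
  sigma_int f = Rintegral sigma setT (fun x => f (clamp x)).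
Proof. by move=> Hf; rewrite /sigma_int integral_clamp. Qed.

Lemma sigma_int_lin (f g : R -> R) (a : R) : (forall x, continuity_pt f x) -> (forall x, continuity_pt g x) ->
  sigma_int (fun x => Rplus (f x) (Rmult a (g x))) = Rplus (sigma_int f) (Rmult a (sigma_int g)).
Proof.
move=> Hf Hg.
have Hag x : continuity_pt (fun x => Rmult a (g x)) x.
  by apply: continuity_pt_mult => //; apply: continuity_pt_const.
have Hfg x : continuity_pt (fun x => Rplus (f x) (Rmult a (g x))) x.
  exact: continuity_pt_plus.
rewrite !sigma_int_clamp // RplusE RmultE -RintegralZl //; last exact: integrable_clamp.
rewrite -RintegralD //; first exact: integrable_clamp.
exact: (integrable_clamp (fun x => Rmult a (g x))).
Qed.

Lemma sigma_int_bound (f : R -> R) (M : R) : (forall x, continuity_pt f x) ->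
  (forall x, Rle (Rabs x) 1 -> Rle (Rabs (f x)) M) ->
  Rle (Rabs (sigma_int f)) (Rmult M (fine (sigma setT))).
Proof.
move=> Hf HM; rewrite sigma_int_clamp //.
have If := integrable_clamp f Hf.
apply/RleP; rewrite RabsE RmultE; apply: (le_trans (le_normr_Rintegral _ _)) => //.
rewrite -Rintegral_cst //; apply: le_Rintegral => //.
- exact: (integrable_norm If).
- apply: measurable_bounded_integrable => //; exists `|M|; split; rewrite ?num_real // => y My x _ /=.
  exact: ltW.
- by move=> x _; rewrite -RabsE; apply/RleP; apply: HM; apply: clamp_bound.
Qed.

End SigmaIntegral.

(** * The pairings with the controlling measure and its density *)

Section PairMeasure.
Local Open Scope classical_set_scope.
Local Open Scope ring_scope.
Import mathcomp.order.order.Order.TTheory GRing.Theory Num.Theory.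

Variables (z z' : C) (sigma : {measure set (measurableTypeR R) -> \bar R}).
Hypothesis Hs : is_sigma1 z z' sigma.

Lemma sigma1_out : sigma [set x : R | (x < -1)%R \/ (1 < x)%R] = 0%E.
Proof. exact: (proj1 Hs). Qed.

(** The zeroth moment is the total mass, and [is_sigma1] makes it a real number. *)
Lemma sigma1_fin : (sigma setT < +oo)%E.
Proof.
have [H _] := proj2 Hs 0%N.
have <- : (\int[sigma]_x (pow x 0)%:E = sigma setT)%E.
  by rewrite /= integral_cst // mul1e.
by rewrite H ltry.
Qed.

Lemma sigma1_int_moment (l : nat) : sigma1_moment z z' l = RtoC (sigma_int sigma (fun x => pow x l)).
Proof.
have [Hr Hi] := proj2 Hs l.
by apply: injective_projections; rewrite /sigma_int ?Hr //=.
Qed.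

Lemma pair_measure_representation (psi : R -> C) (g : nat -> R -> C) : admissible z z' -> jet g ->
  (forall u, g 0%N u = psi u) ->
  pair_measure sigma psi = Cmult (cgamma (Cplus (Cmult z z') (RtoC 1))) (rhs_distr z z' psi).
Proof.
move=> Hadm Hg E.
have lin f h a := sigma_int_lin sigma sigma1_fin sigma1_out f h a.
apply: (real_functional_representation (sigma_int sigma) lin _ z z' Hadm sigma1_int_moment psi g Hg E).
exists (fine (sigma setT)) => f M; exact: (sigma_int_bound sigma sigma1_fin sigma1_out).
Qed.

Lemma measurable_Iset : measurable (Iset : set (measurableTypeR R)).
Proof.
have -> : Iset = ~` [set 0%R : R] `&` ~` [set x : R | (x < -1)%R \/ (1 < x)%R].
  apply/seteqP; split => x.
    move=> [x0 [h1 h2]]; split => //= -[]; apply/negP; by rewrite -leNgt.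
  move=> [x0 /not_orP[/negP h1 /negP h2]]; split => //; split; by rewrite leNgt.
apply: measurableI; apply: measurableC; last exact: measurable_out.
exact: (@measurable_set1 R 0).
Qed.

(** On [-1, 1] the integrand restricted to [Iset] coincides with [h], also at the excluded point 0,
    where [h] vanishes: an atom of the measure at 0 contributes nothing to either side. *)
Lemma sigma_int_Iset (f h : R -> R) : (forall x, continuity_pt f x) -> (forall x, continuity_pt h x) ->
  h 0 = 0 -> (forall x, x <> 0 -> h x = Rmult (Rinv (Rabs x)) (f x)) ->
  fine (\int[sigma]_(x in Iset) (f x / Rabs x)%:E)%E = sigma_int sigma h.
Proof.
move=> cf ch h0 hE; congr fine.
have mh : measurable_fun [set: measurableTypeR R] (EFin \o h).
  by apply/measurable_EFinP; exact: continuity_measurable.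
have EI : forall x, Iset x -> (f x / Rabs x)%:E = (h x)%:E.
  by move=> x [x0 _]; rewrite hE // RmultE RinvE mulrC.
rewrite (@eq_integral _ (measurableTypeR R) R sigma Iset (fun x => (h x)%:E)); last by move=> x /set_mem; exact: EI.
rewrite integral_mkcond; apply: ae_eq_integral => //.
  apply/(measurable_restrictT _ measurable_Iset).
  exact: measurable_funS mh.
apply: (ae_eq_inside sigma sigma1_out) => x Hx; rewrite patchE.
case: ifPn => // /negP xI; rewrite /=.
have [->|/eqP x0] := eqVneq x 0; first by rewrite h0.
exfalso; apply: xI; apply/mem_set; split=> //.
by move/RleP: Hx; rewrite RabsE ler_norml => /andP.
Qed.

End PairMeasure.

Theorem theorem5p8 (z z' : C)
    (sigma : {measure set (measurableTypeR R) -> \bar R}%R) :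
  admissible z z' ->
  is_sigma1 z z' sigma ->
  (forall psi : R -> C, smooth psi ->
     pair_measure sigma psi
     = Cmult (cgamma (Cplus (Cmult z z') (RtoC 1))) (rhs_distr z z' psi)) /\
  (forall psi : R -> C, smooth psi -> vanishes_near0 psi ->
     pair_density sigma psi
     = Cmult (cgamma (Cplus (Cmult z z') (RtoC 1))) (rhs_distr z z' (div_abs psi))).
Proof.
move=> Hadm Hs; split => psi Hpsi.
  have [g [Hg E]] := smooth_jet psi Hpsi.
  exact: (pair_measure_representation z z' sigma Hs psi g Hadm Hg E).
move=> [d [d0 Hd]].
have Hv : exists d, Rlt 0 d /\ forall x, Rlt (Rabs x) d -> psi x = RtoC 0.
  by exists d; split => [|x /RltP]; [apply/RltP|exact: Hd].
have [g [Hg E]] := smooth_jet psi Hpsi.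
have [h [Hh Eh]] := div_abs_jet psi Hpsi Hv.
(* The identity for the measure is used at the test function psi / |x|; it remains to move the
   factor 1 / |x| into the density. *)
rewrite -(pair_measure_representation z z' sigma Hs (div_abs psi) h Hadm Hh Eh).
have cg : contR psi by rewrite -(functional_extensionality _ _ E); exact: jet_contR.
have ch : contR (div_abs psi) by rewrite -(functional_extensionality _ _ Eh); exact: jet_contR.
congr pair.
- apply: (sigma_int_Iset z z' sigma Hs (fun x => Coquelicot.Complex.Re (psi x)) (fun x => Coquelicot.Complex.Re (div_abs psi x))).
  + exact: contR_continuity_Re.
  + exact: contR_continuity_Re.
  + by rewrite div_abs0.
  + by move=> x x0; rewrite div_absE // re_scal_l.
- apply: (sigma_int_Iset z z' sigma Hs (fun x => Coquelicot.Complex.Im (psi x)) (fun x => Coquelicot.Complex.Im (div_abs psi x))).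
  + exact: contR_continuity_Im.
  + exact: contR_continuity_Im.
  + by rewrite div_abs0.
  + by move=> x x0; rewrite div_absE // im_scal_l.
Qed.
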